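(* Let $Y$ be a diagonal doubly-resonant saddle-node in $(\mathbb{C}^3,0)$ which is transversally Hamiltonian with respect to $\omega=\frac{\mathrm dy_1\wedge\mathrm dy_2}{x}$ and $\mathrm dx$. Let $\hat\Phi$ be the unique formal fibered transversally symplectic diffeomorphism tangent to the identity conjugating $Y$ to its normal form $$Y_{\mathrm{norm}}=x^2\frac{\partial}{\partial x}+(-\lambda+a_1x-c(y_1y_2))y_1\frac{\partial}{\partial y_1}+(\lambda+a_2x+c(y_1y_2))y_2\frac{\partial}{\partial y_2},\qquad a_1+a_2=1,\ c(v)\in v\,\mathbb{C}[[v]].$$ Then the sectorial normalizing maps $\Phi_+$ and $\Phi_-$ of $Y$ associated with $\hat\Phi$ are also transversally symplectic.
   Context: Coordinates on $\mathbb{C}^3$ are $(x,\mathbf y)=(x,y_1,y_2)$; $(\mathbb{C}^2,0)$ denotes an arbitrarily small neighborhood of $0$. $\Phi_*(Y)=(\mathrm{D}\Phi\cdot Y)\circ\Phi^{-1}$; fibered means of the form $(x,\mathbf y)\mapsto(x,\phi(x,\mathbf y))$. A diagonal doubly-resonant saddle-node is a germ of analytic vector field $Y=x^2\partial_x+(-\lambda y_1+F_1)\partial_{y_1}+(\lambda y_2+F_2)\partial_{y_2}$ with $\lambda\in\mathbb{C}^*$ and $F_1,F_2\in\mathbb{C}\{x,\mathbf y\}$ of order at least two. Let $\omega=\frac{\mathrm dy_1\wedge\mathrm dy_2}{x}$ and let $\langle\mathrm dx\rangle$ be the ideal generated by $\mathrm dx$ in the algebra of differential forms (meromorphic with poles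 only on $\{x=0\}$; or holomorphic over a sector in the $x$-variable not containing $0$; or their formal analogue). A vector field $Y$ is transversally Hamiltonian if $\mathcal L_Y(\mathrm dx)\in\langle\mathrm dx\rangle$ and $\mathcal L_Y(\omega)\in\langle\mathrm dx\rangle$. A (formal, analytic or sectorial) fibered diffeomorphism $\Phi$ is transversally symplectic if $\Phi^*(\omega)\in\omega+\langle\mathrm dx\rangle$; for fibered $\Phi$ this is equivalent to $\det(\mathrm D\Phi)=1$. Known facts used to define the objects: for $Y$ diagonal and transversally Hamiltonian, $\hat\Phi$ as in the claim exists and is unique (an earlier theorem); moreover $Y$ then has residue $1$ and its restriction to $\{x=0\}$ is analytically orbitally linearizable, so the following holds. For every $\epsilon\in]0,\frac\pi2[$ and some $r>0$, with $S_\pm=\{0<|x|<r,\ |\arg(\pm x/(i\lambda))|<\frac\pi2+\epsilon\}$, there are unique germs $\Phi_\pm$ of analytic sectorial fibered diffeomorphisms in $S_\pm\times(\mathbb{C}^2,0)$, tangent to the identity (i.e. $\Phi_\pm(x,\mathbf y)-(x,\mathbf y)=O(\|(x,\mathbf y)\|^2)$ as $(x,\mathbf y)\to 0$), with $(\Phi_\pm)_*(Y)=Y_{\mathrm{norm}}$; these are the sectorial normalizing maps, and they are the 1-sums (Borel–Laplace sums in the variable $x$) of $\hat\Phi$ in the directions $\arg(\pm i\lambda)$. *)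

(* Defs.v *)
From Stdlib Require Import Reals Arith Bool.
From Coquelicot Require Import Coquelicot.

Open Scope C_scope.

Inductive coord := cx | cy1 | cy2.

Definition C3 : Type := (C * C * C)%type.

Definition co (p : C3) (i : coord) : C :=
  match i with cx => fst (fst p) | cy1 => snd (fst p) | cy2 => snd p end.

Definition upd (p : C3) (i : coord) (t : C) : C3 :=
  match i with
  | cx => (t, co p cy1, co p cy2)
  | cy1 => (co p cx, t, co p cy2)
  | cy2 => (co p cx, co p cy1, t)
  end.

Definition sub3 (q p : C3) : C3 :=
  (co q cx - co p cx, co q cy1 - co p cy1, co q cy2 - co p cy2).

Definition norm3 (p : C3) : R :=
  Rmax (Cmod (co p cx)) (Rmax (Cmod (co p cy1)) (Cmod (co p cy2))).

(* A formal power series: [f i j k] is the coefficient of x^i y1^j y2^k. *)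

Definition fps : Type := nat -> nat -> nat -> C.

Definition feq (f g : fps) : Prop := forall i j k, f i j k = g i j k.

Definition fcst (a : C) : fps :=
  fun i j k => if (i + j + k =? 0)%nat then a else 0.

Definition fvar (v : coord) : fps := fun i j k =>
  match v, i, j, k with
  | cx, 1%nat, 0%nat, 0%nat => 1
  | cy1, 0%nat, 1%nat, 0%nat => 1
  | cy2, 0%nat, 0%nat, 1%nat => 1
  | _, _, _, _ => 0
  end.

Definition fadd (f g : fps) : fps := fun i j k => f i j k + g i j k.

Definition fopp (f : fps) : fps := fun i j k => - f i j k.

(* [sum_n a n] is a 0 + ... + a n, with n+1 terms. *)
Definition csum3 (f : fps) (l m n : nat) : C :=
  sum_n (fun i => sum_n (fun j => sum_n (fun k => f i j k) n) m) l.

Definition fmul (f g : fps) : fps := fun i j k =>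
  csum3 (fun i' j' k' => f i' j' k' * g (i - i')%nat (j - j')%nat (k - k')%nat)
    i j k.

Fixpoint fpow (f : fps) (n : nat) : fps :=
  match n with 0%nat => fcst 1 | S m => fmul f (fpow f m) end.

Definition fD (v : coord) (f : fps) : fps := fun i j k =>
  match v with
  | cx => INR (S i) * f (S i) j k
  | cy1 => INR (S j) * f i (S j) k
  | cy2 => INR (S k) * f i j (S k)
  end.

(* Substitution f(g_x, g_y1, g_y2). It is meant for g without constant terms:
   then only the monomials of f of degree at most i+j+k contribute to the
   coefficient (i,j,k), so that the truncated sum is exact. *)
Definition fcomp (f : fps) (g : coord -> fps) : fps := fun i j k =>
  let n := (i + j + k)%nat in
  csum3 (fun a b c =>
    f a b c *
    fmul (fpow (g cx) a) (fmul (fpow (g cy1) b) (fpow (g cy2) c)) i j k) n n n.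

Definition order_ge (m : nat) (f : fps) : Prop :=
  forall i j k, (i + j + k < m)%nat -> f i j k = 0.

Definition abs_summable (f : fps) (r : R) : Prop :=
  exists M : R, forall n : nat,
    (sum_n (fun i => sum_n (fun j => sum_n (fun k =>
       Cmod (f i j k) * r ^ (i + j + k)) n) n) n <= M)%R.

Definition convergent (f : fps) : Prop :=
  exists r : R, (0 < r)%R /\ abs_summable f r.

Definition partial_sum (f : fps) (p : C3) (n : nat) : C :=
  csum3 (fun i j k =>
    f i j k * (Cpow (co p cx) i * Cpow (co p cy1) j * Cpow (co p cy2) k)) n n n.

(* The value at p, for p in a polydisc on which f is absolutely summable. *)
Definition psum (f : fps) (p : C3) : C :=
  (real (Lim_seq (fun n => fst (partial_sum f p n))),
   real (Lim_seq (fun n => snd (partial_sum f p n)))).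

(* U is meant to be open. *)
Definition analytic_on (U : C3 -> Prop) (f : C3 -> C) : Prop :=
  forall p, U p -> exists (a : fps) (r : R),
    (0 < r)%R /\ abs_summable a r /\
    forall q, (norm3 (sub3 q p) < r)%R -> f q = psum a (sub3 q p).

Definition partial (i : coord) (f : C3 -> C) : C3 -> C :=
  fun p => C_derive (fun t => f (upd p i t)) (co p i).

(* Elements are compared up to [ceq], and only those satisfying [creg] are
   coefficients of actual forms. *)
Record coef_alg := CoefAlg {
  car :> Type;
  ceq : car -> car -> Prop;
  creg : car -> Prop;
  czero : car;
  cone : car;
  cadd : car -> car -> car;
  copp : car -> car;
  cmul : car -> car -> car;
  cD : coord -> car -> car;
  cinvx : car
}.
Arguments ceq {c}.
Arguments creg {c}.
Arguments czero {c}.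
Arguments cone {c}.
Arguments cadd {c}.
Arguments copp {c}.
Arguments cmul {c}.
Arguments cD {c}.

(* [Laurent n f] stands for x^(-n) f. *)
Record laurent := Laurent { pole : nat; numer : fps }.

Definition xmul (n : nat) (f : fps) : fps := fmul (fpow (fvar cx) n) f.

Definition of_fps (f : fps) : laurent := Laurent 0 f.

Definition leq (a b : laurent) : Prop :=
  feq (xmul (pole b) (numer a)) (xmul (pole a) (numer b)).

Definition ladd (a b : laurent) : laurent :=
  Laurent (pole a + pole b)
    (fadd (xmul (pole b) (numer a)) (xmul (pole a) (numer b))).

Definition lopp (a : laurent) : laurent := Laurent (pole a) (fopp (numer a)).

Definition lmul (a b : laurent) : laurent :=
  Laurent (pole a + pole b) (fmul (numer a) (numer b)).

(* d/dx (x^(-n) f) = x^(-n-1) (x f' - n f) *)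
Definition lD (i : coord) (a : laurent) : laurent :=
  match i with
  | cx => Laurent (S (pole a))
            (fadd (xmul 1 (fD cx (numer a)))
                  (fmul (fcst (- INR (pole a))) (numer a)))
  | _ => Laurent (pole a) (fD i (numer a))
  end.

Definition laurent_alg (reg : laurent -> Prop) : coef_alg :=
  CoefAlg laurent leq reg (of_fps (fcst 0)) (of_fps (fcst 1))
    ladd lopp lmul lD (Laurent 1 (fcst 1)).

(* C[[x,y]][1/x] *)
Definition formal_alg : coef_alg := laurent_alg (fun _ => True).

(* C{x,y}[1/x] *)
Definition mero_alg : coef_alg := laurent_alg (fun a => convergent (numer a)).

Definition analytic_alg (U : C3 -> Prop) : coef_alg :=
  CoefAlg (C3 -> C) (fun f g => forall p, U p -> f p = g p) (analytic_on U)
    (fun _ => 0) (fun _ => 1)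
    (fun f g p => f p + g p) (fun f p => - f p) (fun f g p => f p * g p)
    partial (fun p => / co p cx).

(* A form is given by its components on the coordinate vector fields:
   [beta i j] is beta(d/di, d/dj). Forms of degree 2 and 3 are alternating. *)
Definition form1 (A : coef_alg) : Type := coord -> A.
Definition form2 (A : coef_alg) : Type := coord -> coord -> A.
Definition form3 (A : coef_alg) : Type := coord -> coord -> coord -> A.

Definition csub {A : coef_alg} (a b : A) : A := cadd a (copp b).

Definition csum {A : coef_alg} (f : coord -> A) : A :=
  cadd (cadd (f cx) (f cy1)) (f cy2).

Definition dcoord {A : coef_alg} (v : coord) : form1 A := fun i =>
  match v, i with
  | cx, cx | cy1, cy1 | cy2, cy2 => cone
  | _, _ => czero
  end.

Definition wedge11 {A : coef_alg} (a b : form1 A) : form2 A :=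
  fun i j => csub (cmul (a i) (b j)) (cmul (a j) (b i)).

Definition d0 {A : coef_alg} (f : A) : form1 A := fun i => cD i f.

Definition d1 {A : coef_alg} (a : form1 A) : form2 A :=
  fun i j => csub (cD i (a j)) (cD j (a i)).

Definition d2 {A : coef_alg} (b : form2 A) : form3 A :=
  fun i j k => cadd (csub (cD i (b j k)) (cD j (b i k))) (cD k (b i j)).

Definition iota1 {A : coef_alg} (Y : coord -> A) (a : form1 A) : A :=
  csum (fun i => cmul (Y i) (a i)).

Definition iota2 {A : coef_alg} (Y : coord -> A) (b : form2 A) : form1 A :=
  fun j => csum (fun i => cmul (Y i) (b i j)).

Definition iota3 {A : coef_alg} (Y : coord -> A) (g : form3 A) : form2 A :=
  fun j k => csum (fun i => cmul (Y i) (g i j k)).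

(* Cartan's formula, L_Y = i_Y d + d i_Y. *)
Definition lie1 {A : coef_alg} (Y : coord -> A) (a : form1 A) : form1 A :=
  fun i => cadd (iota2 Y (d1 a) i) (d0 (iota1 Y a) i).

Definition lie2 {A : coef_alg} (Y : coord -> A) (b : form2 A) : form2 A :=
  fun i j => cadd (iota3 Y (d2 b) i j) (d1 (iota2 Y b) i j).

(* Pull-back by the map of components [Phi], where [comp f] is f o Phi. *)
Definition pullback2 {A : coef_alg} (Phi : coord -> A) (comp : A -> A)
    (b : form2 A) : form2 A :=
  fun k l => csum (fun i => csum (fun j =>
    cmul (comp (b i j)) (cmul (cD k (Phi i)) (cD l (Phi j))))).

(* The elements of degree 1 and 2 of the ideal generated by dx. *)
Definition in_dx1 {A : coef_alg} (a : form1 A) : Prop :=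
  exists f : A, creg f /\ forall i, ceq (a i) (cmul f (dcoord cx i)).

Definition in_dx2 {A : coef_alg} (b : form2 A) : Prop :=
  exists th : form1 A, (forall i, creg (th i)) /\
    forall i j, ceq (b i j) (wedge11 (dcoord cx) th i j).

Definition omega (A : coef_alg) : form2 A :=
  fun i j => cmul (cinvx A) (wedge11 (dcoord cy1) (dcoord cy2) i j).

Definition preserves_omega {A : coef_alg} (Phi : coord -> A) (comp : A -> A) :=
  in_dx2 (fun i j => csub (pullback2 Phi comp (omega A) i j) (omega A i j)).

Definition vfield : Type := coord -> fps.

Definition diagonal_drsn (lam : C) (Y : vfield) : Prop :=
  lam <> 0 /\
  exists F1 F2 : fps,
    convergent F1 /\ convergent F2 /\ order_ge 2 F1 /\ order_ge 2 F2 /\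
    feq (Y cx) (fmul (fvar cx) (fvar cx)) /\
    feq (Y cy1) (fadd (fmul (fcst (- lam)) (fvar cy1)) F1) /\
    feq (Y cy2) (fadd (fmul (fcst lam) (fvar cy2)) F2).

Definition transversally_hamiltonian (Y : vfield) : Prop :=
  let Y' : coord -> mero_alg := fun i => of_fps (Y i) in
  in_dx1 (lie1 Y' (dcoord cx)) /\ in_dx2 (lie2 Y' (omega mero_alg)).

(* The series c(y1 y2), where c(v) = sum_n c_n v^n. *)
Definition fresonant (c : nat -> C) : fps :=
  fun i j k => if ((i =? 0) && (j =? k))%nat then c j else 0.

Definition Ynorm (lam a1 a2 : C) (c : nat -> C) : vfield := fun i =>
  match i with
  | cx => fmul (fvar cx) (fvar cx)
  | cy1 => fmul (fadd (fadd (fcst (- lam)) (fmul (fcst a1) (fvar cx)))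
                      (fopp (fresonant c)))
                (fvar cy1)
  | cy2 => fmul (fadd (fadd (fcst lam) (fmul (fcst a2) (fvar cx)))
                      (fresonant c))
                (fvar cy2)
  end.

Definition formal_fibered (Phi : coord -> fps) : Prop :=
  feq (Phi cx) (fvar cx).

Definition formal_tangent_id (Phi : coord -> fps) : Prop :=
  forall i, order_ge 2 (fadd (Phi i) (fopp (fvar i))).

(* Phi_* Y = Z, with both sides composed with Phi. *)
Definition formal_conj (Phi : coord -> fps) (Y Z : vfield) : Prop :=
  forall i,
    feq (fadd (fadd (fmul (fD cx (Phi i)) (Y cx)) (fmul (fD cy1 (Phi i)) (Y cy1)))
              (fmul (fD cy2 (Phi i)) (Y cy2)))
        (fcomp (Z i) Phi).

(* The composition law used here, (x^(-n) f) o Phi = x^(-n) (f o Phi), is the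
   one of fibered maps. *)
Definition formal_symplectic (Phi : coord -> fps) : Prop :=
  preserves_omega (A := formal_alg) (fun i => of_fps (Phi i))
    (fun a => Laurent (pole a) (fcomp (numer a) Phi)).

(* s = 1 or -1; since pi/2 + eps < pi, t is the principal argument of
   s x / (i lam). *)
Definition sector (s lam : C) (r eps : R) (x : C) : Prop :=
  x <> 0 /\ (Cmod x < r)%R /\
  exists t : R, (Rabs t < PI / 2 + eps)%R /\
    let z := s * x / (Ci * lam) in z = Cmod z * (cos t, sin t).

Definition sector_dom (s lam : C) (r eps rho : R) (p : C3) : Prop :=
  sector s lam r eps (co p cx) /\
  (Cmod (co p cy1) < rho)%R /\ (Cmod (co p cy2) < rho)%R.

Definition image (U : C3 -> Prop) (Phi : C3 -> C3) (q : C3) : Prop :=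
  exists p, U p /\ q = Phi p.

Definition fibered_on (U : C3 -> Prop) (Phi : C3 -> C3) : Prop :=
  forall p, U p -> co (Phi p) cx = co p cx.

(* Phi is biholomorphic from U onto its image. *)
Definition analytic_diffeo_on (U : C3 -> Prop) (Phi : C3 -> C3) : Prop :=
  (forall i, analytic_on U (fun p => co (Phi p) i)) /\
  exists Psi : C3 -> C3,
    (forall p, U p -> Psi (Phi p) = p) /\
    forall i, analytic_on (image U Phi) (fun q => co (Psi q) i).

Definition tangent_id_on (U : C3 -> Prop) (Phi : C3 -> C3) : Prop :=
  exists M delta : R, (0 < delta)%R /\
    forall p, U p -> (norm3 p < delta)%R ->
      (norm3 (sub3 (Phi p) p) <= M * norm3 p ^ 2)%R.

Definition converges_on (U : C3 -> Prop) (Y : vfield) : Prop :=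
  exists r : R, (forall i, abs_summable (Y i) r) /\
    forall p, U p -> (norm3 p < r)%R.

(* Phi_* Y = Z on the image of U, with both sides composed with Phi. *)
Definition conj_on (U : C3 -> Prop) (Phi : C3 -> C3) (Y Z : vfield) : Prop :=
  converges_on U Y /\ converges_on (image U Phi) Z /\
  forall p, U p -> forall i,
    let DPhi j := partial j (fun q => co (Phi q) i) p in
    DPhi cx * psum (Y cx) p + DPhi cy1 * psum (Y cy1) p
      + DPhi cy2 * psum (Y cy2) p
    = psum (Z i) (Phi p).

Definition symplectic_on (U : C3 -> Prop) (Phi : C3 -> C3) : Prop :=
  preserves_omega (A := analytic_alg U) (fun i p => co (Phi p) i)
    (fun f p => f (Phi p)).

(* Z is the normal form shared with the formal map; its convergence, which
   gives a meaning to the equation, is part of [conj_on].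
   A germ of map on a sectorial domain is given by a representative, on a
   domain small enough for all the conditions to make sense on it. *)
Definition sectorial_normalizing (U : C3 -> Prop) (Y Z : vfield)
    (Phi : C3 -> C3) : Prop :=
  fibered_on U Phi /\ analytic_diffeo_on U Phi /\ tangent_id_on U Phi /\
  conj_on U Phi Y Z.

(* Main.v *)
Require Import Defs.
From Stdlib Require Import Reals.
From Coquelicot Require Import Coquelicot.
From Stdlib Require Import Lra Lia List Bool Arith ZArith Permutation Classical.
Import ListNotations.

(** Let [D] be the determinant of the [y]-derivative of a sectorial normalizing map.
    Both [Y] and [Ynorm] have [y]-divergence [x] (for [Y] this is the transversally
    Hamiltonian condition), so differentiating the conjugacy equation gives [Y D = 0].
    Tangency to the identity and the Cauchy estimate give [D -> 1] at the origin, and also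
    that the image of the map contains a small sectorial polydisc.  There the trajectories
    of [Ynorm] through an open set of points can be followed explicitly, in complex time,
    down to the origin: [y1 y2 / x] is constant, and a time path along which
    [Re (lam / x)] varies logarithmically keeps [y1] and [y2] both of size [|x|^(1/2)].
    Hence [D = 1] on an open set, and everywhere by the identity theorem along segments of
    the sectorial domain. *)

Open Scope C_scope.

(** * Sums over cubes of indices *)

(** [Y D = 0] alone does not make [D] constant: the normal form itself has the first integral
    [y1 y2 / x], analytic on the sectorial domain. What is known of [D] is its limit at the origin,
    and this limit has to be carried along trajectories that end at the origin without leaving the
    domain. On the normal form, [y1] behaves like exp(lam/x) x^a1 and [y2] like exp(-lam/x) x^a2; on
    a ray where Re (lam/x) is unbounded, one of the exponentials explodes. The path must therefore
    follow the bisector of the sector, where lam/x is imaginary. There |y1| and |y2| are of order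
    |x|^(Re a1) and |x|^(Re a2), and one of these exponents may be negative; but their sum is 1
    because [a1 + a2 = 1], and a drift of Re (lam/x) proportional to log |x| redistributes them
    equally. Trajectories are followed in the target, where they are explicit, and pulled back by
    the inverse map. This is why the image has to contain a sectorial polydisc, and why [D] must be
    nonzero there: invertibility turns a trajectory of the normal form into one of [Y]. *)

Lemma Cmod_sub_comm (x y : C) : Cmod (x - y) = Cmod (y - x).
Proof. rewrite <- Cmod_opp. f_equal. ring. Qed.

Lemma Cmod_triangle_sub (x y z : C) : (Cmod (x - z) <= Cmod (x - y) + Cmod (y - z))%R.
Proof. replace (x - z) with ((x - y) + (y - z)) by ring. apply Cmod_triangle. Qed.

Lemma Cmod_triangle_rev (x y : C) : (Cmod x - Cmod y <= Cmod (x - y))%R.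
Proof.
  assert (H := Cmod_triangle (x - y) y).
  replace (x - y + y) with x in H by ring. lra.
Qed.

Lemma Cmod_minus_le (x y : C) : (Cmod (x - y) <= Cmod x + Cmod y)%R.
Proof. unfold Cminus. rewrite <- (Cmod_opp y). apply Cmod_triangle. Qed.

Lemma Im_le_Cmod (c : C) : (Rabs (snd c) <= Cmod c)%R.
Proof. eapply Rle_trans; [apply Rmax_r | apply Rmax_Cmod]. Qed.

Lemma Re_le_Cmod (c : C) : (Rabs (fst c) <= Cmod c)%R.
Proof. eapply Rle_trans; [apply Rmax_l | apply Rmax_Cmod]. Qed.

Lemma Cmod_le_Re_Im (c : C) : (Cmod c <= Rabs (fst c) + Rabs (snd c))%R.
Proof.
  assert (E : c = RtoC (fst c) + Ci * RtoC (snd c)) by (apply injective_projections; simpl; ring).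
  rewrite E at 1. eapply Rle_trans; [apply Cmod_triangle|].
  rewrite Cmod_mult, Cmod_Ci, !Cmod_R. lra.
Qed.

Fixpoint csum_list {A} (l : list A) (u : A -> C) : C :=
  match l with [] => 0 | a :: l' => u a + csum_list l' u end.

Fixpoint rsum_list {A} (l : list A) (u : A -> R) : R :=
  match l with [] => 0 | a :: l' => u a + rsum_list l' u end.

Lemma csum_list_ext {A} (l : list A) u v :
  (forall a, In a l -> u a = v a) -> csum_list l u = csum_list l v.
Proof.
  induction l as [|a l IH]; simpl; intros H; auto.
  rewrite H by auto. rewrite IH; auto.
Qed.

Lemma csum_list_plus {A} (l : list A) u v :
  csum_list l (fun a => u a + v a) = csum_list l u + csum_list l v.
Proof. induction l as [|a l IH]; simpl; [ring | rewrite IH; ring]. Qed.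

Lemma csum_list_scal {A} (l : list A) k u :
  csum_list l (fun a => k * u a) = k * csum_list l u.
Proof. induction l as [|a l IH]; simpl; [ring | rewrite IH; ring]. Qed.

Lemma csum_list_zero {A} (l : list A) (u : A -> C) :
  (forall a, In a l -> u a = 0) -> csum_list l u = 0.
Proof.
  induction l as [|a l IH]; simpl; intros H; auto.
  rewrite H by auto. rewrite IH by auto. ring.
Qed.

Lemma csum_list_app {A} (l l' : list A) u :
  csum_list (l ++ l') u = csum_list l u + csum_list l' u.
Proof. induction l as [|a l IH]; simpl; [ring | rewrite IH; ring]. Qed.

Lemma csum_list_map {A B} (f : A -> B) (l : list A) u :
  csum_list (map f l) u = csum_list l (fun a => u (f a)).
Proof. induction l as [|a l IH]; simpl; [auto | rewrite IH; auto]. Qed.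

Lemma csum_list_prod {A B} (l : list A) (l' : list B) u :
  csum_list (list_prod l l') u = csum_list l (fun a => csum_list l' (fun b => u (a, b))).
Proof.
  induction l as [|a l IH]; simpl; auto.
  rewrite csum_list_app, IH, csum_list_map. auto.
Qed.

Lemma csum_list_swap {A B} (l : list A) (l' : list B) u :
  csum_list l (fun a => csum_list l' (fun b => u a b))
  = csum_list l' (fun b => csum_list l (fun a => u a b)).
Proof.
  induction l as [|a l IH]; simpl.
  - symmetry. apply csum_list_zero. auto.
  - rewrite IH. rewrite <- csum_list_plus. auto.
Qed.

Lemma csum_list_single {A} (l : list A) a0 (u : A -> C) :
  NoDup l -> In a0 l -> (forall a, In a l -> a <> a0 -> u a = 0) ->
  csum_list l u = u a0.
Proof.
  induction l as [|a l IH]; simpl; intros ND Hin H; [tauto|].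
  inversion ND as [|? ? Hn ND']; subst.
  destruct Hin as [->|Hin].
  - rewrite csum_list_zero; [ring|].
    intros b Hb. apply H; auto. intros ->. auto.
  - rewrite IH; auto. rewrite H; [ring|auto|]. intros ->. auto.
Qed.

Lemma rsum_list_le {A} (l : list A) u v :
  (forall a, In a l -> (u a <= v a)%R) -> (rsum_list l u <= rsum_list l v)%R.
Proof.
  induction l as [|a l IH]; simpl; intros H; [lra|].
  assert (H1 := H a (or_introl eq_refl)). assert (rsum_list l u <= rsum_list l v)%R by auto. lra.
Qed.

Lemma rsum_list_ext {A} (l : list A) u v :
  (forall a, In a l -> u a = v a) -> rsum_list l u = rsum_list l v.
Proof.
  induction l as [|a l IH]; simpl; intros H; auto.
  rewrite H by auto. rewrite IH; auto.
Qed.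

Lemma rsum_list_plus {A} (l : list A) u v :
  rsum_list l (fun a => u a + v a)%R = (rsum_list l u + rsum_list l v)%R.
Proof. induction l as [|a l IH]; simpl; [ring | rewrite IH; ring]. Qed.

Lemma rsum_list_scal {A} (l : list A) k u :
  rsum_list l (fun a => k * u a)%R = (k * rsum_list l u)%R.
Proof. induction l as [|a l IH]; simpl; [ring | rewrite IH; ring]. Qed.

Lemma rsum_list_nonneg {A} (l : list A) u :
  (forall a, (0 <= u a)%R) -> (0 <= rsum_list l u)%R.
Proof. intros H. induction l as [|a l IH]; simpl; [lra|]. specialize (H a). lra. Qed.

Lemma Cmod_csum_list {A} (l : list A) u :
  (Cmod (csum_list l u) <= rsum_list l (fun a => Cmod (u a)))%R.
Proof.
  induction l as [|a l IH]; simpl; [rewrite Cmod_0; lra|].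
  eapply Rle_trans; [apply Cmod_triangle | lra].
Qed.

Lemma rsum_list_app {A} (l l' : list A) u :
  rsum_list (l ++ l') u = (rsum_list l u + rsum_list l' u)%R.
Proof. induction l as [|a l IH]; simpl; [ring | rewrite IH; ring]. Qed.

Lemma rsum_list_map {A B} (f : A -> B) (l : list A) u :
  rsum_list (map f l) u = rsum_list l (fun a => u (f a)).
Proof. induction l as [|a l IH]; simpl; [auto | rewrite IH; auto]. Qed.

Lemma rsum_list_prod {A B} (l : list A) (l' : list B) u :
  rsum_list (list_prod l l') u = rsum_list l (fun a => rsum_list l' (fun b => u (a, b))).
Proof.
  induction l as [|a l IH]; simpl; auto.
  rewrite rsum_list_app, IH, rsum_list_map. auto.
Qed.

Lemma rsum_list_perm {A} (l l' : list A) u :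
  Permutation l l' -> rsum_list l u = rsum_list l' u.
Proof. induction 1; simpl; lra. Qed.

Lemma csum_list_perm {A} (l l' : list A) u :
  Permutation l l' -> csum_list l u = csum_list l' u.
Proof.
  induction 1; simpl; auto.
  - rewrite IHPermutation; auto.
  - ring.
  - congruence.
Qed.

Notation idx := (nat * nat * nat)%type.

Definition deg (a : idx) : nat := let '(i, j, k) := a in (i + j + k)%nat.

Definition cube (n : nat) : list idx :=
  list_prod (list_prod (seq 0 (S n)) (seq 0 (S n))) (seq 0 (S n)).

Lemma in_cube n i j k : In (i, j, k) (cube n) <-> (i <= n /\ j <= n /\ k <= n)%nat.
Proof. unfold cube. rewrite !in_prod_iff, !in_seq. lia. Qed.

Lemma nodup_prod {A B} (l : list A) (l' : list B) :
  NoDup l -> NoDup l' -> NoDup (list_prod l l').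
Proof.
  intros H H'. induction H as [|a l Hn H IH]; simpl; [constructor|].
  apply NoDup_app; auto.
  - apply FinFun.Injective_map_NoDup; auto. intros x y. congruence.
  - intros [x y] Hin Hin2. apply in_map_iff in Hin. destruct Hin as (z & Hz & _).
    apply in_prod_iff in Hin2. injection Hz as -> ->. tauto.
Qed.

Lemma nodup_cube n : NoDup (cube n).
Proof. apply nodup_prod; [apply nodup_prod|]; apply seq_NoDup. Qed.

(** Comparing two cubic partial sums becomes splitting a list: up to order, the larger cube is the
    smaller one followed by the remaining indices. *)
Lemma cube_split n m : (n <= m)%nat ->
  exists l', Permutation (cube m) (cube n ++ l') /\
    NoDup (cube n ++ l').
Proof.
  intros H.
  set (p := fun a : idx => let '(i, j, k) := a in
    ((i <=? n) && (j <=? n) && (k <=? n))%nat).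
  exists (filter (fun a => negb (p a)) (cube m)).
  assert (ND : NoDup (cube n ++ filter (fun a => negb (p a)) (cube m))).
  { apply NoDup_app; [apply nodup_cube | apply NoDup_filter, nodup_cube |].
    intros [[i j] k] Hin Hf. apply in_cube in Hin. apply filter_In in Hf.
    destruct Hf as [_ Hf]. unfold p in Hf.
    rewrite !(proj2 (Nat.leb_le _ _)) in Hf by lia. discriminate. }
  split; auto.
  apply NoDup_Permutation; auto using nodup_cube.
  intros [[i j] k]. rewrite in_app_iff, filter_In, !in_cube. unfold p.
  destruct (Nat.leb_spec i n), (Nat.leb_spec j n), (Nat.leb_spec k n); simpl; intuition lia.
Qed.

Lemma rsum_cube_mono n m u : (n <= m)%nat -> (forall a, (0 <= u a)%R) ->
  (rsum_list (cube n) u <= rsum_list (cube m) u)%R.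
Proof.
  intros H Hu. destruct (cube_split n m H) as (l' & P & _).
  rewrite (rsum_list_perm _ _ _ P), rsum_list_app.
  assert (H1 := rsum_list_nonneg l' u Hu). lra.
Qed.

(** The extra terms of the larger cube are bounded by their absolute values, so bounded sums of
    absolute values make the cubic partial sums Cauchy. *)
Lemma csum_cube_diff n m u : (n <= m)%nat ->
  (Cmod (csum_list (cube m) u - csum_list (cube n) u)
   <= rsum_list (cube m) (fun a => Cmod (u a)) - rsum_list (cube n) (fun a => Cmod (u a)))%R.
Proof.
  intros H. destruct (cube_split n m H) as (l' & P & _).
  rewrite (rsum_list_perm _ _ _ P), (csum_list_perm _ _ _ P), rsum_list_app, csum_list_app.
  replace (csum_list (cube n) u + csum_list l' u - csum_list (cube n) u)
    with (csum_list l' u) by ring.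
  assert (H1 := Cmod_csum_list l' u). lra.
Qed.

Lemma sum_n_csum_list (u : nat -> C) n : sum_n u n = csum_list (seq 0 (S n)) u.
Proof.
  induction n as [|n IH].
  - rewrite sum_O. simpl. ring.
  - rewrite sum_Sn, IH. rewrite (seq_S (S n)), csum_list_app. simpl.
    unfold plus. simpl. ring.
Qed.

Lemma sum_n_rsum_list (u : nat -> R) n : sum_n u n = rsum_list (seq 0 (S n)) u.
Proof.
  induction n as [|n IH].
  - rewrite sum_O. simpl. ring.
  - rewrite sum_Sn, IH. rewrite (seq_S (S n)), rsum_list_app. simpl.
    unfold plus. simpl. ring.
Qed.

Lemma csum3_cube (f : fps) n :
  csum3 f n n n = csum_list (cube n) (fun '(i, j, k) => f i j k).
Proof.
  unfold csum3, cube. rewrite !csum_list_prod, sum_n_csum_list.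
  apply csum_list_ext. intros i _. rewrite sum_n_csum_list.
  apply csum_list_ext. intros j _. rewrite sum_n_csum_list. auto.
Qed.

(** * Absolutely summable families and their totals *)

Definition summable_by (u : idx -> C) (M : R) : Prop :=
  forall n, (rsum_list (cube n) (fun a => Cmod (u a)) <= M)%R.

Definition has_total (u : idx -> C) (S : C) : Prop :=
  forall e : R, (0 < e)%R -> exists N, forall n, (N <= n)%nat ->
    (Cmod (csum_list (cube n) u - S) < e)%R.

(** The same limits of real and imaginary parts as in [psum], for an arbitrary family of terms. *)
Definition total (u : idx -> C) : C :=
  (real (Lim_seq (fun n => fst (csum_list (cube n) u))),
   real (Lim_seq (fun n => snd (csum_list (cube n) u)))).

Lemma summable_by_nonneg u M : summable_by u M -> (0 <= M)%R.
Proof.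
  intros H. eapply Rle_trans; [|apply (H 0%nat)]. apply rsum_list_nonneg.
  intros a. apply Cmod_ge_0.
Qed.

Lemma has_total_unique u S : has_total u S -> total u = S.
Proof.
  intros H. unfold total. rewrite (surjective_pairing S) at 1. f_equal.
  - erewrite (is_lim_seq_unique _ (fst S)); [reflexivity|].
    apply is_lim_seq_spec. intros e. destruct (H e (cond_pos e)) as [N HN].
    exists N. intros n Hn. eapply Rle_lt_trans; [|apply (HN n Hn)].
    exact (Re_le_Cmod (csum_list (cube n) u - S)).
  - erewrite (is_lim_seq_unique _ (snd S)); [reflexivity|].
    apply is_lim_seq_spec. intros e. destruct (H e (cond_pos e)) as [N HN].
    exists N. intros n Hn. eapply Rle_lt_trans; [|apply (HN n Hn)].
    exact (Im_le_Cmod (csum_list (cube n) u - S)).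
Qed.

Lemma Ccauchy_lim (s : nat -> C) :
  (forall e : R, (0 < e)%R -> exists N, forall n m, (N <= n <= m)%nat ->
     (Cmod (s m - s n) < e)%R) ->
  exists S : C, forall e : R, (0 < e)%R -> exists N, forall n, (N <= n)%nat ->
     (Cmod (s n - S) < e)%R.
Proof.
  intros H.
  assert (HR : ex_finite_lim_seq (fun n => fst (s n))).
  { apply ex_lim_seq_cauchy_corr. intros e. destruct (H e (cond_pos e)) as [N HN].
    exists N. intros n m Hn Hm.
    destruct (Nat.le_ge_cases n m).
    - rewrite Rabs_minus_sym. eapply Rle_lt_trans; [|apply (HN n m); lia].
      exact (Re_le_Cmod (s m - s n)).
    - eapply Rle_lt_trans; [|apply (HN m n); lia].
      exact (Re_le_Cmod (s n - s m)). }
  assert (HI : ex_finite_lim_seq (fun n => snd (s n))).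
  { apply ex_lim_seq_cauchy_corr. intros e. destruct (H e (cond_pos e)) as [N HN].
    exists N. intros n m Hn Hm.
    destruct (Nat.le_ge_cases n m).
    - rewrite Rabs_minus_sym. eapply Rle_lt_trans; [|apply (HN n m); lia].
      exact (Im_le_Cmod (s m - s n)).
    - eapply Rle_lt_trans; [|apply (HN m n); lia].
      exact (Im_le_Cmod (s n - s m)). }
  destruct HR as [a Ha], HI as [b Hb]. exists (a, b). intros e He.
  apply is_lim_seq_spec in Ha. apply is_lim_seq_spec in Hb.
  assert (He2 : (0 < e / 2)%R) by lra.
  destruct (Ha (mkposreal _ He2)) as [N1 H1]. destruct (Hb (mkposreal _ He2)) as [N2 H2].
  exists (N1 + N2)%nat. intros n Hn.
  eapply Rle_lt_trans; [apply Cmod_le_Re_Im|]. simpl in *.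
  specialize (H1 n ltac:(lia)). specialize (H2 n ltac:(lia)).
  unfold Rminus in *. lra.
Qed.

Lemma cube_norms_cauchy u M : summable_by u M ->
  forall e : R, (0 < e)%R -> exists N, forall n m, (N <= n <= m)%nat ->
    (rsum_list (cube m) (fun a => Cmod (u a)) - rsum_list (cube n) (fun a => Cmod (u a)) < e)%R.
Proof.
  intros H e He.
  assert (HC : ex_finite_lim_seq (fun n => rsum_list (cube n) (fun a => Cmod (u a)))).
  { apply ex_finite_lim_seq_incr with M; auto. intros n. apply rsum_cube_mono; [lia|].
    intros a; apply Cmod_ge_0. }
  apply ex_lim_seq_cauchy_corr in HC. destruct (HC (mkposreal e He)) as [N HN].
  exists N. intros n m Hnm. simpl in HN.
  eapply Rle_lt_trans; [apply Rle_abs|]. apply HN; lia.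
Qed.

Lemma summable_total u M : summable_by u M ->
  has_total u (total u) /\ (Cmod (total u) <= M)%R.
Proof.
  intros H.
  destruct (Ccauchy_lim (fun n => csum_list (cube n) u)) as [S HS].
  { intros e He. destruct (cube_norms_cauchy u M H e He) as [N HN]. exists N.
    intros n m Hnm. eapply Rle_lt_trans; [apply csum_cube_diff; lia|]. auto. }
  rewrite (has_total_unique u S HS). split; [exact HS|].
  apply le_epsilon. intros e He. destruct (HS e He) as [N HN].
  specialize (HN N (le_n N)).
  assert (H1 := Cmod_csum_list (cube N) u). specialize (H N).
  assert (H2 := Cmod_triangle_rev S (csum_list (cube N) u)).
  rewrite Cmod_sub_comm in H2. lra.
Qed.

Lemma has_total_plus u v S T :
  has_total u S -> has_total v T -> has_total (fun a => u a + v a) (S + T).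
Proof.
  intros H1 H2 e He. destruct (H1 (e / 2)%R ltac:(lra)) as [N1 HN1].
  destruct (H2 (e / 2)%R ltac:(lra)) as [N2 HN2]. exists (N1 + N2)%nat. intros n Hn.
  rewrite csum_list_plus.
  replace (csum_list (cube n) u + csum_list (cube n) v - (S + T))
    with ((csum_list (cube n) u - S) + (csum_list (cube n) v - T)) by ring.
  eapply Rle_lt_trans; [apply Cmod_triangle|].
  specialize (HN1 n ltac:(lia)). specialize (HN2 n ltac:(lia)). lra.
Qed.

Lemma has_total_scal u k S : has_total u S -> has_total (fun a => k * u a) (k * S).
Proof.
  intros H e He.
  assert (Hk : (0 < Cmod k + 1)%R) by (assert (H0 := Cmod_ge_0 k); lra).
  destruct (H (e / (Cmod k + 1))%R) as [N HN]; [apply Rdiv_lt_0_compat; lra|].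
  exists N. intros n Hn. rewrite csum_list_scal.
  replace (k * csum_list (cube n) u - k * S) with (k * (csum_list (cube n) u - S)) by ring.
  rewrite Cmod_mult. specialize (HN n Hn).
  apply Rle_lt_trans with ((Cmod k + 1) * Cmod (csum_list (cube n) u - S))%R.
  - apply Rmult_le_compat_r; [apply Cmod_ge_0 | lra].
  - apply (Rmult_lt_compat_l (Cmod k + 1)) in HN; auto.
    replace ((Cmod k + 1) * (e / (Cmod k + 1)))%R with e in HN by (field; lra). auto.
Qed.

Lemma total_ext u v : (forall a, u a = v a) -> total u = total v.
Proof.
  intros H. unfold total.
  f_equal; f_equal; apply Lim_seq_ext; intros n; f_equal; apply csum_list_ext; auto.
Qed.

Lemma total_plus u v M N : summable_by u M -> summable_by v N ->
  total (fun a => u a + v a) = total u + total v.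
Proof.
  intros H1 H2. apply has_total_unique, has_total_plus;
  [apply (summable_total u M H1) | apply (summable_total v N H2)].
Qed.

Lemma total_scal u k M : summable_by u M -> total (fun a => k * u a) = k * total u.
Proof. intros H. apply has_total_unique, has_total_scal, (summable_total u M H). Qed.

Lemma summable_by_le u v M : (forall a, (Cmod (u a) <= Cmod (v a))%R) ->
  summable_by v M -> summable_by u M.
Proof. intros H Hv n. eapply Rle_trans; [|apply (Hv n)]. apply rsum_list_le. auto. Qed.

Lemma summable_by_plus u v M N : summable_by u M -> summable_by v N ->
  summable_by (fun a => u a + v a) (M + N).
Proof.
  intros Hu Hv n. eapply Rle_trans; [|apply Rplus_le_compat; [apply (Hu n)|apply (Hv n)]].
  rewrite <- rsum_list_plus. apply rsum_list_le. intros; apply Cmod_triangle.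
Qed.

Lemma summable_by_scal u k M : summable_by u M ->
  summable_by (fun a => k * u a) (Cmod k * M).
Proof.
  intros Hu n. eapply Rle_trans; [|apply Rmult_le_compat_l; [apply Cmod_ge_0|apply (Hu n)]].
  rewrite <- rsum_list_scal. apply rsum_list_le. intros. rewrite Cmod_mult. lra.
Qed.

Lemma summable_by_bound u v M K : (0 <= K)%R ->
  (forall a, (Cmod (u a) <= K * Cmod (v a))%R) ->
  summable_by v M -> summable_by u (K * M).
Proof.
  intros HK H Hv n. eapply Rle_trans; [|apply Rmult_le_compat_l; [exact HK|apply (Hv n)]].
  rewrite <- rsum_list_scal. apply rsum_list_le. auto.
Qed.

Lemma has_total_single (u : idx -> C) i j k : (forall a, a <> (i, j, k) -> u a = 0) ->
  has_total u (u (i, j, k)) /\ summable_by u (Cmod (u (i, j, k))).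
Proof.
  intros H. assert (Hs : forall n, (i + j + k <= n)%nat -> csum_list (cube n) u = u (i, j, k)).
  { intros n Hn. apply csum_list_single; auto using nodup_cube. apply in_cube. lia. }
  split.
  - intros e He. exists (i + j + k)%nat. intros n Hn. rewrite Hs by auto.
    replace (u (i, j, k) - u (i, j, k)) with (RtoC 0) by ring. rewrite Cmod_0. auto.
  - intros n. eapply Rle_trans; [apply (rsum_cube_mono n (n + (i + j + k)))|].
    + lia.
    + intros; apply Cmod_ge_0.
    + assert (Hin : In (i, j, k) (cube (n + (i + j + k)))) by (apply in_cube; lia).
      assert (ND := nodup_cube (n + (i + j + k))).
      apply in_split in Hin. destruct Hin as (l1 & l2 & E). rewrite E in *.
      rewrite rsum_list_app. simpl.
      apply NoDup_remove_2 in ND.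
      assert (Z : forall l, (forall a, In a l -> a <> (i, j, k)) -> rsum_list l (fun a => Cmod (u a)) = 0%R).
      { induction l as [|a l IH]; intros Hl; simpl; auto.
        rewrite H by (apply Hl; left; auto). rewrite Cmod_0, IH; [lra|].
        intros; apply Hl; right; auto. }
      rewrite !Z; [lra| |]; intros a Ha ->; apply ND, in_or_app; auto.
Qed.

Lemma csum_list_RtoC {A} (l : list A) (w : A -> R) :
  csum_list l (fun a => RtoC (w a)) = RtoC (rsum_list l w).
Proof. induction l as [|a l IH]; simpl; auto. rewrite IH, RtoC_plus. auto. Qed.

Lemma csum_list_incl {A} (l l' : list A) (u : A -> C) :
  NoDup l -> NoDup l' -> incl l l' ->
  (forall a, In a l' -> ~ In a l -> u a = 0) -> csum_list l u = csum_list l' u.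
Proof.
  intros H; revert l'. induction H as [|a l Hn H IH]; intros l' H' Hi Hz; simpl.
  - symmetry. apply csum_list_zero. auto.
  - assert (Ha : In a l') by (apply Hi; left; auto).
    apply in_split in Ha. destruct Ha as (l1 & l2 & ->).
    rewrite csum_list_app. simpl.
    assert (N1 := NoDup_remove_1 _ _ _ H'). assert (N2 := NoDup_remove_2 _ _ _ H').
    rewrite (IH (l1 ++ l2)); auto.
    + rewrite csum_list_app. ring.
    + intros b Hb. assert (Hb' : In b (l1 ++ a :: l2)) by (apply Hi; right; auto).
      rewrite in_app_iff in *. simpl in Hb'. destruct Hb' as [?|[<-|?]]; tauto.
    + intros b Hb Hb'. apply Hz.
      * rewrite in_app_iff in *. simpl. tauto.
      * intros [<-|?]; tauto.
Qed.

Lemma rsum_list_incl {A} (l l' : list A) u :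
  NoDup l -> incl l l' -> (forall a, (0 <= u a)%R) -> (rsum_list l u <= rsum_list l' u)%R.
Proof.
  intros H; revert l'. induction H as [|a l Hn H IH]; intros l' Hi Hz; simpl.
  - apply rsum_list_nonneg. auto.
  - assert (Ha : In a l') by (apply Hi; left; auto).
    apply in_split in Ha. destruct Ha as (l1 & l2 & ->).
    rewrite rsum_list_app. simpl.
    assert (H1 : (rsum_list l u <= rsum_list (l1 ++ l2) u)%R).
    { apply IH; auto. intros b Hb.
      assert (Hb' : In b (l1 ++ a :: l2)) by (apply Hi; right; auto).
      rewrite in_app_iff in *. simpl in Hb'. destruct Hb' as [?|[<-|?]]; tauto. }
    rewrite rsum_list_app in H1. lra.
Qed.

Definition box (i j k : nat) : list idx :=
  list_prod (list_prod (seq 0 (S i)) (seq 0 (S j))) (seq 0 (S k)).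

Lemma in_box i j k a b c : In (a, b, c) (box i j k) <-> (a <= i /\ b <= j /\ c <= k)%nat.
Proof. unfold box. rewrite !in_prod_iff, !in_seq. lia. Qed.

Lemma nodup_box i j k : NoDup (box i j k).
Proof. apply nodup_prod; [apply nodup_prod|]; apply seq_NoDup. Qed.

Lemma csum3_box (f : fps) i j k :
  csum3 f i j k = csum_list (box i j k) (fun '(a, b, c) => f a b c).
Proof.
  unfold csum3, box. rewrite !csum_list_prod, sum_n_csum_list.
  apply csum_list_ext. intros a _. rewrite sum_n_csum_list.
  apply csum_list_ext. intros b _. rewrite sum_n_csum_list. auto.
Qed.

(** * Cauchy products *)

Definition conv (u v : idx -> C) (g : idx) : C :=
  let '(i, j, k) := g in
  csum_list (box i j k) (fun '(a, b, c) => u (a, b, c) * v (i - a, j - b, k - c)%nat).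

Definition iadd (a b : idx) : idx :=
  let '(i, j, k) := a in let '(i', j', k') := b in (i + i', j + j', k + k')%nat.

Definition ieqb (a b : idx) : bool :=
  let '(i, j, k) := a in let '(i', j', k') := b in
  ((i =? i') && (j =? j') && (k =? k'))%nat.

Lemma ieqb_spec a b : ieqb a b = true <-> a = b.
Proof.
  destruct a as [[i j] k], b as [[i' j'] k']. unfold ieqb.
  rewrite !andb_true_iff, !Nat.eqb_eq. split; [intros [[-> ->] ->]; auto | intros H; injection H; auto].
Qed.

Definition incube (n : nat) (a : idx) : bool :=
  let '(i, j, k) := a in ((i <=? n) && (j <=? n) && (k <=? n))%nat.

Lemma incube_spec n a : incube n a = true <-> In a (cube n).
Proof.
  destruct a as [[i j] k]. rewrite in_cube. unfold incube.
  rewrite !andb_true_iff, !Nat.leb_le. tauto.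
Qed.

(** Writing the product as a sum over all pairs, with the indicator of [iadd a b = g], makes it
    symmetric in the two factors and turns every later rearrangement into an exchange of finite
    sums. *)
Lemma conv_delta u v n g : In g (cube n) ->
  conv u v g = csum_list (cube n) (fun a => csum_list (cube n) (fun b =>
    if ieqb (iadd a b) g then u a * v b else 0)).
Proof.
  intros Hg. destruct g as [[i j] k]. apply in_cube in Hg. unfold conv.
  transitivity (csum_list (box i j k) (fun a => csum_list (cube n) (fun b =>
    if ieqb (iadd a b) (i, j, k) then u a * v b else 0))).
  - apply csum_list_ext. intros [[a b] c] Ha. apply in_box in Ha.
    symmetry. etransitivity; [apply (csum_list_single _ (i - a, j - b, k - c)%nat); auto using nodup_cube|].
    + apply in_cube. lia.
    + intros [[a' b'] c'] _ Hne.
      destruct (ieqb _ _) eqn:E; auto. apply ieqb_spec in E. simpl in E.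
      exfalso. apply Hne. injection E as <- <- <-. repeat f_equal; lia.
    + replace (ieqb _ _) with true; auto. symmetry. apply ieqb_spec. simpl.
      repeat f_equal; lia.
  - apply csum_list_incl; auto using nodup_box, nodup_cube.
    + intros [[a b] c] Ha. apply in_box in Ha. apply in_cube. lia.
    + intros [[a b] c] _ Hn. apply csum_list_zero. intros [[a' b'] c'] _.
      destruct (ieqb _ _) eqn:E; auto. apply ieqb_spec in E. simpl in E.
      exfalso. apply Hn, in_box. injection E as <- <- <-. lia.
Qed.

Lemma conv_comm u v g : conv u v g = conv v u g.
Proof.
  assert (Hg : exists n, In g (cube n)).
  { destruct g as [[i j] k]. exists (i + j + k)%nat. apply in_cube. lia. }
  destruct Hg as [n Hg].
  rewrite (conv_delta u v n g Hg), (conv_delta v u n g Hg), csum_list_swap.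
  apply csum_list_ext. intros a _. apply csum_list_ext. intros b _.
  replace (iadd b a) with (iadd a b).
  - destruct (ieqb _ _); ring.
  - destruct a as [[? ?] ?], b as [[? ?] ?]. simpl. f_equal; [f_equal|]; lia.
Qed.

(** A family supported at one index acts by a shift; this computes products with constants,
    variables and powers of x. *)
Lemma conv_supported (u v : idx -> C) i j k :
  (forall a, a <> (i, j, k) -> u a = 0) ->
  forall a b c, conv u v (a, b, c) =
    if (i <=? a)%nat && (j <=? b)%nat && (k <=? c)%nat
    then u (i, j, k) * v (a - i, b - j, c - k)%nat else 0.
Proof.
  intros H a b c. unfold conv.
  destruct ((i <=? a)%nat && (j <=? b)%nat && (k <=? c)%nat) eqn:E.
  - etransitivity; [apply (csum_list_single _ (i, j, k)); auto using nodup_box|reflexivity].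
    + rewrite !andb_true_iff, !Nat.leb_le in E. apply in_box. lia.
    + intros [[x y] z] _ Hn. rewrite H by auto. ring.
  - apply csum_list_zero. intros [[x y] z] Hin. apply in_box in Hin.
    rewrite H; [ring|]. intros Eq. injection Eq as -> -> ->.
    rewrite (proj2 (Nat.leb_le _ _)), (proj2 (Nat.leb_le j _)), (proj2 (Nat.leb_le k _)) in E by lia.
    discriminate.
Qed.

Lemma sum_conv u v n :
  csum_list (cube n) (conv u v)
  = csum_list (cube n) (fun a => csum_list (cube n) (fun b =>
      if incube n (iadd a b) then u a * v b else 0)).
Proof.
  erewrite csum_list_ext; [|intros g Hg; apply (conv_delta u v n g Hg)].
  rewrite csum_list_swap. apply csum_list_ext. intros a _.
  rewrite csum_list_swap. apply csum_list_ext. intros b _.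
  destruct (incube n (iadd a b)) eqn:E.
  - apply incube_spec in E.
    etransitivity; [apply (csum_list_single _ (iadd a b)); auto using nodup_cube|].
    + intros g _ Hne. destruct (ieqb _ _) eqn:E'; auto. apply ieqb_spec in E'. congruence.
    + rewrite (proj2 (ieqb_spec _ _)); auto.
  - apply csum_list_zero. intros g Hg. destruct (ieqb _ _) eqn:E'; auto.
    apply ieqb_spec in E'. subst. apply incube_spec in Hg. congruence.
Qed.

Lemma prod_sums {A B} (l : list A) (l' : list B) u v :
  csum_list l u * csum_list l' v = csum_list l (fun a => csum_list l' (fun b => u a * v b)).
Proof.
  rewrite Cmult_comm, <- csum_list_scal. apply csum_list_ext. intros a _.
  rewrite csum_list_scal. ring.
Qed.

Lemma rprod_sums {A B} (l : list A) (l' : list B) u v :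
  (rsum_list l u * rsum_list l' v)%R = rsum_list l (fun a => rsum_list l' (fun b => u a * v b)%R).
Proof.
  rewrite Rmult_comm, <- rsum_list_scal. apply rsum_list_ext. intros a _.
  rewrite rsum_list_scal. ring.
Qed.

Lemma summable_conv u v M N : summable_by u M -> summable_by v N ->
  summable_by (conv u v) (M * N).
Proof.
  intros Hu Hv n.
  apply Rle_trans with (rsum_list (cube n) (fun a => Cmod (u a)) *
                        rsum_list (cube n) (fun a => Cmod (v a)))%R.
  2: { apply Rmult_le_compat; auto; apply rsum_list_nonneg; intros; apply Cmod_ge_0. }
  (* The absolute values, viewed as complex families, so that [sum_conv] also rewrites the majorant
     as a sum over pairs. *)
  set (u' := fun a => RtoC (Cmod (u a))). set (v' := fun a => RtoC (Cmod (v a))).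
  assert (Hc : forall g, (Cmod (conv u v g) <= fst (conv u' v' g))%R).
  { intros [[i j] k].
    assert (E : conv u' v' (i, j, k) = RtoC (rsum_list (box i j k) (fun x =>
      Cmod (let '(a, b, c) := x in u (a, b, c) * v (i - a, j - b, k - c)%nat)))).
    { rewrite <- csum_list_RtoC. apply csum_list_ext. intros [[a b] c] _.
      unfold u', v'. rewrite Cmod_mult, RtoC_mult. auto. }
    rewrite E. apply Cmod_csum_list. }
  assert (Hf : forall (l : list idx) w, rsum_list l (fun a => fst (w a)) = fst (csum_list l w)).
  { induction l as [|a l IH]; intros w; simpl; auto. rewrite IH. auto. }
  eapply Rle_trans; [apply rsum_list_le; intros g _; apply Hc|].
  rewrite Hf, sum_conv, rprod_sums.
  rewrite <- Hf. apply rsum_list_le. intros a _. rewrite <- Hf. apply rsum_list_le. intros b _.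
  assert (H1 := Cmod_ge_0 (u a)). assert (H2 := Cmod_ge_0 (v b)).
  destruct (incube n (iadd a b)); unfold u', v'; simpl; nra.
Qed.

Definition outer (h : nat) (w : idx -> R) (a : idx) : R := if incube h a then 0%R else w a.

Lemma rsum_outer h n w : (h <= n)%nat ->
  rsum_list (cube n) (outer h w) = (rsum_list (cube n) w - rsum_list (cube h) w)%R.
Proof.
  intros Hh. destruct (cube_split h n Hh) as (l' & P & ND).
  rewrite !(rsum_list_perm _ _ _ P), !rsum_list_app.
  rewrite (rsum_list_ext (cube h) _ (fun _ => 0 * 0)%R).
  - rewrite rsum_list_scal. rewrite (rsum_list_ext l' _ w); [ring|].
    intros a Ha. unfold outer. destruct (incube h a) eqn:E; auto.
    apply incube_spec in E. exfalso.
    revert ND E Ha. clear. intros ND E Ha. apply in_split in Ha. destruct Ha as (l1 & l2 & ->).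
    rewrite app_assoc in ND. apply NoDup_remove_2 in ND. apply ND. rewrite !in_app_iff. tauto.
  - intros a Ha. unfold outer. rewrite (proj2 (incube_spec h a)) by auto. ring.
Qed.

(** With h = n/2, two indices in the cube of size h add up to an index in the cube of size n. Hence
    the pairs missing from the partial sum of the product have at least one member outside the
    smaller cube, and their contribution is controlled by the tails of the absolute values. *)
Lemma total_conv u v M N : summable_by u M -> summable_by v N ->
  total (conv u v) = total u * total v.
Proof.
  intros Hu Hv. apply has_total_unique. intros e He.
  assert (HM := summable_by_nonneg u M Hu). assert (HN := summable_by_nonneg v N Hv).
  destruct (summable_total u M Hu) as [Tu Bu]. destruct (summable_total v N Hv) as [Tv Bv].
  (* Four errors occur, two of size at most M e/(4K) and two of size at most N e/(4K); the added 1
     keeps K positive and the final inequality strict. *)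
  set (K := (M + N + 1)%R). assert (HK : (0 < K)%R) by (unfold K; lra).
  assert (He' : (0 < e / (4 * K))%R) by (apply Rdiv_lt_0_compat; lra).
  destruct (Tu _ He') as [N1 H1]. destruct (Tv _ He') as [N2 H2].
  destruct (cube_norms_cauchy u M Hu _ He') as [N3 H3].
  destruct (cube_norms_cauchy v N Hv _ He') as [N4 H4].
  exists (2 * (N1 + N2 + N3 + N4) + 2)%nat. intros n Hn.
  set (h := (n / 2)%nat).
  assert (Hh : (2 * h <= n /\ n < 2 * h + 2)%nat).
  { unfold h. assert (E := Nat.div_mod n 2 ltac:(lia)). assert (B := Nat.mod_upper_bound n 2 ltac:(lia)). lia. }
  specialize (H1 n ltac:(lia)). specialize (H2 n ltac:(lia)).
  specialize (H3 h n ltac:(lia)). specialize (H4 h n ltac:(lia)).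
  assert (D : (Cmod (csum_list (cube n) u * csum_list (cube n) v - csum_list (cube n) (conv u v))
     <= rsum_list (cube n) (outer h (fun a => Cmod (u a))) * rsum_list (cube n) (fun a => Cmod (v a))
      + rsum_list (cube n) (fun a => Cmod (u a)) * rsum_list (cube n) (outer h (fun a => Cmod (v a))))%R).
  { rewrite sum_conv, prod_sums.
    match goal with |- (Cmod (csum_list _ ?f - csum_list _ ?g) <= _)%R =>
      replace (csum_list (cube n) f - csum_list (cube n) g)
        with (csum_list (cube n) (fun a => csum_list (cube n) (fun b =>
           if incube n (iadd a b) then 0 else u a * v b))) end.
    2: { set (W := csum_list (cube n) (fun a => csum_list (cube n) (fun b =>
           if incube n (iadd a b) then u a * v b else 0))).
         match goal with |- ?A = ?B - ?D => cut (A + D = B); [intros <-; ring|] end.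
         unfold W. rewrite <- csum_list_plus. apply csum_list_ext. intros a _.
         rewrite <- csum_list_plus. apply csum_list_ext. intros b _.
         destruct (incube n (iadd a b)); ring. }
    eapply Rle_trans; [apply Cmod_csum_list|].
    rewrite !rprod_sums, <- rsum_list_plus. apply rsum_list_le. intros a Ha.
    eapply Rle_trans; [apply Cmod_csum_list|].
    rewrite <- rsum_list_plus. apply rsum_list_le. intros b Hb.
    assert (P1 := Cmod_ge_0 (u a)). assert (P2 := Cmod_ge_0 (v b)).
    unfold outer.
    destruct (incube n (iadd a b)) eqn:E.
    - rewrite Cmod_0. destruct (incube h a), (incube h b); nra.
    - rewrite Cmod_mult. destruct (incube h a) eqn:Ea; [|destruct (incube h b); nra].
      destruct (incube h b) eqn:Eb; [|nra].
      exfalso. apply incube_spec in Ea. apply incube_spec in Eb.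
      destruct a as [[i j] k], b as [[i' j'] k']. apply in_cube in Ea. apply in_cube in Eb.
      assert (incube n (iadd (i, j, k) (i', j', k')) = true) by (apply incube_spec, in_cube; lia).
      congruence. }
  rewrite !rsum_outer in D by lia.
  assert (Bu' := Hu n). assert (Bv' := Hv n).
  assert (Pu := rsum_list_nonneg (cube n) (fun a => Cmod (u a)) (fun a => Cmod_ge_0 _)).
  assert (Pv := rsum_list_nonneg (cube n) (fun a => Cmod (v a)) (fun a => Cmod_ge_0 _)).
  assert (D' : (Cmod (csum_list (cube n) u * csum_list (cube n) v - csum_list (cube n) (conv u v))
     <= e / (4 * K) * N + M * (e / (4 * K)))%R) by nra.
  set (U := csum_list (cube n) u) in *. set (V := csum_list (cube n) v) in *.
  assert (BU : (Cmod U <= M)%R) by (eapply Rle_trans; [apply Cmod_csum_list | apply Hu]).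
  replace (csum_list (cube n) (conv u v) - total u * total v)
    with ((csum_list (cube n) (conv u v) - U * V) + (U * (V - total v) + (U - total u) * total v)) by ring.
  eapply Rle_lt_trans; [apply Cmod_triangle|].
  rewrite Cmod_sub_comm.
  eapply Rle_lt_trans; [apply Rplus_le_compat_l, Cmod_triangle|].
  rewrite !Cmod_mult.
  assert (Q1 := Cmod_ge_0 U). assert (Q2 := Cmod_ge_0 (total v)).
  assert (Q3 := Cmod_ge_0 (V - total v)). assert (Q4 := Cmod_ge_0 (U - total u)).
  set (d := (e / (4 * K))%R) in *.
  assert (Hd : (4 * d * K = e)%R) by (unfold d; field; lra).
  assert (R1 : (Cmod U * Cmod (V - total v) <= M * d)%R) by (apply Rmult_le_compat; lra).
  assert (R2 : (Cmod (U - total u) * Cmod (total v) <= d * N)%R) by (apply Rmult_le_compat; lra).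
  assert (Hdk : (e = 4 * d * M + 4 * d * N + 4 * d)%R) by (rewrite <- Hd; unfold K; ring).
  assert (0 <= d * M)%R by (apply Rmult_le_pos; lra).
  assert (0 <= d * N)%R by (apply Rmult_le_pos; lra). lra.
Qed.

(** * Values of convergent power series *)

Definition mono (p : C3) (a : idx) : C :=
  let '(i, j, k) := a in Cpow (co p cx) i * Cpow (co p cy1) j * Cpow (co p cy2) k.

Definition cf (f : fps) (a : idx) : C := let '(i, j, k) := a in f i j k.

Definition pterm (f : fps) (p : C3) (a : idx) : C := cf f a * mono p a.

Lemma psum_total f p : psum f p = total (pterm f p).
Proof.
  unfold psum, total. f_equal; f_equal; apply Lim_seq_ext; intros n; f_equal;
  unfold partial_sum; rewrite csum3_cube; apply csum_list_ext; intros [[i j] k] _; reflexivity.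
Qed.

Lemma abs_summable_iff f r :
  abs_summable f r <-> exists M, forall n,
    (rsum_list (cube n) (fun a => Cmod (cf f a) * r ^ deg a) <= M)%R.
Proof.
  assert (E : forall n, (sum_n (fun i => sum_n (fun j => sum_n (fun k =>
       Cmod (f i j k) * r ^ (i + j + k)) n) n) n)%R =
     rsum_list (cube n) (fun a => Cmod (cf f a) * r ^ deg a)%R).
  { intros n. unfold cube. rewrite !rsum_list_prod, sum_n_rsum_list.
    apply rsum_list_ext. intros a _. rewrite sum_n_rsum_list.
    apply rsum_list_ext. intros b _. rewrite sum_n_rsum_list. auto. }
  unfold abs_summable. split; intros [M H]; exists M; intros n; specialize (H n).
  - rewrite <- E. auto.
  - rewrite E. auto.
Qed.

Lemma norm3_co p i : (Cmod (co p i) <= norm3 p)%R.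
Proof.
  unfold norm3. assert (H := Rmax_l (Cmod (co p cy1)) (Cmod (co p cy2))).
  assert (H' := Rmax_r (Cmod (co p cy1)) (Cmod (co p cy2))).
  assert (H1 := Rmax_l (Cmod (co p cx)) (Rmax (Cmod (co p cy1)) (Cmod (co p cy2)))).
  assert (H2 := Rmax_r (Cmod (co p cx)) (Rmax (Cmod (co p cy1)) (Cmod (co p cy2)))).
  destruct i; lra.
Qed.

Lemma norm3_nonneg p : (0 <= norm3 p)%R.
Proof. eapply Rle_trans; [apply Cmod_ge_0 | apply (norm3_co p cx)]. Qed.

Lemma norm3_le p d : (forall i, (Cmod (co p i) <= d)%R) -> (norm3 p <= d)%R.
Proof. intros H. unfold norm3. repeat apply Rmax_lub; apply H. Qed.

Lemma norm3_lt p d : (forall i, (Cmod (co p i) < d)%R) -> (norm3 p < d)%R.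
Proof. intros H. unfold norm3. repeat apply Rmax_lub_lt; apply H. Qed.

Lemma Cmod_mono p a r : (norm3 p <= r)%R -> (Cmod (mono p a) <= r ^ deg a)%R.
Proof.
  intros H. destruct a as [[i j] k]. unfold mono, deg. rewrite !Cmod_mult, !Cmod_pow, !pow_add.
  assert (H1 := norm3_co p cx). assert (H2 := norm3_co p cy1). assert (H3 := norm3_co p cy2).
  repeat apply Rmult_le_compat; repeat apply Rmult_le_pos; try apply pow_le; try apply Cmod_ge_0;
  apply pow_incr; split; try apply Cmod_ge_0; lra.
Qed.

Lemma abs_summable_bound f r : abs_summable f r ->
  exists M, forall p, (norm3 p <= r)%R -> summable_by (pterm f p) M.
Proof.
  intros H. apply abs_summable_iff in H. destruct H as [M H]. exists M. intros p Hp n.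
  eapply Rle_trans; [|apply (H n)]. apply rsum_list_le. intros a _.
  unfold pterm. rewrite Cmod_mult. apply Rmult_le_compat_l; [apply Cmod_ge_0|].
  apply Cmod_mono; auto.
Qed.

Lemma abs_summable_at f r p : abs_summable f r -> (norm3 p <= r)%R ->
  exists M, summable_by (pterm f p) M.
Proof. intros H Hp. destruct (abs_summable_bound f r H) as [M HM]. eauto. Qed.

(* On the diagonal point the absolute values of the terms are exactly those of [abs_summable]. *)
Lemma abs_summable_diag f r : (0 <= r)%R ->
  (exists M, summable_by (pterm f (RtoC r, RtoC r, RtoC r)) M) -> abs_summable f r.
Proof.
  intros Hr [M H]. apply abs_summable_iff. exists M. intros n.
  eapply Rle_trans; [|apply (H n)]. apply rsum_list_le. intros [[i j] k] _.
  unfold pterm. rewrite Cmod_mult. right. f_equal. simpl.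
  rewrite !Cmod_mult, !Cmod_pow, Cmod_R, Rabs_pos_eq, !pow_add by auto. auto.
Qed.

Lemma norm3_diag r : (0 <= r)%R -> norm3 (RtoC r, RtoC r, RtoC r) = r.
Proof.
  intros H. unfold norm3. cbn [co fst snd]. rewrite !Cmod_R, !Rabs_pos_eq by auto.
  unfold Rmax; repeat destruct Rle_dec; lra.
Qed.

Lemma abs_summable_le f r s : (0 <= s <= r)%R -> abs_summable f r -> abs_summable f s.
Proof.
  intros Hs H. apply abs_summable_diag; [lra|]. apply (abs_summable_at f r); auto.
  rewrite norm3_diag; lra.
Qed.

Lemma fmul_conv f g a : cf (fmul f g) a = conv (cf f) (cf g) a.
Proof.
  destruct a as [[i j] k]. unfold cf at 1, fmul, conv. rewrite csum3_box.
  apply csum_list_ext. intros [[a b] c] _. auto.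
Qed.

Lemma pterm_fmul f g p a : pterm (fmul f g) p a = conv (pterm f p) (pterm g p) a.
Proof.
  unfold pterm at 1. rewrite fmul_conv. destruct a as [[i j] k]. unfold conv.
  rewrite Cmult_comm, <- csum_list_scal. apply csum_list_ext.
  intros [[a b] c] Ha. apply in_box in Ha. unfold pterm, mono, cf.
  replace (Cpow (co p cx) i) with (Cpow (co p cx) a * Cpow (co p cx) (i - a)).
  2: { rewrite <- Cpow_add_r. f_equal. lia. }
  replace (Cpow (co p cy1) j) with (Cpow (co p cy1) b * Cpow (co p cy1) (j - b)).
  2: { rewrite <- Cpow_add_r. f_equal. lia. }
  replace (Cpow (co p cy2) k) with (Cpow (co p cy2) c * Cpow (co p cy2) (k - c)).
  2: { rewrite <- Cpow_add_r. f_equal. lia. }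
  ring.
Qed.

Lemma summable_by_ext u v M : (forall a, u a = v a) -> summable_by v M -> summable_by u M.
Proof. intros H. apply summable_by_le. intros a. rewrite H. lra. Qed.

Lemma psum_fmul f g p M N :
  summable_by (pterm f p) M -> summable_by (pterm g p) N ->
  psum (fmul f g) p = psum f p * psum g p.
Proof.
  intros Hf Hg. rewrite !psum_total, <- (total_conv _ _ M N); auto.
  apply total_ext. apply pterm_fmul.
Qed.

Lemma abs_summable_fmul f g r : (0 <= r)%R ->
  abs_summable f r -> abs_summable g r -> abs_summable (fmul f g) r.
Proof.
  intros Hr Hf Hg. apply abs_summable_diag; auto.
  destruct (abs_summable_bound f r Hf) as [M HM]. destruct (abs_summable_bound g r Hg) as [N HN].
  exists (M * N)%R. eapply summable_by_ext; [apply pterm_fmul|].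
  apply summable_conv; [apply HM | apply HN]; rewrite norm3_diag; lra.
Qed.

Lemma psum_fadd f g p M N :
  summable_by (pterm f p) M -> summable_by (pterm g p) N ->
  psum (fadd f g) p = psum f p + psum g p.
Proof.
  intros Hf Hg. rewrite !psum_total, <- (total_plus _ _ M N); auto.
  apply total_ext. intros [[i j] k]. unfold pterm. simpl. unfold fadd. ring.
Qed.

Lemma abs_summable_fadd f g r : (0 <= r)%R ->
  abs_summable f r -> abs_summable g r -> abs_summable (fadd f g) r.
Proof.
  intros Hr Hf Hg. apply abs_summable_diag; auto.
  destruct (abs_summable_bound f r Hf) as [M HM]. destruct (abs_summable_bound g r Hg) as [N HN].
  set (p := (RtoC r, RtoC r, RtoC r)). assert (Hp : (norm3 p <= r)%R) by (unfold p; rewrite norm3_diag; lra).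
  exists (M + N)%R. apply (summable_by_ext _ (fun a => pterm f p a + pterm g p a));
    [|apply summable_by_plus; auto].
  intros [[i j] k]. unfold pterm. simpl. unfold fadd. ring.
Qed.

Lemma fopp_scal f p a : pterm (fopp f) p a = - (1) * pterm f p a.
Proof. destruct a as [[i j] k]. unfold pterm. simpl. unfold fopp. ring. Qed.

Lemma psum_fopp f p M : summable_by (pterm f p) M -> psum (fopp f) p = - psum f p.
Proof.
  intros Hf. rewrite !psum_total. rewrite (total_ext _ _ (fopp_scal f p)).
  rewrite (total_scal _ _ M) by auto. ring.
Qed.

Lemma abs_summable_fopp f r : (0 <= r)%R -> abs_summable f r -> abs_summable (fopp f) r.
Proof.
  intros Hr Hf. apply abs_summable_diag; auto.
  destruct (abs_summable_bound f r Hf) as [M HM].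
  exists (Cmod (- (1)) * M)%R. eapply summable_by_ext; [apply fopp_scal|].
  apply summable_by_scal, HM. rewrite norm3_diag; lra.
Qed.

Lemma psum_ext f g p : feq f g -> psum f p = psum g p.
Proof.
  intros H. rewrite !psum_total. apply total_ext. intros [[i j] k]. unfold pterm. simpl.
  rewrite H. auto.
Qed.

Lemma psum_single f i j k p : (forall a, a <> (i, j, k) -> cf f a = 0) ->
  psum f p = f i j k * mono p (i, j, k) /\ exists M, summable_by (pterm f p) M.
Proof.
  intros H.
  assert (H' : forall a, a <> (i, j, k) -> pterm f p a = 0).
  { intros a Ha. unfold pterm. rewrite H; auto. ring. }
  destruct (has_total_single _ _ _ _ H') as [T S]. split; [|eauto].
  rewrite psum_total. apply has_total_unique. auto.
Qed.

Lemma fcst_support a b : b <> (0, 0, 0)%nat -> cf (fcst a) b = 0.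
Proof. destruct b as [[[|i] [|j]] [|k]]; simpl; unfold fcst; simpl; congruence. Qed.

Definition unit_idx (v : coord) : idx :=
  match v with cx => (1, 0, 0)%nat | cy1 => (0, 1, 0)%nat | cy2 => (0, 0, 1)%nat end.

Lemma fvar_support v b : b <> unit_idx v -> cf (fvar v) b = 0.
Proof.
  destruct v, b as [[[|[|i]] [|[|j]]] [|[|k]]]; simpl; congruence.
Qed.

Lemma psum_fcst a p : psum (fcst a) p = a /\ exists M, summable_by (pterm (fcst a) p) M.
Proof.
  destruct (psum_single (fcst a) 0 0 0 p (fcst_support a)) as [E H]. split; auto.
  rewrite E. unfold fcst. simpl. ring.
Qed.

Lemma psum_fvar v p : psum (fvar v) p = co p v /\ exists M, summable_by (pterm (fvar v) p) M.
Proof.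
  destruct v;
  [destruct (psum_single (fvar cx) 1 0 0 p (fvar_support cx)) as [E H] |
   destruct (psum_single (fvar cy1) 0 1 0 p (fvar_support cy1)) as [E H] |
   destruct (psum_single (fvar cy2) 0 0 1 p (fvar_support cy2)) as [E H]]; (split; [|exact H]);
  rewrite E; simpl; ring.
Qed.

Lemma abs_summable_fcst a r : (0 <= r)%R -> abs_summable (fcst a) r.
Proof. intros Hr. apply abs_summable_diag; auto. apply psum_fcst. Qed.

Lemma abs_summable_fvar v r : (0 <= r)%R -> abs_summable (fvar v) r.
Proof. intros Hr. apply abs_summable_diag; auto. apply psum_fvar. Qed.

(** * Frechet derivatives and analytic functions *)

Lemma pow_lin_bound (t : R) (n : nat) : (0 <= t < 1)%R -> (INR n * t ^ n * (1 - t) <= 1)%R.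
Proof.
  (* The added term [t ^ n] is what makes the induction close. *)
  intros H. assert (G : (INR n * t ^ n * (1 - t) + t ^ n <= 1)%R).
  { induction n as [|n IH]; [simpl; lra|].
    rewrite S_INR. simpl.
    assert (0 <= t ^ n)%R by (apply pow_le; lra).
    assert (t ^ n <= 1)%R by (rewrite <- (pow1 n); apply pow_incr; lra).
    assert (0 <= t * (1 - (INR n * t ^ n * (1 - t) + t ^ n)))%R by (apply Rmult_le_pos; lra).
    assert (0 <= (1 - t) * (1 - t * t ^ n))%R by (apply Rmult_le_pos; nra). nra. }
  assert (0 <= t ^ n)%R by (apply pow_le; lra). lra.
Qed.

Lemma pow_quad_bound (t : R) : (0 <= t < 1)%R ->
  exists K, (0 <= K)%R /\ forall n, (INR n ^ 2 * t ^ n <= K)%R.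
Proof.
  (* With m^2 = t, n^2 t^n is the square of n m^n, to which the linear bound applies. *)
  intros H. set (m := sqrt t).
  assert (Hm : (m * m = t)%R) by (apply sqrt_sqrt; lra).
  assert (Hm0 : (0 <= m)%R) by apply sqrt_pos.
  assert (Hm1 : (m < 1)%R) by nra.
  exists ((/ (1 - m)) ^ 2)%R. split; [apply pow_le; left; apply Rinv_0_lt_compat; lra|].
  intros n. rewrite <- Hm, Rpow_mult_distr.
  replace (INR n ^ 2 * (m ^ n * m ^ n))%R with ((INR n * m ^ n) ^ 2)%R by ring.
  apply pow_incr. split.
  - apply Rmult_le_pos; [apply pos_INR | apply pow_le; auto].
  - apply (Rmult_le_reg_r (1 - m)); [lra|]. rewrite Rinv_l by lra. apply pow_lin_bound. lra.
Qed.

Lemma pow_quad_bound_radius (s r : R) : (0 <= s < r)%R ->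
  exists K, (0 <= K)%R /\ forall n, (INR n ^ 2 * s ^ n <= K * r ^ n)%R.
Proof.
  intros H. destruct (pow_quad_bound (s / r)) as (K & HK & B).
  { split; [apply Rdiv_le_0_compat; lra|]. apply Rlt_div_l; lra. }
  exists K. split; auto. intros n. specialize (B n).
  replace (s ^ n)%R with ((s / r) ^ n * r ^ n)%R.
  - rewrite <- Rmult_assoc. apply Rmult_le_compat_r; auto. apply pow_le. lra.
  - rewrite <- Rpow_mult_distr. f_equal. field. lra.
Qed.

Lemma abs_summable_fD v f r s : (0 <= s < r)%R -> abs_summable f r -> abs_summable (fD v f) s.
Proof.
  (* An intermediate radius is used because [s] may be 0, whereas shifting the index by one divides
     by the radius. *)
  intros Hs H. set (t := ((s + r) / 2)%R).
  apply (abs_summable_le _ t); [unfold t; lra|].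
  destruct (pow_quad_bound_radius t r) as (K & HK & B); [unfold t; lra|].
  apply abs_summable_iff in H. destruct H as [M H].
  apply abs_summable_iff. exists (K / t * M)%R. intros n.
  assert (Ht : (0 < t)%R) by (unfold t; lra).
  set (e := unit_idx v).
  set (w := fun b => (Cmod (cf f b) * r ^ deg b)%R).
  apply Rle_trans with (K / t * rsum_list (map (fun a => iadd a e) (cube n)) w)%R.
  - rewrite rsum_list_map, <- rsum_list_scal. apply rsum_list_le. intros a _.
    unfold w. apply (Rmult_le_reg_l t); auto.
    replace (t * (K / t * (Cmod (cf f (iadd a e)) * r ^ deg (iadd a e))))%R
      with (Cmod (cf f (iadd a e)) * (K * r ^ deg (iadd a e)))%R by (field; lra).
    assert (Hd : exists m, (m <= deg (iadd a e))%nat /\ cf (fD v f) a = RtoC (INR m) * cf f (iadd a e)).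
    { destruct a as [[i j] k]. unfold e. destruct v; simpl.
      - exists (S i). split; [lia|]. unfold fD. rewrite (Nat.add_comm i 1), (Nat.add_0_r j), (Nat.add_0_r k). auto.
      - exists (S j). split; [lia|]. unfold fD. rewrite (Nat.add_comm j 1), (Nat.add_0_r i), (Nat.add_0_r k). auto.
      - exists (S k). split; [lia|]. unfold fD. rewrite (Nat.add_comm k 1), (Nat.add_0_r j), (Nat.add_0_r i). auto. }
    assert (Hdeg : deg (iadd a e) = S (deg a)).
    { destruct a as [[i j] k]. unfold e. destruct v; simpl; lia. }
    destruct Hd as (m & Hm & ->). rewrite Cmod_mult, Cmod_R, Rabs_pos_eq by apply pos_INR.
    replace (t * (INR m * Cmod (cf f (iadd a e)) * t ^ deg a))%R
      with (Cmod (cf f (iadd a e)) * (INR m * t ^ deg (iadd a e)))%R by (rewrite Hdeg; simpl; ring).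
    apply Rmult_le_compat_l; [apply Cmod_ge_0|].
    eapply Rle_trans; [|apply B]. apply Rmult_le_compat_r; [apply pow_le; lra|].
    apply le_INR in Hm. rewrite Hdeg in *.
    assert (1 <= INR (S (deg a)))%R by (rewrite S_INR; assert (G := pos_INR (deg a)); lra).
    assert (G := pos_INR m). nra.
  - apply Rmult_le_compat_l; [apply Rdiv_le_0_compat; lra|].
    eapply Rle_trans; [|apply (H (S n))].
    apply rsum_list_incl.
    + apply FinFun.Injective_map_NoDup; [|apply nodup_cube].
      intros [[i j] k] [[i' j'] k']. unfold e. destruct v; simpl; intros E; injection E; intros;
      f_equal; [f_equal| | f_equal| |f_equal|]; lia.
    + intros b Hb. apply in_map_iff in Hb. destruct Hb as ([[i j] k] & <- & Hb).
      apply in_cube in Hb. unfold e. destruct v; cbn [iadd unit_idx]; apply in_cube; lia.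
    + intros b. apply Rmult_le_pos; [apply Cmod_ge_0 | apply pow_le; lra].
Qed.

(** Partial derivative of a monomial. At exponent 0 the truncated [pred] is harmless, since the
    factor [INR 0] annihilates the term. *)
Definition dmono (v : coord) (p : C3) (a : idx) : C :=
  let '(i, j, k) := a in
  match v with
  | cx => RtoC (INR i) * mono p (pred i, j, k)
  | cy1 => RtoC (INR j) * mono p (i, pred j, k)
  | cy2 => RtoC (INR k) * mono p (i, j, pred k)
  end.

Definition dot (l : coord -> C) (h : C3) : C :=
  l cx * co h cx + l cy1 * co h cy1 + l cy2 * co h cy2.

Definition delta_at (e a : idx) : C := if ieqb a e then 1 else 0.

Lemma delta_at_support e a : a <> e -> delta_at e a = 0.
Proof.
  intros H. unfold delta_at. destruct (ieqb a e) eqn:E; auto. apply ieqb_spec in E. congruence.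
Qed.

(** Convolution with a unit mass shifts the indices without changing the total. It reindexes the
    series of a derivative by the monomials of the original series, as [conv_delta_fD] records. *)
Lemma total_shift e w M : summable_by w M ->
  total (conv (delta_at e) w) = total w /\ summable_by (conv (delta_at e) w) M.
Proof.
  intros H. destruct e as [[i j] k].
  destruct (has_total_single _ i j k (delta_at_support (i, j, k))) as [T S].
  assert (E : delta_at (i, j, k) (i, j, k) = 1).
  { unfold delta_at. rewrite (proj2 (ieqb_spec _ _)); auto. }
  rewrite E in *. split.
  - rewrite (total_conv _ _ _ _ S H), (has_total_unique _ _ T). ring.
  - replace M with (Cmod 1 * M)%R by (rewrite Cmod_1; ring). apply summable_conv; auto.
Qed.

Lemma conv_delta_fD v f p a :
  conv (delta_at (unit_idx v)) (pterm (fD v f) p) a = cf f a * dmono v p a.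
Proof.
  destruct a as [[i j] k].
  destruct v; simpl unit_idx; rewrite (conv_supported _ _ _ _ _ (delta_at_support _));
  unfold delta_at; rewrite (proj2 (ieqb_spec _ _) eq_refl); unfold pterm, cf, fD, dmono.
  - destruct i as [|i]; simpl Nat.leb; cbn [andb].
    + simpl. ring.
    + replace (S i - 1)%nat with i by lia. rewrite !Nat.sub_0_r. simpl Nat.pred. ring.
  - destruct j as [|j]; simpl Nat.leb; cbn [andb].
    + simpl. ring.
    + replace (S j - 1)%nat with j by lia. rewrite !Nat.sub_0_r. simpl Nat.pred. ring.
  - destruct k as [|k]; simpl Nat.leb; cbn [andb].
    + simpl. ring.
    + replace (S k - 1)%nat with k by lia. rewrite !Nat.sub_0_r. simpl Nat.pred. ring.
Qed.

Definition add_unit (v : coord) (a : idx) : idx := iadd (unit_idx v) a.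

Lemma idx_ind (P : idx -> Prop) : P (0, 0, 0)%nat ->
  (forall v a, P a -> P (add_unit v a)) -> forall a, P a.
Proof.
  intros H0 HS [[i j] k].
  assert (Hk : P (0, 0, k)%nat) by (induction k as [|k IH]; [auto | apply (HS cy2 (0, 0, k)%nat IH)]).
  assert (Hj : P (0, j, k)%nat) by (induction j as [|j IH]; [auto | apply (HS cy1 (0, j, k)%nat IH)]).
  induction i as [|i IH]; [auto | apply (HS cx (i, j, k) IH)].
Qed.

Lemma mono_add_unit v p a : mono p (add_unit v a) = mono p a * co p v.
Proof. destruct a as [[i j] k], v; simpl; ring. Qed.

Lemma dmono_add_unit v w p a :
  dmono w p (add_unit v a) =
  dmono w p a * co p v + (match v, w with cx, cx | cy1, cy1 | cy2, cy2 => 1 | _, _ => 0 end) * mono p a.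
Proof.
  destruct a as [[i j] k], v, w; unfold add_unit, iadd, unit_idx, dmono;
  cbn [Nat.add Nat.pred]; rewrite ?S_INR, ?RtoC_plus;
  try (destruct i as [|i]); try (destruct j as [|j]); try (destruct k as [|k]);
  rewrite ?S_INR, ?RtoC_plus; simpl; ring.
Qed.

Lemma deg_add_unit v a : deg (add_unit v a) = S (deg a).
Proof. destruct a as [[i j] k], v; simpl; lia. Qed.

(** Taylor bounds for a monomial, by the product rule, adding one variable at a time. They are
    multiplied by [s] and [s ^ 2] so that no exponent [deg a - 1] or [deg a - 2] appears and [s = 0]
    is allowed. *)
Lemma mono_remainder (s : R) (p q : C3) a : (0 <= s)%R ->
  (norm3 p <= s)%R -> (norm3 q <= s)%R ->
  (Cmod (dot (fun v => dmono v p a) (sub3 q p)) * s <= INR (deg a) * s ^ deg a * norm3 (sub3 q p))%R /\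
  (Cmod (mono q a - mono p a - dot (fun v => dmono v p a) (sub3 q p)) * s ^ 2
   <= INR (deg a) ^ 2 * s ^ deg a * norm3 (sub3 q p) ^ 2)%R.
Proof.
  intros Hs Hp Hq. set (d := norm3 (sub3 q p)). assert (Hd : (0 <= d)%R) by apply norm3_nonneg.
  induction a as [|v a [IH1 IH2]] using idx_ind.
  - unfold dot. simpl.
    split; match goal with |- (Cmod ?z * _ <= _)%R => replace z with (RtoC 0) by ring end;
    rewrite Cmod_0; lra.
  - set (D := dot (fun v => dmono v p a) (sub3 q p)) in *.
    assert (ED : dot (fun w => dmono w p (add_unit v a)) (sub3 q p)
                 = D * co p v + mono p a * co (sub3 q p) v).
    { unfold D, dot. rewrite !dmono_add_unit. destruct v; ring. }
    assert (Eh : co (sub3 q p) v = co q v - co p v) by (destruct v; reflexivity).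
    assert (Bh : (Cmod (co (sub3 q p) v) <= d)%R) by apply norm3_co.
    assert (Bp : (Cmod (co p v) <= s)%R) by (eapply Rle_trans; [apply norm3_co | auto]).
    assert (Bq : (Cmod (co q v) <= s)%R) by (eapply Rle_trans; [apply norm3_co | auto]).
    assert (Bm : (Cmod (mono p a) <= s ^ deg a)%R) by (apply Cmod_mono; auto).
    assert (Sn : (0 <= s ^ deg a)%R) by (apply pow_le; auto).
    assert (Hn := pos_INR (deg a)).
    rewrite ED, !mono_add_unit, deg_add_unit, S_INR.
    change (s ^ S (deg a))%R with (s * s ^ deg a)%R.
    set (n := INR (deg a)) in *. set (sn := (s ^ deg a)%R) in *.
    split.
    + eapply Rle_trans; [apply Rmult_le_compat_r; [auto | apply Cmod_triangle]|].
      rewrite !Cmod_mult.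
      assert (Q1 : (Cmod D * s * Cmod (co p v) <= n * sn * d * s)%R)
        by (apply Rmult_le_compat; auto; try apply Rmult_le_pos; auto; apply Cmod_ge_0).
      assert (Q2 : (Cmod (mono p a) * Cmod (co (sub3 q p) v) <= sn * d)%R)
        by (apply Rmult_le_compat; auto; apply Cmod_ge_0).
      assert (Q3 : (Cmod (mono p a) * Cmod (co (sub3 q p) v) * s <= sn * d * s)%R)
        by (apply Rmult_le_compat_r; auto).
      lra.
    + set (Rm := mono q a - mono p a - D) in *.
      replace (mono q a * co q v - mono p a * co p v - (D * co p v + mono p a * co (sub3 q p) v))
        with (Rm * co q v + D * co (sub3 q p) v) by (unfold Rm; rewrite Eh; ring).
      assert (S2 : (0 <= s ^ 2)%R) by (apply pow_le; auto).
      eapply Rle_trans; [apply Rmult_le_compat_r; [auto | apply Cmod_triangle]|].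
      rewrite !Cmod_mult.
      assert (Q1 : (Cmod Rm * s ^ 2 * Cmod (co q v) <= n ^ 2 * sn * d ^ 2 * s)%R)
        by (apply Rmult_le_compat; auto; try apply Rmult_le_pos; auto; apply Cmod_ge_0).
      assert (Q2 : (Cmod D * s * Cmod (co (sub3 q p) v) <= n * sn * d * d)%R)
        by (apply Rmult_le_compat; auto; try apply Rmult_le_pos; auto; apply Cmod_ge_0).
      assert (Q3 : (Cmod D * s * Cmod (co (sub3 q p) v) * s <= n * sn * d * d * s)%R)
        by (apply Rmult_le_compat_r; auto).
      assert (Q4 : (0 <= (n + 1) * (sn * d * d * s))%R).
      { apply Rmult_le_pos; [lra|]. repeat apply Rmult_le_pos; auto. }
      nra.
Qed.

(** Complex differentiability with a quadratic remainder. Analytic functions satisfy it, and it is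
    stable under products and compositions with explicit constants, so that no limit has to be
    handled. *)
Definition frechet (f : C3 -> C) (p : C3) (l : coord -> C) : Prop :=
  exists K d : R, (0 <= K)%R /\ (0 < d)%R /\ forall q, (norm3 (sub3 q p) < d)%R ->
    (Cmod (f q - f p - dot l (sub3 q p)) <= K * norm3 (sub3 q p) ^ 2)%R.

Lemma norm3_sub_le q p : (norm3 q <= norm3 p + norm3 (sub3 q p))%R.
Proof.
  apply norm3_le. intros i.
  assert (H1 := norm3_co p i). assert (H2 := norm3_co (sub3 q p) i).
  replace (co q i) with (co p i + co (sub3 q p) i) by (destruct i; simpl; ring).
  eapply Rle_trans; [apply Cmod_triangle | lra].
Qed.

(** The quadratic remainders of the monomials are summed; the factor [deg a ^ 2] lost in each is
    absorbed by passing from the radius [s], which contains both points, to [r]. *)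
Lemma frechet_psum f r p : abs_summable f r -> (norm3 p < r)%R ->
  frechet (psum f) p (fun v => psum (fD v f) p).
Proof.
  intros Hf Hp. assert (Hp0 := norm3_nonneg p).
  set (s := ((norm3 p + r) / 2)%R).
  assert (Hs : (norm3 p < s < r)%R) by (unfold s; lra).
  destruct (pow_quad_bound_radius s r) as (K & HK & B); [lra|].
  assert (HD : forall v, exists M, summable_by (pterm (fD v f) p) M).
  { intros v. apply (abs_summable_at _ s); [apply (abs_summable_fD v f r); auto; lra | lra]. }
  set (P := (RtoC r, RtoC r, RtoC r)).
  destruct (abs_summable_at f r P Hf) as [M HM]; [unfold P; rewrite norm3_diag; lra|].
  assert (HM0 := summable_by_nonneg _ _ HM).
  exists (K / s ^ 2 * M)%R, (s - norm3 p)%R.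
  assert (Hs2 : (0 < s ^ 2)%R) by (apply pow_lt; lra).
  split; [apply Rmult_le_pos; [apply Rdiv_le_0_compat|]; lra|]. split; [lra|].
  intros q Hq. assert (Hq' : (norm3 q <= s)%R) by (assert (G := norm3_sub_le q p); lra).
  set (h := sub3 q p) in *.
  destruct (abs_summable_at f r q Hf) as [Mq HMq]; [lra|].
  destruct (abs_summable_at f r p Hf) as [Mp HMp]; [lra|].
  assert (Tq := proj1 (summable_total _ _ HMq)). assert (Tp := proj1 (summable_total _ _ HMp)).
  assert (TD : forall v, has_total (fun a => cf f a * dmono v p a) (psum (fD v f) p)).
  { intros v. destruct (HD v) as [N HN]. destruct (total_shift (unit_idx v) _ _ HN) as [E S].
    rewrite psum_total, <- E. destruct (summable_total _ _ S) as [T _].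
    intros e He. destruct (T e He) as [n0 Hn0]. exists n0. intros n Hn.
    erewrite csum_list_ext; [apply (Hn0 n Hn)|]. intros a _. symmetry. apply conv_delta_fD. }
  set (w := fun a => cf f a * (mono q a - mono p a - dot (fun v => dmono v p a) h)).
  assert (Tw : has_total w (psum f q - psum f p - dot (fun v => psum (fD v f) p) h)).
  { rewrite (psum_total f q), (psum_total f p).
    assert (T := has_total_plus _ _ _ _ (has_total_plus _ _ _ _ Tq (has_total_scal _ (- (1)) _ Tp))
      (has_total_plus _ _ _ _ (has_total_plus _ _ _ _
         (has_total_scal _ (- co h cx) _ (TD cx)) (has_total_scal _ (- co h cy1) _ (TD cy1)))
         (has_total_scal _ (- co h cy2) _ (TD cy2)))).
    match type of T with has_total _ ?S => match goal with |- has_total _ ?S' =>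
      replace S' with S by (unfold dot; ring) end end.
    intros e He. destruct (T e He) as [n0 Hn0]. exists n0. intros n Hn.
    erewrite csum_list_ext; [apply (Hn0 n Hn)|]. intros a _. unfold w, pterm, dot. ring. }
  rewrite <- (has_total_unique _ _ Tw).
  assert (Sw : summable_by w (K / s ^ 2 * norm3 h ^ 2 * M)).
  { apply summable_by_bound with (v := pterm f P); auto.
    { apply Rmult_le_pos; [apply Rdiv_le_0_compat; lra|]. apply pow_le, norm3_nonneg. }
    intros a. unfold w, pterm. rewrite !Cmod_mult.
    assert (EP : Cmod (mono P a) = (r ^ deg a)%R).
    { destruct a as [[i j] k]. unfold P. simpl.
      rewrite !Cmod_mult, !Cmod_pow, Cmod_R, Rabs_pos_eq, !pow_add by lra. auto. }
    rewrite EP.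
    destruct (mono_remainder s p q a) as [_ Hr]; [lra|lra|lra|]. fold h in Hr.
    specialize (B (deg a)).
    assert (Hr' : (Cmod (mono q a - mono p a - dot (fun v => dmono v p a) h)
                   <= K * r ^ deg a * norm3 h ^ 2 / s ^ 2)%R).
    { apply (Rmult_le_reg_r (s ^ 2)); auto.
      replace (K * r ^ deg a * norm3 h ^ 2 / s ^ 2 * s ^ 2)%R
        with (K * r ^ deg a * norm3 h ^ 2)%R by (field; lra).
      eapply Rle_trans; [apply Hr|]. apply Rmult_le_compat_r; auto. apply pow_le, norm3_nonneg. }
    replace (K / s ^ 2 * norm3 h ^ 2 * (Cmod (cf f a) * r ^ deg a))%R
      with (Cmod (cf f a) * (K * r ^ deg a * norm3 h ^ 2 / s ^ 2))%R by (field; lra).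
    apply Rmult_le_compat_l; auto. apply Cmod_ge_0. }
  eapply Rle_trans; [apply (summable_total _ _ Sw)|]. right. ring.
Qed.

(** * Germs of analytic functions *)

Definition germ_at (f : C3 -> C) (p : C3) (a : fps) (r : R) : Prop :=
  (0 < r)%R /\ abs_summable a r /\
  forall q, (norm3 (sub3 q p) < r)%R -> f q = psum a (sub3 q p).

Lemma sub3_sub3 q q' p : sub3 (sub3 q p) (sub3 q' p) = sub3 q q'.
Proof.
  unfold sub3. simpl. f_equal; [f_equal|]; ring.
Qed.

Lemma norm3_sub_triangle x y z : (norm3 (sub3 x z) <= norm3 (sub3 x y) + norm3 (sub3 y z))%R.
Proof.
  apply norm3_le. intros i.
  assert (H1 := norm3_co (sub3 x y) i). assert (H2 := norm3_co (sub3 y z) i).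
  replace (co (sub3 x z) i) with (co (sub3 x y) i + co (sub3 y z) i) by (destruct i; simpl; ring).
  eapply Rle_trans; [apply Cmod_triangle | lra].
Qed.

Lemma norm3_sub_self p : norm3 (sub3 p p) = 0%R.
Proof.
  apply Rle_antisym; [|apply norm3_nonneg]. apply norm3_le. intros i.
  replace (co (sub3 p p) i) with (RtoC 0) by (destruct i; simpl; ring). rewrite Cmod_0. lra.
Qed.

(** The expansion at [p] also gives the derivatives at neighbouring points, so no series is ever
    expanded again at another centre. *)
Lemma germ_frechet f p a r q : germ_at f p a r -> (norm3 (sub3 q p) < r)%R ->
  frechet f q (fun v => psum (fD v a) (sub3 q p)).
Proof.
  intros (Hr & Ha & Hf) Hq.
  destruct (frechet_psum a r (sub3 q p) Ha Hq) as (K & d & HK & Hd & H).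
  exists K, (Rmin d (r - norm3 (sub3 q p)))%R. split; auto.
  split; [apply Rmin_pos; lra|]. intros q' Hq'.
  assert (G1 := Rmin_l d (r - norm3 (sub3 q p))). assert (G2 := Rmin_r d (r - norm3 (sub3 q p))).
  assert (G3 := norm3_sub_triangle q' q p).
  specialize (H (sub3 q' p)). rewrite sub3_sub3 in H. rewrite !Hf by lra. apply H. lra.
Qed.

Lemma co_upd_sub p v t i : co (sub3 (upd p v t) p) i =
  match v, i with cx, cx | cy1, cy1 | cy2, cy2 => t - co p v | _, _ => 0 end.
Proof. destruct v, i; simpl; ring. Qed.

Lemma norm3_upd_sub p v t : norm3 (sub3 (upd p v t) p) = Cmod (t - co p v).
Proof.
  apply Rle_antisym.
  - apply norm3_le. intros i. rewrite co_upd_sub.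
    destruct v, i; rewrite ?Cmod_0; try apply Cmod_ge_0; lra.
  - eapply Rle_trans; [|apply (norm3_co _ v)]. rewrite co_upd_sub. destruct v; lra.
Qed.

Lemma upd_co p v : upd p v (co p v) = p.
Proof. destruct p as [[x y] z], v; reflexivity. Qed.

Lemma dot_upd l p v t : dot l (sub3 (upd p v t) p) = l v * (t - co p v).
Proof. unfold dot. rewrite !co_upd_sub. destruct v; ring. Qed.

Lemma C_derive_quadratic (g : C -> C) z l K d : (0 <= K)%R -> (0 < d)%R ->
  (forall t, (Cmod (t - z) < d)%R -> (Cmod (g t - g z - l * (t - z)) <= K * Cmod (t - z) ^ 2)%R) ->
  C_derive g z = l.
Proof.
  intros HK Hd H.
  (* [C_derive] takes limits along real increments only, separately for the real and the imaginary
     part. *)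
  assert (Q : forall e : R, (0 < e)%R -> exists d', (0 < d')%R /\ forall x, (Rabs (x - fst z) < d')%R ->
     x <> fst z -> (Cmod ((g (x, snd z) - g z) / ((x, snd z) - z) - l) < e)%R).
  { intros e He. exists (Rmin d (e / (K + 1)))%R. split.
    { apply Rmin_pos; auto. apply Rdiv_lt_0_compat; lra. }
    intros x Hx Hne. assert (G1 := Rmin_l d (e / (K + 1))). assert (G2 := Rmin_r d (e / (K + 1))).
    set (t := (x, snd z) : C).
    assert (Et : t - z = RtoC (x - fst z)) by (apply injective_projections; simpl; ring).
    assert (Hn : (0 < Rabs (x - fst z))%R) by (apply Rabs_pos_lt; lra).
    specialize (H t). rewrite Et in *. rewrite Cmod_R in H. specialize (H ltac:(lra)).
    set (h := (x - fst z)%R) in *.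
    assert (Hh : RtoC h <> 0) by (intros E; apply RtoC_inj in E; rewrite E, Rabs_R0 in Hn; lra).
    replace ((g t - g z) / RtoC h - l) with ((g t - g z - l * RtoC h) / RtoC h) by (field; auto).
    rewrite Cmod_div, Cmod_R by auto.
    apply (Rmult_lt_reg_r (Rabs h)); auto.
    replace (Cmod (g t - g z - l * RtoC h) / Rabs h * Rabs h)%R with (Cmod (g t - g z - l * RtoC h))%R by (field; lra).
    eapply Rle_lt_trans; [apply H|]. replace (K * Rabs h ^ 2)%R with (K * Rabs h * Rabs h)%R by ring.
    apply Rmult_lt_compat_r; auto.
    apply Rle_lt_trans with (K * (e / (K + 1)))%R; [apply Rmult_le_compat_l; lra|].
    replace e with ((K + 1) * (e / (K + 1)))%R at 2 by (field; lra).
    apply Rmult_lt_compat_r; [apply Rdiv_lt_0_compat|]; lra. }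
  unfold C_derive, C_lim. rewrite (surjective_pairing l) at 1. f_equal.
  - rewrite (is_lim_unique _ _ (Finite (fst l))); [reflexivity|]. apply is_lim_spec. intros e.
    destruct (Q e (cond_pos e)) as (d' & Hd' & HQ). exists (mkposreal d' Hd'). intros x Hx Hne.
    eapply Rle_lt_trans; [|apply (HQ x Hx Hne)]. exact (Re_le_Cmod (_ - _)).
  - rewrite (is_lim_unique _ _ (Finite (snd l))); [reflexivity|]. apply is_lim_spec. intros e.
    destruct (Q e (cond_pos e)) as (d' & Hd' & HQ). exists (mkposreal d' Hd'). intros x Hx Hne.
    eapply Rle_lt_trans; [|apply (HQ x Hx Hne)]. exact (Im_le_Cmod (_ - _)).
Qed.

Lemma frechet_partial f p l v : frechet f p l -> partial v f p = l v.
Proof.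
  intros (K & d & HK & Hd & H). unfold partial. apply (C_derive_quadratic _ _ _ K d); auto.
  intros t Ht. specialize (H (upd p v t)). rewrite norm3_upd_sub, dot_upd in H.
  rewrite upd_co. auto.
Qed.

Lemma germ_shrink f p a r s : germ_at f p a r -> (0 < s <= r)%R -> germ_at f p a s.
Proof.
  intros (Hr & Ha & Hf) Hs. split; [lra|]. split; [apply (abs_summable_le a r); auto; lra|].
  intros q Hq. apply Hf. lra.
Qed.

Lemma germ_partial v f p a r : germ_at f p a r -> germ_at (partial v f) p (fD v a) (r / 2).
Proof.
  intros H. assert (H' := H). destruct H' as (Hr & Ha & Hf). split; [lra|]. split.
  - apply (abs_summable_fD v a r); auto. lra.
  - intros q Hq. apply (frechet_partial f q (fun v => psum (fD v a) (sub3 q p))).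
    apply (germ_frechet f p a r); auto. lra.
Qed.

Definition analytic_at (f : C3 -> C) (p : C3) : Prop := exists a r, germ_at f p a r.

Lemma analytic_partial v f p : analytic_at f p -> analytic_at (partial v f) p.
Proof. intros (a & r & H). exists (fD v a), (r / 2)%R. apply germ_partial. auto. Qed.

Lemma analytic_binop (F : fps -> fps -> fps) (G : C -> C -> C) :
  (forall f g r, (0 <= r)%R -> abs_summable f r -> abs_summable g r -> abs_summable (F f g) r) ->
  (forall f g p M N, summable_by (pterm f p) M -> summable_by (pterm g p) N ->
     psum (F f g) p = G (psum f p) (psum g p)) ->
  forall f g p, analytic_at f p -> analytic_at g p -> analytic_at (fun q => G (f q) (g q)) p.
Proof.
  intros HF HG f g p (a & r & Ha) (b & s & Hb).
  assert (Ht : (0 < Rmin r s)%R) by (apply Rmin_pos; [apply Ha | apply Hb]).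
  apply germ_shrink with (s := Rmin r s) in Ha; [|split; [auto | apply Rmin_l]].
  apply germ_shrink with (s := Rmin r s) in Hb; [|split; [auto | apply Rmin_r]].
  destruct Ha as (_ & Ha & Hf), Hb as (_ & Hb & Hg).
  exists (F a b), (Rmin r s). split; auto. split; [apply HF; auto; lra|].
  intros q Hq. rewrite Hf, Hg by auto.
  destruct (abs_summable_at a (Rmin r s) (sub3 q p) Ha) as [M HM]; [lra|].
  destruct (abs_summable_at b (Rmin r s) (sub3 q p) Hb) as [N HN]; [lra|].
  symmetry. eapply HG; eauto.
Qed.

Lemma analytic_plus f g p : analytic_at f p -> analytic_at g p -> analytic_at (fun q => f q + g q) p.
Proof. apply (analytic_binop fadd Cplus); [apply abs_summable_fadd | apply psum_fadd]. Qed.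

Lemma analytic_mult f g p : analytic_at f p -> analytic_at g p -> analytic_at (fun q => f q * g q) p.
Proof. apply (analytic_binop fmul Cmult); [apply abs_summable_fmul | apply psum_fmul]. Qed.

Lemma analytic_const c p : analytic_at (fun _ => c) p.
Proof.
  exists (fcst c), 1%R. split; [lra|]. split; [apply abs_summable_fcst; lra|].
  intros q _. symmetry. apply psum_fcst.
Qed.

Lemma analytic_opp f p : analytic_at f p -> analytic_at (fun q => - f q) p.
Proof.
  intros H. destruct (analytic_mult (fun _ => - (1)) f p (analytic_const _ p) H) as (a & r & Hr & Ha & E).
  exists a, r. split; auto. split; auto. intros q Hq. rewrite <- E by auto. ring.
Qed.

Lemma analytic_minus f g p : analytic_at f p -> analytic_at g p -> analytic_at (fun q => f q - g q) p.
Proof. intros Hf Hg. apply analytic_plus; auto. apply analytic_opp; auto. Qed.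

Lemma geometric_half n : (rsum_list (seq 0 (S n)) (fun i => (/ 2) ^ i) <= 2)%R.
Proof.
  assert (E : (rsum_list (seq 0 (S n)) (fun i => (/ 2) ^ i) = 2 - (/ 2) ^ n)%R).
  { induction n as [|n IH]; [simpl; lra|].
    rewrite seq_S, rsum_list_app, IH. simpl. lra. }
  rewrite E. assert (0 < (/ 2) ^ n)%R by (apply pow_lt; lra). lra.
Qed.

(** The expansion of [1 / (x + h)] in powers of [h]. *)
Definition inv_series (x : C) : fps := fun i j k =>
  if ((j =? 0) && (k =? 0))%nat then / x * Cpow (- / x) i else 0.

Lemma inv_series_mul (x : C) : x <> 0 -> feq (fmul (fadd (fcst x) (fvar cx)) (inv_series x)) (fcst 1).
Proof.
  intros Hx i j k. change (cf (fmul (fadd (fcst x) (fvar cx)) (inv_series x)) (i, j, k) = fcst 1 i j k).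
  rewrite fmul_conv.
  assert (E : conv (cf (fadd (fcst x) (fvar cx))) (cf (inv_series x)) (i, j, k)
     = conv (cf (fcst x)) (cf (inv_series x)) (i, j, k) + conv (cf (fvar cx)) (cf (inv_series x)) (i, j, k)).
  { unfold conv. rewrite <- csum_list_plus. apply csum_list_ext. intros [[a b] c] _.
    unfold cf, fadd. ring. }
  rewrite E, (conv_supported _ _ _ _ _ (fcst_support x)), (conv_supported _ _ _ _ _ (fvar_support cx)).
  simpl unit_idx. unfold cf, fvar, fcst, inv_series. simpl Nat.leb. cbn [andb].
  destruct i as [|i]; cbn [andb Nat.leb]; rewrite ?Nat.sub_0_r; simpl Nat.add; simpl Nat.eqb; cbn [andb];
  destruct j as [|j], k as [|k]; cbn [andb Nat.eqb Nat.add Cpow]; rewrite ?Nat.sub_0_r; try ring.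
  - apply Cinv_r in Hx. rewrite Cmult_1_r, Hx. ring.
  - match goal with |- context [(S ?m - 1)%nat] => replace (S m - 1)%nat with m by lia end.
    field. auto.
Qed.

Lemma abs_summable_inv (x : C) : x <> 0 -> abs_summable (inv_series x) (Cmod x / 2).
Proof.
  intros Hx. assert (Px : (0 < Cmod x)%R) by (apply Cmod_gt_0; auto).
  apply abs_summable_iff. exists (/ Cmod x * (2 * 2 * 2))%R. intros n.
  set (g := fun i : nat => ((/ 2) ^ i)%R).
  assert (Pg : forall i, (0 <= g i)%R) by (intros; apply pow_le; lra).
  apply Rle_trans with (rsum_list (cube n) (fun '(i, j, k) => / Cmod x * (g i * g j * g k))%R).
  - apply rsum_list_le. intros [[i j] k] _. simpl. unfold inv_series.
    destruct j as [|j], k as [|k]; simpl Nat.eqb; cbn [andb];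
    try (rewrite Cmod_0, Rmult_0_l; apply Rmult_le_pos;
         [left; apply Rinv_0_lt_compat; auto | apply Rmult_le_pos; [apply Rmult_le_pos|]; apply Pg]).
    rewrite Cmod_mult, Cmod_pow, Cmod_opp, Cmod_inv by auto.
    rewrite !Nat.add_0_r. rewrite Rmult_assoc, <- Rpow_mult_distr.
    right. unfold g. simpl. rewrite !Rmult_1_r. do 2 f_equal. field. lra.
  - unfold cube. rewrite !rsum_list_prod.
    rewrite (rsum_list_ext _ _ (fun i => / Cmod x * (g i * (rsum_list (seq 0 (S n)) g * rsum_list (seq 0 (S n)) g)))%R).
    + rewrite rsum_list_scal.
      apply Rmult_le_compat_l; [left; apply Rinv_0_lt_compat; auto|].
      rewrite (rsum_list_ext _ _ (fun i => rsum_list (seq 0 (S n)) g * rsum_list (seq 0 (S n)) g * g i)%R)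
        by (intros; ring).
      rewrite rsum_list_scal. assert (G := geometric_half n). fold g in G.
      assert (0 <= rsum_list (seq 0 (S n)) g)%R by (apply rsum_list_nonneg; auto).
      set (S := rsum_list (seq 0 (Datatypes.S n)) g) in *.
      assert (S * S <= 2 * 2)%R by nra. nra.
    + intros i _. rewrite rprod_sums, <- !rsum_list_scal. apply rsum_list_ext. intros j _.
      rewrite <- !rsum_list_scal. apply rsum_list_ext. intros k _. ring.
Qed.

(** The geometric series is not summed directly: its product with [x + h] is the constant series 1,
    and evaluation is multiplicative. The same identity shows that [co q cx] does not vanish near
    [p]. *)
Lemma analytic_inv_x p : co p cx <> 0 -> analytic_at (fun q => / co q cx) p.
Proof.
  intros Hx. set (x := co p cx) in *. assert (Px : (0 < Cmod x)%R) by (apply Cmod_gt_0; auto).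
  exists (inv_series x), (Cmod x / 2)%R. split; [lra|].
  split; [apply abs_summable_inv; auto|]. intros q Hq.
  destruct (abs_summable_at _ _ (sub3 q p) (abs_summable_inv x Hx)) as [M HM]; [lra|].
  assert (Hl : abs_summable (fadd (fcst x) (fvar cx)) (Cmod x / 2)).
  { apply abs_summable_fadd; [lra | apply abs_summable_fcst; lra | apply abs_summable_fvar; lra]. }
  destruct (abs_summable_at _ _ (sub3 q p) Hl) as [N HN]; [lra|].
  assert (E := psum_fmul _ _ _ _ _ HN HM).
  rewrite (psum_ext _ _ _ (inv_series_mul x Hx)) in E.
  destruct (psum_fcst 1 (sub3 q p)) as [E1 _]. rewrite E1 in E.
  destruct (psum_fcst x (sub3 q p)) as [E2 [M2 H2]].
  destruct (psum_fvar cx (sub3 q p)) as [E3 [M3 H3]].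
  rewrite (psum_fadd _ _ _ _ _ H2 H3), E2, E3 in E.
  replace (x + co (sub3 q p) cx) with (co q cx) in E by (unfold x; simpl; ring).
  assert (Hq0 : co q cx <> 0) by (intros E0; rewrite E0 in E; apply C1_nz; rewrite E; ring).
  apply (f_equal (Cmult (/ co q cx))) in E.
  rewrite Cmult_assoc, Cinv_l, Cmult_1_l, Cmult_1_r in E by auto. auto.
Qed.

Lemma Rle_small_zero (x K d : R) : (0 <= x)%R -> (0 < d)%R ->
  (forall h, (0 < h < d)%R -> (x <= K * h)%R) -> x = 0%R.
Proof.
  intros Hx Hd H. apply Rle_antisym; auto. apply le_epsilon. intros e He.
  set (h := (Rmin (d / 2) (e / (Rabs K + 1)))%R).
  assert (HK := Rabs_pos K). assert (HK' := Rle_abs K).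
  assert (Hh : (0 < h)%R) by (apply Rmin_pos; [lra | apply Rdiv_lt_0_compat; lra]).
  assert (H1 : (h <= d / 2)%R) by apply Rmin_l. assert (H2 : (h <= e / (Rabs K + 1))%R) by apply Rmin_r.
  specialize (H h ltac:(lra)).
  assert ((Rabs K + 1) * h <= e)%R.
  { apply (Rmult_le_compat_l (Rabs K + 1)) in H2; [|lra].
    replace ((Rabs K + 1) * (e / (Rabs K + 1)))%R with e in H2 by (field; lra). auto. }
  nra.
Qed.

Lemma Cmod_dot l h : (Cmod (dot l h) <= (Cmod (l cx) + Cmod (l cy1) + Cmod (l cy2)) * norm3 h)%R.
Proof.
  unfold dot. eapply Rle_trans; [apply Cmod_triangle|].
  eapply Rle_trans; [apply Rplus_le_compat_r, Cmod_triangle|]. rewrite !Cmod_mult.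
  assert (H1 := norm3_co h cx). assert (H2 := norm3_co h cy1). assert (H3 := norm3_co h cy2).
  assert (G1 := Cmod_ge_0 (l cx)). assert (G2 := Cmod_ge_0 (l cy1)). assert (G3 := Cmod_ge_0 (l cy2)).
  assert (Cmod (l cx) * Cmod (co h cx) <= Cmod (l cx) * norm3 h)%R by (apply Rmult_le_compat_l; auto).
  assert (Cmod (l cy1) * Cmod (co h cy1) <= Cmod (l cy1) * norm3 h)%R by (apply Rmult_le_compat_l; auto).
  assert (Cmod (l cy2) * Cmod (co h cy2) <= Cmod (l cy2) * norm3 h)%R by (apply Rmult_le_compat_l; auto).
  lra.
Qed.

Lemma frechet_lipschitz f p l : frechet f p l ->
  exists L d, (0 <= L)%R /\ (0 < d)%R /\ forall q, (norm3 (sub3 q p) < d)%R ->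
    (Cmod (f q - f p) <= L * norm3 (sub3 q p))%R.
Proof.
  intros (K & d & HK & Hd & H).
  set (A := (Cmod (l cx) + Cmod (l cy1) + Cmod (l cy2))%R).
  assert (HA : (0 <= A)%R) by (unfold A; repeat apply Rplus_le_le_0_compat; apply Cmod_ge_0).
  exists (A + K)%R, (Rmin d 1). split; [lra|]. split; [apply Rmin_pos; lra|].
  intros q Hq. assert (G1 := Rmin_l d 1). assert (G2 := Rmin_r d 1).
  specialize (H q ltac:(lra)). assert (Hd0 := Cmod_dot l (sub3 q p)). fold A in Hd0.
  assert (Hn := norm3_nonneg (sub3 q p)). set (h := norm3 (sub3 q p)) in *.
  replace (f q - f p) with ((f q - f p - dot l (sub3 q p)) + dot l (sub3 q p)) by ring.
  eapply Rle_trans; [apply Cmod_triangle|].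
  assert (K * h ^ 2 <= K * h)%R by (apply Rmult_le_compat_l; [auto | nra]). lra.
Qed.

Lemma frechet_ext f p l l' : (forall v, l v = l' v) -> frechet f p l -> frechet f p l'.
Proof.
  intros E (K & d & HK & Hd & H). exists K, d. do 2 (split; auto). intros q Hq.
  specialize (H q Hq). unfold dot in *. rewrite <- !E. auto.
Qed.

Lemma frechet_plus f g p l m : frechet f p l -> frechet g p m ->
  frechet (fun q => f q + g q) p (fun v => l v + m v).
Proof.
  intros (K & d & HK & Hd & H) (K' & d' & HK' & Hd' & H').
  exists (K + K')%R, (Rmin d d'). split; [lra|]. split; [apply Rmin_pos; auto|].
  intros q Hq. assert (G1 := Rmin_l d d'). assert (G2 := Rmin_r d d').
  specialize (H q ltac:(lra)). specialize (H' q ltac:(lra)).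
  replace (f q + g q - (f p + g p) - dot (fun v => l v + m v) (sub3 q p))
    with ((f q - f p - dot l (sub3 q p)) + (g q - g p - dot m (sub3 q p))) by (unfold dot; ring).
  eapply Rle_trans; [apply Cmod_triangle | lra].
Qed.

Lemma frechet_const c p : frechet (fun _ => c) p (fun _ => 0).
Proof.
  exists 0%R, 1%R. split; [lra|]. split; [lra|]. intros q _.
  replace (c - c - dot (fun _ => 0) (sub3 q p)) with (RtoC 0) by (unfold dot; ring).
  rewrite Cmod_0. lra.
Qed.

Lemma frechet_mult f g p l m : frechet f p l -> frechet g p m ->
  frechet (fun q => f q * g q) p (fun v => l v * g p + f p * m v).
Proof.
  intros Hf Hg. destruct (frechet_lipschitz _ _ _ Hf) as (L & e & HL & He & Lf).
  destruct (frechet_lipschitz _ _ _ Hg) as (L' & e' & HL' & He' & Lg).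
  destruct Hf as (K & d & HK & Hd & H), Hg as (K' & d' & HK' & Hd' & H').
  assert (P1 := Cmod_ge_0 (f p)). assert (P2 := Cmod_ge_0 (g p)).
  exists (K * Cmod (g p) + Cmod (f p) * K' + L * L')%R, (Rmin (Rmin d d') (Rmin e e')).
  split; [repeat apply Rplus_le_le_0_compat; apply Rmult_le_pos; auto|].
  split; [repeat apply Rmin_pos; auto|]. intros q Hq.
  assert (G1 := Rmin_l (Rmin d d') (Rmin e e')). assert (G2 := Rmin_r (Rmin d d') (Rmin e e')).
  assert (G3 := Rmin_l d d'). assert (G4 := Rmin_r d d').
  assert (G5 := Rmin_l e e'). assert (G6 := Rmin_r e e').
  specialize (H q ltac:(lra)). specialize (H' q ltac:(lra)).
  specialize (Lf q ltac:(lra)). specialize (Lg q ltac:(lra)).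
  replace (f q * g q - f p * g p - dot (fun v => l v * g p + f p * m v) (sub3 q p))
    with ((f q - f p - dot l (sub3 q p)) * g p + f p * (g q - g p - dot m (sub3 q p))
          + (f q - f p) * (g q - g p)) by (unfold dot; ring).
  eapply Rle_trans; [apply Cmod_triangle|].
  eapply Rle_trans; [apply Rplus_le_compat_r, Cmod_triangle|]. rewrite !Cmod_mult.
  set (h := norm3 (sub3 q p)) in *.
  apply Rle_trans with (K * h ^ 2 * Cmod (g p) + Cmod (f p) * (K' * h ^ 2) + (L * h) * (L' * h))%R.
  - repeat apply Rplus_le_compat.
    + apply Rmult_le_compat_r; auto.
    + apply Rmult_le_compat_l; auto.
    + apply Rmult_le_compat; auto; apply Cmod_ge_0.
  - right. ring.
Qed.

Lemma frechet_opp f p l : frechet f p l -> frechet (fun q => - f q) p (fun v => - l v).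
Proof.
  intros (K & d & HK & Hd & H). exists K, d. do 2 (split; auto). intros q Hq.
  specialize (H q Hq). rewrite <- Cmod_opp.
  replace (- (- f q - - f p - dot (fun v => - l v) (sub3 q p)))
    with (f q - f p - dot l (sub3 q p)) by (unfold dot; ring). auto.
Qed.

Lemma frechet_minus f g p l m : frechet f p l -> frechet g p m ->
  frechet (fun q => f q - g q) p (fun v => l v - m v).
Proof. intros Hf Hg. apply frechet_plus; auto. apply frechet_opp; auto. Qed.

Lemma frechet_comp f (P : C3 -> C3) p l m :
  frechet f (P p) l -> (forall i, frechet (fun q => co (P q) i) p (m i)) ->
  frechet (fun q => f (P q)) p (fun v => l cx * m cx v + l cy1 * m cy1 v + l cy2 * m cy2 v).
Proof.
  intros (K & d & HK & Hd & H) Hm.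
  assert (HL : exists L e, (0 <= L)%R /\ (0 < e)%R /\ forall q, (norm3 (sub3 q p) < e)%R ->
    (norm3 (sub3 (P q) (P p)) <= L * norm3 (sub3 q p))%R).
  { assert (A := fun i => frechet_lipschitz _ _ _ (Hm i)).
    destruct (A cx) as (L1 & e1 & ? & ? & A1), (A cy1) as (L2 & e2 & ? & ? & A2), (A cy2) as (L3 & e3 & ? & ? & A3).
    exists (L1 + L2 + L3)%R, (Rmin e1 (Rmin e2 e3)). split; [lra|].
    split; [repeat apply Rmin_pos; auto|]. intros q Hq.
    assert (G1 := Rmin_l e1 (Rmin e2 e3)). assert (G2 := Rmin_r e1 (Rmin e2 e3)).
    assert (G3 := Rmin_l e2 e3). assert (G4 := Rmin_r e2 e3).
    specialize (A1 q ltac:(lra)). specialize (A2 q ltac:(lra)). specialize (A3 q ltac:(lra)).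
    assert (Hn := norm3_nonneg (sub3 q p)). set (h := norm3 (sub3 q p)) in *.
    assert (0 <= L1 * h)%R by (apply Rmult_le_pos; auto).
    assert (0 <= L2 * h)%R by (apply Rmult_le_pos; auto).
    assert (0 <= L3 * h)%R by (apply Rmult_le_pos; auto).
    apply norm3_le. intros i.
    replace (co (sub3 (P q) (P p)) i) with (co (P q) i - co (P p) i) by (destruct i; reflexivity).
    destruct i; lra. }
  destruct HL as (L & e & HL & He & HLip).
  destruct (Hm cx) as (K1 & d1 & HK1 & Hd1 & R1), (Hm cy1) as (K2 & d2 & HK2 & Hd2 & R2),
    (Hm cy2) as (K3 & d3 & HK3 & Hd3 & R3).
  assert (P1 := Cmod_ge_0 (l cx)). assert (P2 := Cmod_ge_0 (l cy1)). assert (P3 := Cmod_ge_0 (l cy2)).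
  exists (K * L ^ 2 + (Cmod (l cx) * K1 + Cmod (l cy1) * K2 + Cmod (l cy2) * K3))%R.
  set (D := Rmin (Rmin e (d / (L + 1))) (Rmin d1 (Rmin d2 d3))).
  exists D. split.
  { assert (0 <= L ^ 2)%R by (apply pow_le; auto).
    repeat apply Rplus_le_le_0_compat; apply Rmult_le_pos; auto. }
  split; [repeat apply Rmin_pos; auto; apply Rdiv_lt_0_compat; lra|].
  intros q Hq. unfold D in Hq.
  assert (G1 := Rmin_l (Rmin e (d / (L + 1))) (Rmin d1 (Rmin d2 d3))).
  assert (G2 := Rmin_r (Rmin e (d / (L + 1))) (Rmin d1 (Rmin d2 d3))).
  assert (G3 := Rmin_l e (d / (L + 1))). assert (G4 := Rmin_r e (d / (L + 1))).
  assert (G5 := Rmin_l d1 (Rmin d2 d3)). assert (G6 := Rmin_r d1 (Rmin d2 d3)).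
  assert (G7 := Rmin_l d2 d3). assert (G8 := Rmin_r d2 d3).
  specialize (HLip q ltac:(lra)). specialize (R1 q ltac:(lra)). specialize (R2 q ltac:(lra)). specialize (R3 q ltac:(lra)).
  assert (Hn := norm3_nonneg (sub3 q p)). set (h := norm3 (sub3 q p)) in *.
  assert (Hh : (L * h < d)%R).
  { assert ((L + 1) * h < d)%R; [|nra].
    assert (B : (h < d / (L + 1))%R) by lra.
    apply (Rmult_lt_compat_l (L + 1)) in B; [|lra].
    replace ((L + 1) * (d / (L + 1)))%R with d in B by (field; lra). auto. }
  specialize (H (P q) ltac:(lra)).
  replace (f (P q) - f (P p) - dot (fun v => l cx * m cx v + l cy1 * m cy1 v + l cy2 * m cy2 v) (sub3 q p))
    with ((f (P q) - f (P p) - dot l (sub3 (P q) (P p)))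
      + (l cx * (co (P q) cx - co (P p) cx - dot (m cx) (sub3 q p))
       + l cy1 * (co (P q) cy1 - co (P p) cy1 - dot (m cy1) (sub3 q p))
       + l cy2 * (co (P q) cy2 - co (P p) cy2 - dot (m cy2) (sub3 q p))))
    by (unfold dot; simpl; ring).
  eapply Rle_trans; [apply Cmod_triangle|].
  eapply Rle_trans; [apply Rplus_le_compat_l, Cmod_triangle|].
  eapply Rle_trans; [apply Rplus_le_compat_l, Rplus_le_compat_r, Cmod_triangle|].
  rewrite !Cmod_mult.
  apply Rle_trans with (K * (L * h) ^ 2 + (Cmod (l cx) * (K1 * h ^ 2) + Cmod (l cy1) * (K2 * h ^ 2)
    + Cmod (l cy2) * (K3 * h ^ 2)))%R; [|right; ring].
  apply Rplus_le_compat.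
  - eapply Rle_trans; [apply H|]. apply Rmult_le_compat_l; auto. apply pow_incr.
    split; [apply norm3_nonneg | auto].
  - repeat apply Rplus_le_compat; apply Rmult_le_compat_l; auto.
Qed.

(** Applied to the difference of two sides, it differentiates an identity that is known only on a
    disc in one coordinate. *)
Lemma frechet_direction f p l v d : frechet f p l -> (0 < d)%R ->
  (forall t, (Cmod (t - co p v) < d)%R -> f (upd p v t) = 0) -> l v = 0.
Proof.
  intros (K & e & HK & He & H) Hd Hz. apply Cmod_eq_0.
  apply (Rle_small_zero _ K (Rmin d e)); [apply Cmod_ge_0 | apply Rmin_pos; auto |].
  intros h Hh. assert (G1 := Rmin_l d e). assert (G2 := Rmin_r d e).
  specialize (H (upd p v (co p v + RtoC h))). rewrite norm3_upd_sub, dot_upd in H.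
  replace (co p v + RtoC h - co p v) with (RtoC h) in H by ring.
  rewrite Cmod_R, Rabs_pos_eq in H by lra. specialize (H ltac:(lra)).
  rewrite Hz in H.
  2: { replace (co p v + RtoC h - co p v) with (RtoC h) by ring. rewrite Cmod_R, Rabs_pos_eq; lra. }
  assert (Hp : f p = 0).
  { rewrite <- (upd_co p v). apply Hz.
    replace (co p v - co p v) with (RtoC 0) by ring. rewrite Cmod_0. lra. }
  rewrite Hp in H. replace (RtoC 0 - RtoC 0 - l v * RtoC h) with (- (l v * RtoC h)) in H by ring.
  rewrite Cmod_opp, Cmod_mult, Cmod_R, Rabs_pos_eq in H by lra.
  apply (Rmult_le_reg_r h); [lra|]. eapply Rle_trans; [apply H|]. right. ring.
Qed.

Lemma analytic_frechet f p : analytic_at f p -> frechet f p (fun v => partial v f p).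
Proof.
  intros (a & r & H). assert (Hr := proj1 H).
  assert (F : frechet f p (fun v => psum (fD v a) (sub3 p p))).
  { apply (germ_frechet f p a r); auto. rewrite norm3_sub_self. auto. }
  apply (frechet_ext _ _ _ _ (fun v => eq_sym (frechet_partial _ _ _ v F)) F).
Qed.

Lemma partial_comm f p v w : analytic_at f p ->
  partial v (partial w f) p = partial w (partial v f) p.
Proof.
  intros (a & r & H).
  assert (E : forall v w, partial v (partial w f) p = psum (fD v (fD w a)) (sub3 p p)).
  { intros v' w'. assert (G := germ_partial w' _ _ _ _ H).
    apply (frechet_partial _ _ (fun v => psum (fD v (fD w' a)) (sub3 p p))).
    apply (germ_frechet _ p _ (r / 2)); auto. rewrite norm3_sub_self. destruct H. lra. }
  rewrite !E. apply psum_ext. intros i j k. destruct v, w; unfold fD; ring.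
Qed.

(** Derivative of a curve in real time. Unlike [frechet] it asks for no quadratic remainder, because
    the curves include exponentials of real integrals. *)
Definition cderiv (g : R -> C) (t : R) (l : C) : Prop :=
  forall e : R, (0 < e)%R -> exists d : R, (0 < d)%R /\ forall s : R, (Rabs (s - t) < d)%R ->
    (Cmod (g s - g t - l * RtoC (s - t)) <= e * Rabs (s - t))%R.

Lemma cderiv_comp f (G : R -> C3) t l m : frechet f (G t) l ->
  (forall i, cderiv (fun s => co (G s) i) t (m i)) ->
  cderiv (fun s => f (G s)) t (l cx * m cx + l cy1 * m cy1 + l cy2 * m cy2).
Proof.
  intros (K & d & HK & Hd & H) Hm e He.
  set (A := (Cmod (l cx) + Cmod (l cy1) + Cmod (l cy2) + 1)%R).
  assert (HA : (0 < A)%R) by (unfold A; assert (G1 := Cmod_ge_0 (l cx)); assert (G2 := Cmod_ge_0 (l cy1));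
    assert (G3 := Cmod_ge_0 (l cy2)); lra).
  assert (He1 : (0 < e / (2 * A))%R) by (apply Rdiv_lt_0_compat; lra).
  (* [B] is a Lipschitz constant of the curve near [t]; the linear errors, weighted by [A], and the
     quadratic one, weighted by [K * B ^ 2], each get half of [e]. *)
  set (B := (Cmod (m cx) + Cmod (m cy1) + Cmod (m cy2) + e / (2 * A))%R).
  assert (HB : (0 < B)%R) by (unfold B; assert (G1 := Cmod_ge_0 (m cx)); assert (G2 := Cmod_ge_0 (m cy1));
    assert (G3 := Cmod_ge_0 (m cy2)); lra).
  destruct (Hm cx _ He1) as (d1 & Hd1 & R1), (Hm cy1 _ He1) as (d2 & Hd2 & R2), (Hm cy2 _ He1) as (d3 & Hd3 & R3).
  set (D := Rmin (Rmin (d / B) (e / (2 * (K * B ^ 2 + 1)))) (Rmin d1 (Rmin d2 d3))).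
  assert (HKB : (0 <= K * B ^ 2)%R) by (apply Rmult_le_pos; auto; apply pow_le; lra).
  exists D. split; [repeat apply Rmin_pos; auto; apply Rdiv_lt_0_compat; lra|].
  intros s Hs. unfold D in Hs.
  assert (G1 := Rmin_l (Rmin (d / B) (e / (2 * (K * B ^ 2 + 1)))) (Rmin d1 (Rmin d2 d3))).
  assert (G2 := Rmin_r (Rmin (d / B) (e / (2 * (K * B ^ 2 + 1)))) (Rmin d1 (Rmin d2 d3))).
  assert (G3 := Rmin_l (d / B) (e / (2 * (K * B ^ 2 + 1)))). assert (G4 := Rmin_r (d / B) (e / (2 * (K * B ^ 2 + 1)))).
  assert (G5 := Rmin_l d1 (Rmin d2 d3)). assert (G6 := Rmin_r d1 (Rmin d2 d3)).
  assert (G7 := Rmin_l d2 d3). assert (G8 := Rmin_r d2 d3).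
  specialize (R1 s ltac:(lra)). specialize (R2 s ltac:(lra)). specialize (R3 s ltac:(lra)).
  assert (Hn := Rabs_pos (s - t)). set (h := Rabs (s - t)) in *.
  assert (Hlip : (norm3 (sub3 (G s) (G t)) <= B * h)%R).
  { apply norm3_le. intros i.
    assert (Q : forall i, (Cmod (co (G s) i - co (G t) i - m i * RtoC (s - t)) <= e / (2 * A) * h)%R)
      by (intros []; auto).
    specialize (Q i).
    replace (co (sub3 (G s) (G t)) i)
      with ((co (G s) i - co (G t) i - m i * RtoC (s - t)) + m i * RtoC (s - t)) by (destruct i; simpl; ring).
    eapply Rle_trans; [apply Cmod_triangle|]. rewrite Cmod_mult, Cmod_R. fold h.
    assert (Hi : (Cmod (m i) <= Cmod (m cx) + Cmod (m cy1) + Cmod (m cy2))%R).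
    { assert (X1 := Cmod_ge_0 (m cx)). assert (X2 := Cmod_ge_0 (m cy1)). assert (X3 := Cmod_ge_0 (m cy2)).
      destruct i; lra. }
    apply (Rmult_le_compat_r h) in Hi; auto. unfold B. lra. }
  assert (Hlt : (norm3 (sub3 (G s) (G t)) < d)%R).
  { eapply Rle_lt_trans; [apply Hlip|]. assert (X : (h < d / B)%R) by lra.
    apply (Rmult_lt_compat_l B) in X; auto. replace (B * (d / B))%R with d in X by (field; lra). auto. }
  specialize (H (G s) Hlt).
  replace (f (G s) - f (G t) - (l cx * m cx + l cy1 * m cy1 + l cy2 * m cy2) * RtoC (s - t))
    with ((f (G s) - f (G t) - dot l (sub3 (G s) (G t)))
      + (l cx * (co (G s) cx - co (G t) cx - m cx * RtoC (s - t))
       + l cy1 * (co (G s) cy1 - co (G t) cy1 - m cy1 * RtoC (s - t))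
       + l cy2 * (co (G s) cy2 - co (G t) cy2 - m cy2 * RtoC (s - t))))
    by (unfold dot; simpl; ring).
  eapply Rle_trans; [apply Cmod_triangle|].
  eapply Rle_trans; [apply Rplus_le_compat_l, Cmod_triangle|].
  eapply Rle_trans; [apply Rplus_le_compat_l, Rplus_le_compat_r, Cmod_triangle|].
  rewrite !Cmod_mult.
  set (E := (e / (2 * A))%R) in *.
  assert (HE : (2 * A * E = e)%R) by (unfold E; field; lra).
  assert (T1 : (K * norm3 (sub3 (G s) (G t)) ^ 2 <= K * (B * h) ^ 2)%R).
  { apply Rmult_le_compat_l; auto. apply pow_incr. split; [apply norm3_nonneg | auto]. }
  assert (T2 : (K * (B * h) ^ 2 <= e / 2 * h)%R).
  { replace (K * (B * h) ^ 2)%R with (K * B ^ 2 * h * h)%R by ring. apply Rmult_le_compat_r; auto.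
    assert (X : (h < e / (2 * (K * B ^ 2 + 1)))%R) by lra.
    apply (Rmult_lt_compat_l (2 * (K * B ^ 2 + 1))) in X; [|lra].
    replace (2 * (K * B ^ 2 + 1) * (e / (2 * (K * B ^ 2 + 1))))%R with e in X by (field; lra). lra. }
  assert (X1 := Cmod_ge_0 (l cx)). assert (X2 := Cmod_ge_0 (l cy1)). assert (X3 := Cmod_ge_0 (l cy2)).
  apply (Rmult_le_compat_l _ _ _ X1) in R1. apply (Rmult_le_compat_l _ _ _ X2) in R2.
  apply (Rmult_le_compat_l _ _ _ X3) in R3.
  assert (HEh : (0 <= E * h)%R) by (apply Rmult_le_pos; lra).
  assert (Heh : (e * h = 2 * (A * (E * h)))%R) by (rewrite <- HE; ring).
  unfold A in Heh. lra.
Qed.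

Lemma cderiv_is_derive g t l : cderiv g t l ->
  is_derive (fun s => fst (g s)) t (fst l) /\ is_derive (fun s => snd (g s)) t (snd l).
Proof.
  intros H.
  split; apply is_derive_Reals; intros e He; destruct (H (e / 2)%R ltac:(lra)) as (d & Hd & B);
  exists (mkposreal d Hd); intros h Hh Hlt; simpl in Hlt;
  specialize (B (t + h)%R); replace (t + h - t)%R with h in B by ring; specialize (B Hlt);
  assert (Ph := Rabs_pos_lt h Hh); apply (Rmult_lt_reg_r (Rabs h)); auto; rewrite <- Rabs_mult.
  - replace (((fst (g (t + h)%R) - fst (g t)) / h - fst l) * h)%R
      with (fst (g (t + h)%R - g t - l * RtoC h)) by (simpl; field; auto).
    eapply Rle_lt_trans; [apply Re_le_Cmod|]. eapply Rle_lt_trans; [apply B|]. nra.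
  - replace (((snd (g (t + h)%R) - snd (g t)) / h - snd l) * h)%R
      with (snd (g (t + h)%R - g t - l * RtoC h)) by (simpl; field; auto).
    eapply Rle_lt_trans; [apply Im_le_Cmod|]. eapply Rle_lt_trans; [apply B|]. nra.
Qed.

Lemma is_derive_cderiv (a b : R -> R) t l m : is_derive a t l -> is_derive b t m ->
  cderiv (fun s => (a s, b s)) t (l, m).
Proof.
  intros Ha Hb e He. apply is_derive_Reals in Ha. apply is_derive_Reals in Hb.
  destruct (Ha (e / 2)%R ltac:(lra)) as [d1 B1], (Hb (e / 2)%R ltac:(lra)) as [d2 B2].
  exists (Rmin d1 d2). split; [apply Rmin_pos; apply cond_pos|]. intros s Hs.
  assert (G1 := Rmin_l d1 d2). assert (G2 := Rmin_r d1 d2).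
  destruct (Req_dec s t) as [->|Hne].
  { rewrite Rminus_diag, Rabs_R0, Rmult_0_r.
    match goal with |- (Cmod ?z <= _)%R => replace z with (RtoC 0) by ring end. rewrite Cmod_0. lra. }
  set (h := (s - t)%R) in *. assert (Hh : h <> 0%R) by (unfold h; lra).
  specialize (B1 h Hh ltac:(lra)). specialize (B2 h Hh ltac:(lra)).
  replace (t + h)%R with s in * by (unfold h; ring).
  assert (Ph := Rabs_pos_lt h Hh).
  eapply Rle_trans; [apply Cmod_le_Re_Im|].
  replace (fst ((a s, b s) - (a t, b t) - (l, m) * RtoC h))
    with (((a s - a t) / h - l) * h)%R by (simpl; field; auto).
  replace (snd ((a s, b s) - (a t, b t) - (l, m) * RtoC h))
    with (((b s - b t) / h - m) * h)%R by (simpl; field; auto).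
  rewrite !Rabs_mult. nra.
Qed.

Lemma cderiv_ext g g' t l : (forall s, g s = g' s) -> cderiv g t l -> cderiv g' t l.
Proof. intros E H e He. destruct (H e He) as (d & Hd & B). exists d. split; auto. intros. rewrite <- !E. auto. Qed.

Lemma cderiv_ext_loc g g' t l d : (0 < d)%R -> (forall s, (Rabs (s - t) < d)%R -> g s = g' s) ->
  cderiv g t l -> cderiv g' t l.
Proof.
  intros Hd E H e He. destruct (H e He) as (d' & Hd' & B). exists (Rmin d d').
  split; [apply Rmin_pos; auto|]. intros s Hs.
  assert (G1 := Rmin_l d d'). assert (G2 := Rmin_r d d').
  rewrite <- (E s), <- (E t) by (try lra; rewrite Rminus_diag, Rabs_R0; lra). apply B. lra.
Qed.

Lemma cderiv_unique g t l l' : cderiv g t l -> cderiv g t l' -> l = l'.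
Proof.
  intros H H'. apply cderiv_is_derive in H. apply cderiv_is_derive in H'.
  destruct H as [H1 H2], H' as [H3 H4].
  apply injective_projections.
  - rewrite <- (is_derive_unique _ _ _ H1). apply is_derive_unique. auto.
  - rewrite <- (is_derive_unique _ _ _ H2). apply is_derive_unique. auto.
Qed.

(** At the left end only some derivative is asked for, which gives continuity there: trajectories
    are controlled at nonnegative times, so the equation cannot be read off on both sides of the
    initial time. *)
Lemma cderiv_zero_const g a b : (a <= b)%R ->
  (forall t, (a < t <= b)%R -> cderiv g t 0) -> (exists l, cderiv g a l) -> g b = g a.
Proof.
  intros Hab H [l Ha].
  assert (HC : forall t, (a <= t <= b)%R -> exists l, cderiv g t l).
  { intros t Ht. destruct (Req_dec t a) as [->|]; [eauto|]. exists 0. apply H. lra. }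
  apply injective_projections.
  - destruct (MVT_gen (fun s => fst (g s)) a b (fun _ => 0%R)) as (c & _ & E).
    + rewrite Rmin_left, Rmax_right by auto. intros x Hx.
      apply (cderiv_is_derive g x 0). apply H. lra.
    + rewrite Rmin_left, Rmax_right by auto. intros x Hx. destruct (HC x Hx) as [m Hm].
      apply continuity_pt_filterlim, (@ex_derive_continuous R_AbsRing R_NormedModule).
      exists (fst m). apply (cderiv_is_derive g x m Hm).
    + lra.
  - destruct (MVT_gen (fun s => snd (g s)) a b (fun _ => 0%R)) as (c & _ & E).
    + rewrite Rmin_left, Rmax_right by auto. intros x Hx.
      apply (cderiv_is_derive g x 0). apply H. lra.
    + rewrite Rmin_left, Rmax_right by auto. intros x Hx. destruct (HC x Hx) as [m Hm].
      apply continuity_pt_filterlim, (@ex_derive_continuous R_AbsRing R_NormedModule).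
      exists (snd m). apply (cderiv_is_derive g x m Hm).
    + lra.
Qed.

(** * Identity theorem along segments *)

Definition move (p : C3) (w : R) (v : C3) : C3 :=
  (co p cx + RtoC w * co v cx, co p cy1 + RtoC w * co v cy1, co p cy2 + RtoC w * co v cy2).

Definition scal3 (w : R) (v : C3) : C3 :=
  (RtoC w * co v cx, RtoC w * co v cy1, RtoC w * co v cy2).

Lemma sub3_move p w w' v : sub3 (move p w v) (move p w' v) = scal3 (w - w') v.
Proof. unfold sub3, move, scal3. simpl. rewrite RtoC_minus. f_equal; [f_equal|]; ring. Qed.

Lemma norm3_scal3 w v : norm3 (scal3 w v) = (Rabs w * norm3 v)%R.
Proof.
  assert (E : forall i, Cmod (co (scal3 w v) i) = (Rabs w * Cmod (co v i))%R).
  { intros i. rewrite <- Cmod_R, <- Cmod_mult. destruct i; reflexivity. }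
  unfold norm3. rewrite !E, !RmaxRmult by apply Rabs_pos. auto.
Qed.

Definition tail_from (n : nat) (a : fps) : fps := fun i j k =>
  if (n <=? i + j + k)%nat then a i j k else 0.

Definition homog (n : nat) (a : fps) : fps := fun i j k =>
  if (i + j + k =? n)%nat then a i j k else 0.

Lemma mono_scal3 w v a : mono (scal3 w v) a = RtoC w ^ deg a * mono v a.
Proof. destruct a as [[i j] k]. simpl. rewrite !Cpow_mult_l, !Cpow_add_r. ring. Qed.

(* A power series vanishing on one half of a real segment through the origin vanishes on it:
   the homogeneous parts are annihilated one degree at a time. *)
Lemma psum_half_segment a v M : summable_by (pterm a v) M ->
  (forall w, (-1 < w < 0)%R -> psum a (scal3 w v) = 0) ->
  forall w, (-1 < w < 1)%R -> psum a (scal3 w v) = 0.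
Proof.
  intros HM Hz.
  assert (Stail : forall n w, (Rabs w <= 1)%R -> summable_by (pterm (tail_from n a) (scal3 w v)) (Rabs w ^ n * M)).
  { intros n w Hw. apply summable_by_bound with (v := pterm a v); auto; [apply pow_le, Rabs_pos|].
    intros b. unfold pterm. rewrite mono_scal3, !Cmod_mult, Cmod_pow, Cmod_R.
    assert (P1 := Cmod_ge_0 (mono v b)).
    destruct b as [[i j] k]. unfold cf, tail_from. destruct (Nat.leb_spec n (i + j + k)) as [Hn|Hn].
    - assert (P2 := Cmod_ge_0 (a i j k)).
      assert (Hp : (Rabs w ^ deg (i, j, k) <= Rabs w ^ n)%R).
      { simpl deg. replace (i + j + k)%nat with (n + (i + j + k - n))%nat by lia. rewrite pow_add.
        rewrite <- (Rmult_1_r (Rabs w ^ n)) at 2. apply Rmult_le_compat_l; [apply pow_le, Rabs_pos|].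
        rewrite <- (pow1 (i + j + k - n)). apply pow_incr. split; [apply Rabs_pos | auto]. }
      replace (Cmod (a i j k) * (Rabs w ^ deg (i, j, k) * Cmod (mono v (i, j, k))))%R
        with (Rabs w ^ deg (i, j, k) * (Cmod (a i j k) * Cmod (mono v (i, j, k))))%R by ring.
      apply Rmult_le_compat_r; auto. apply Rmult_le_pos; auto.
    - rewrite Cmod_0, Rmult_0_l. apply Rmult_le_pos; [apply pow_le, Rabs_pos|].
      apply Rmult_le_pos; auto. apply Cmod_ge_0. }
  assert (Shom : forall n, summable_by (pterm (homog n a) v) M).
  { intros n. apply summable_by_le with (v := pterm a v); auto. intros [[i j] k].
    unfold pterm, cf, homog. rewrite !Cmod_mult. apply Rmult_le_compat_r; [apply Cmod_ge_0|].
    destruct (_ =? _)%nat; [lra|]. rewrite Cmod_0. apply Cmod_ge_0. }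
  assert (Ehom : forall n w b, pterm (homog n a) (scal3 w v) b = RtoC w ^ n * pterm (homog n a) v b).
  { intros n w b. unfold pterm. rewrite mono_scal3. destruct b as [[i j] k]. unfold cf, homog. simpl deg.
    destruct (Nat.eqb_spec (i + j + k) n) as [->|]; ring. }
  assert (Phom : forall n w, psum (homog n a) (scal3 w v) = RtoC w ^ n * psum (homog n a) v).
  { intros n w. rewrite !psum_total, (total_ext _ _ (Ehom n w)). apply (total_scal _ _ M). auto. }
  assert (Split : forall n w, (Rabs w <= 1)%R -> psum (tail_from n a) (scal3 w v)
     = RtoC w ^ n * psum (homog n a) v + psum (tail_from (S n) a) (scal3 w v)).
  { intros n w Hw. rewrite <- Phom.
    assert (Sh : summable_by (pterm (homog n a) (scal3 w v)) (Cmod (RtoC w ^ n) * M)).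
    { eapply summable_by_ext; [apply Ehom|]. apply summable_by_scal. auto. }
    rewrite <- (psum_fadd _ _ _ _ _ Sh (Stail (S n) w Hw)). apply psum_ext. intros i j k.
    unfold fadd, homog, tail_from.
    destruct (Nat.eqb_spec (i + j + k) n), (Nat.leb_spec n (i + j + k)), (Nat.leb_spec (S n) (i + j + k));
    try lia; ring. }
  assert (Btail : forall n w, (Rabs w <= 1)%R -> (Cmod (psum (tail_from n a) (scal3 w v)) <= Rabs w ^ n * M)%R).
  { intros n w Hw. rewrite psum_total. apply (summable_total _ _ (Stail n w Hw)). }
  assert (All : forall n w, (Rabs w <= 1)%R -> psum a (scal3 w v) = psum (tail_from n a) (scal3 w v)).
  { induction n as [|n IH]; intros w Hw.
    - apply psum_ext. intros i j k. reflexivity.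
    - rewrite (IH w Hw), (Split n w Hw).
      (* On the negative half, [h ^ n] times this value is, up to sign, a tail of size at most M
         h^(n+1); divide by [h ^ n] and let [h] tend to 0. *)
      assert (E : psum (homog n a) v = 0).
      { apply Cmod_eq_0, (Rle_small_zero _ M 1); [apply Cmod_ge_0 | lra|].
        intros h Hh. assert (Hw' : (Rabs (- h) = h)%R) by (rewrite Rabs_Ropp, Rabs_pos_eq; lra).
        assert (Q := Split n (- h)%R ltac:(lra)). rewrite <- (IH (- h)%R), Hz in Q by lra.
        assert (B := Btail (S n) (- h)%R ltac:(lra)). rewrite Hw' in B.
        apply (f_equal (fun z => Cmod (z - psum (tail_from (S n) a) (scal3 (- h) v)))) in Q.
        match type of Q with _ = Cmod ?z => replace z with (RtoC (- h) ^ n * psum (homog n a) v) in Q by ring end.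
        match type of Q with Cmod ?z = _ => replace z with (- psum (tail_from (S n) a) (scal3 (- h) v)) in Q by ring end.
        rewrite Cmod_opp, Cmod_mult, Cmod_pow, Cmod_R, Hw' in Q. rewrite Q in B.
        assert (Hp : (0 < h ^ n)%R) by (apply pow_lt; lra).
        apply (Rmult_le_reg_l (h ^ n)); auto. simpl in B. lra. }
      rewrite E. ring. }
  intros w Hw. apply Cmod_eq_0. apply Rle_antisym; [|apply Cmod_ge_0].
  assert (HM0 := summable_by_nonneg _ _ HM).
  assert (Hw1 : (Rabs w < 1)%R) by (apply Rabs_def1; lra).
  apply le_epsilon. intros e He.
  destruct (pow_lt_1_zero w Hw1 (e / (M + 1))%R) as [N HN]; [apply Rdiv_lt_0_compat; lra|].
  specialize (HN N (le_n N)). rewrite (All N w) by lra.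
  eapply Rle_trans; [apply Btail; lra|]. rewrite RPow_abs.
  apply Rlt_le in HN. apply (Rmult_le_compat_r (M + 1)) in HN; [|lra].
  replace (e / (M + 1) * (M + 1))%R with e in HN by (field; lra).
  assert (0 <= Rabs (w ^ N))%R by apply Rabs_pos. lra.
Qed.

(** At the supremum of the times up to which [f] vanishes, the local expansion vanishes on the half
    segment behind, hence also on the one ahead; this contradicts maximality unless the end is
    reached. *)
Lemma identity_on_segment f p v eta : (0 < eta)%R ->
  (forall t, (0 <= t <= 1)%R -> analytic_at f (move p t v)) ->
  (forall t, (0 <= t < eta)%R -> (t <= 1)%R -> f (move p t v) = 0) ->
  f (move p 1 v) = 0.
Proof.
  intros Heta Han Hz.
  set (S := fun t => (0 <= t <= 1)%R /\ forall s, (0 <= s <= t)%R -> f (move p s v) = 0).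
  assert (S0 : S 0%R) by (split; [lra|]; intros s Hs; apply Hz; lra).
  destruct (completeness S) as [T [HT1 HT2]].
  { exists 1%R. intros t [Ht _]. lra. }
  { exists 0%R. auto. }
  assert (Tlow : (Rmin (eta / 2) 1 <= T)%R).
  { apply HT1. assert (G1 := Rmin_l (eta / 2) 1). assert (G2 := Rmin_r (eta / 2) 1).
    assert (0 < Rmin (eta / 2) 1)%R by (apply Rmin_pos; lra).
    split; [lra|]. intros s Hs. apply Hz; lra. }
  assert (T0 : (0 < T)%R) by (assert (0 < Rmin (eta / 2) 1)%R by (apply Rmin_pos; lra); lra).
  assert (T1 : (T <= 1)%R) by (apply HT2; intros t [Ht _]; lra).
  assert (Below : forall s, (0 <= s < T)%R -> f (move p s v) = 0).
  { intros s Hs. apply NNPP. intros Hne. assert (T <= s)%R; [|lra].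
    apply HT2. intros t [Ht Hft]. apply Rnot_lt_le. intros Hlt. apply Hne, Hft. lra. }
  destruct (Han T ltac:(lra)) as (a & r & Hr & Ha & Hf).
  assert (Nv := norm3_nonneg v).
  (* This scale keeps [T - d] nonnegative and puts both [T - d] and [T + d] inside the domain of the
     expansion. *)
  set (d := Rmin T (r / (2 * (norm3 v + 1)))%R).
  assert (Hd : (0 < d)%R) by (apply Rmin_pos; auto; apply Rdiv_lt_0_compat; lra).
  assert (dT : (d <= T)%R) by apply Rmin_l.
  assert (dr : (d * norm3 v < r)%R).
  { assert (X : (d <= r / (2 * (norm3 v + 1)))%R) by apply Rmin_r.
    apply (Rmult_le_compat_r (2 * (norm3 v + 1))) in X; [|lra].
    replace (r / (2 * (norm3 v + 1)) * (2 * (norm3 v + 1)))%R with r in X by (field; lra). nra. }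
  assert (Nd : (norm3 (scal3 d v) < r)%R) by (rewrite norm3_scal3, Rabs_pos_eq; lra).
  destruct (abs_summable_at a r (scal3 d v) Ha) as [M HM]; [lra|].
  assert (Ef : forall w, (-1 <= w <= 1)%R -> f (move p (T + w * d) v) = psum a (scal3 w (scal3 d v))).
  { intros w Hw. rewrite Hf.
    - f_equal. rewrite sub3_move. replace (T + w * d - T)%R with (w * d)%R by ring.
      unfold scal3. simpl. rewrite !RtoC_mult. f_equal; [f_equal|]; ring.
    - rewrite sub3_move, norm3_scal3. replace (T + w * d - T)%R with (w * d)%R by ring.
      rewrite Rabs_mult, (Rabs_pos_eq d) by lra.
      assert (Rabs w <= 1)%R by (apply Rabs_le; lra). assert (0 <= Rabs w)%R by apply Rabs_pos.
      assert (0 <= d * norm3 v)%R by (apply Rmult_le_pos; lra). nra. }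
  assert (Z := psum_half_segment a (scal3 d v) M HM).
  assert (Z' : forall w, (-1 < w < 1)%R -> f (move p (T + w * d) v) = 0).
  { intros w Hw. rewrite Ef by lra. apply Z; auto. intros u Hu. rewrite <- Ef by lra.
    apply Below. split; nra. }
  destruct (Req_dec T 1) as [E|Hne].
  { rewrite <- E. replace T with (T + 0 * d)%R at 1 by ring. apply Z'. lra. }
  exfalso. set (t := Rmin 1 (T + d / 2)%R).
  assert (t1 : (t <= 1)%R) by apply Rmin_l. assert (t2 : (t <= T + d / 2)%R) by apply Rmin_r.
  assert (tT : (T < t)%R) by (apply Rmin_glb_lt; lra).
  assert (S t); [|assert (t <= T)%R by (apply HT1; auto); lra].
  split; [lra|]. intros s Hs. destruct (Rlt_dec s T) as [?|?]; [apply Below; lra|].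
  replace s with (T + (s - T) / d * d)%R by (field; lra). apply Z'.
  assert (0 <= (s - T) / d)%R by (apply Rdiv_le_0_compat; lra).
  assert ((s - T) / d <= / 2)%R; [|lra].
  apply (Rmult_le_reg_r d); auto. replace ((s - T) / d * d)%R with (s - T)%R by (field; lra). lra.
Qed.

(** * The Jacobian determinant as a first integral *)

Definition divergence (Y : vfield) : fps := fadd (fD cy1 (Y cy1)) (fD cy2 (Y cy2)).

Definition jac (Phi : C3 -> C3) (v i : coord) : C3 -> C := partial v (fun q => co (Phi q) i).

Definition jac_det (Phi : C3 -> C3) (p : C3) : C :=
  jac Phi cy1 cy1 p * jac Phi cy2 cy2 p - jac Phi cy1 cy2 p * jac Phi cy2 cy1 p.

(** Openness in the two directions in which the conjugacy equation is differentiated. *)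
Definition open_in_y (U : C3 -> Prop) : Prop := forall p, U p -> exists d : R, (0 < d)%R /\
  forall v t, v <> cx -> (Cmod (t - co p v) < d)%R -> U (upd p v t).

Lemma fmul_fvar_r A v a :
  cf (fmul A (fvar v)) a =
  let '(i, j, k) := a in
  match v with
  | cx => if (1 <=? i)%nat then A (i - 1)%nat j k else 0
  | cy1 => if (1 <=? j)%nat then A i (j - 1)%nat k else 0
  | cy2 => if (1 <=? k)%nat then A i j (k - 1)%nat else 0
  end.
Proof.
  rewrite fmul_conv, conv_comm. destruct a as [[i j] k].
  destruct v;
  [rewrite (conv_supported _ _ _ _ _ (fvar_support cx)) |
   rewrite (conv_supported _ _ _ _ _ (fvar_support cy1)) |
   rewrite (conv_supported _ _ _ _ _ (fvar_support cy2))];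
  unfold cf; cbn [Nat.leb andb fvar]; rewrite ?Nat.sub_0_r, ?andb_true_r.
  - destruct i; [reflexivity | ring].
  - destruct j; [reflexivity | ring].
  - destruct k; [reflexivity | ring].
Qed.

Lemma fvar_sq_coef i j k : fmul (fvar cx) (fvar cx) i j k =
  if ((i =? 2) && (j =? 0) && (k =? 0))%nat then 1 else 0.
Proof.
  change (fmul (fvar cx) (fvar cx) i j k) with (cf (fmul (fvar cx) (fvar cx)) (i, j, k)).
  rewrite fmul_fvar_r. destruct i as [|[|[|i]]], j as [|j], k as [|k]; reflexivity.
Qed.

Lemma psum_zero p : psum (fcst 0) p = 0.
Proof. apply psum_fcst. Qed.

Lemma fD_sq Yx v : v <> cx -> feq Yx (fmul (fvar cx) (fvar cx)) -> feq (fD v Yx) (fcst 0).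
Proof.
  intros Hv H i j k. unfold fcst, fD.
  destruct v; [congruence| |]; rewrite H, fvar_sq_coef; destruct i as [|[|[|i]]], j as [|j], k as [|k];
  cbn; try ring.
Qed.

Lemma psum_divergence Y p r :
  (forall i, abs_summable (Y i) r) -> (norm3 p < r)%R -> feq (divergence Y) (fvar cx) ->
  psum (fD cy1 (Y cy1)) p + psum (fD cy2 (Y cy2)) p = co p cx.
Proof.
  intros HY Hp Hdiv. assert (Hp0 := norm3_nonneg p).
  assert (HS : forall v, exists M, summable_by (pterm (fD v (Y v)) p) M).
  { intros v. apply (abs_summable_at _ ((norm3 p + r) / 2)); [apply (abs_summable_fD _ _ r); auto; lra | lra]. }
  destruct (HS cy1) as [M1 H1], (HS cy2) as [M2 H2].
  rewrite <- (psum_fadd _ _ _ _ _ H1 H2). rewrite (psum_ext _ _ _ Hdiv). apply psum_fvar.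
Qed.

Lemma analytic_jac_det (Phi : C3 -> C3) p : (forall i, analytic_at (fun q => co (Phi q) i) p) ->
  analytic_at (jac_det Phi) p.
Proof.
  intros H. unfold jac_det, jac. apply analytic_minus; apply analytic_mult; apply analytic_partial; auto.
Qed.

(* Differentiating [DPhi Y = Z o Phi] in [y] gives [Y A = (D_y Z o Phi) A - A D_y Y] for the
   [y]-Jacobian [A], so that [det A] varies along [Y] with the difference of the traces. *)
Lemma jac_det_first_integral (U : C3 -> Prop) (Phi : C3 -> C3) (Y Z : vfield) :
  open_in_y U -> fibered_on U Phi -> (forall i, analytic_on U (fun p => co (Phi p) i)) ->
  conj_on U Phi Y Z ->
  feq (Y cx) (fmul (fvar cx) (fvar cx)) ->
  feq (divergence Y) (fvar cx) -> feq (divergence Z) (fvar cx) ->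
  forall p, U p ->
    psum (Y cx) p * partial cx (jac_det Phi) p + psum (Y cy1) p * partial cy1 (jac_det Phi) p
    + psum (Y cy2) p * partial cy2 (jac_det Phi) p = 0.
Proof.
  intros Hopen Hfib Han ((rY & HY & HrY) & (rZ & HZ & HrZ) & Hconj) HYx HYd HZd p Hp.
  assert (An : forall i, analytic_at (fun q => co (Phi q) i) p) by (intros; apply (Han i p Hp)).
  assert (F : forall i, frechet (fun q => co (Phi q) i) p (fun v => jac Phi v i p)).
  { intros i. apply (analytic_frechet _ _ (An i)). }
  assert (F2 : forall v i, frechet (jac Phi v i) p (fun w => partial w (jac Phi v i) p)).
  { intros v i. apply analytic_frechet, analytic_partial. auto. }
  destruct (Hopen p Hp) as (d & Hd & HU).
  (* The map is fibered, so its first component is constant in [y]. *)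
  assert (Jx : forall v, v <> cx -> jac Phi v cx p = 0).
  { intros v Hv. assert (G := frechet_minus _ _ _ _ _ (F cx) (frechet_const (co p cx) p)).
    assert (E := frechet_direction _ _ _ v d G Hd). cbv beta in E.
    rewrite <- E; [ring|]. intros t Ht. rewrite Hfib by (apply HU; auto).
    destruct v; [congruence| |]; simpl; ring. }
  assert (FY : forall i, frechet (psum (Y i)) p (fun v => psum (fD v (Y i)) p)).
  { intros i. apply (frechet_psum _ rY); auto. }
  assert (HZp : (norm3 (Phi p) < rZ)%R) by (apply HrZ; exists p; auto).
  assert (FZ : forall i, frechet (psum (Z i)) (Phi p) (fun v => psum (fD v (Z i)) (Phi p))).
  { intros i. apply (frechet_psum _ rZ); auto. }
  assert (Eq : forall i v, v <> cx ->
    partial cx (jac Phi v i) p * psum (Y cx) p + partial cy1 (jac Phi v i) p * psum (Y cy1) p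
    + partial cy2 (jac Phi v i) p * psum (Y cy2) p
    = psum (fD cy1 (Z i)) (Phi p) * jac Phi v cy1 p + psum (fD cy2 (Z i)) (Phi p) * jac Phi v cy2 p
      - (jac Phi cy1 i p * psum (fD v (Y cy1)) p + jac Phi cy2 i p * psum (fD v (Y cy2)) p)).
  { intros i v Hv.
    assert (G := frechet_minus _ _ _ _ _
      (frechet_plus _ _ _ _ _ (frechet_plus _ _ _ _ _
        (frechet_mult _ _ _ _ _ (F2 cx i) (FY cx)) (frechet_mult _ _ _ _ _ (F2 cy1 i) (FY cy1)))
        (frechet_mult _ _ _ _ _ (F2 cy2 i) (FY cy2)))
      (frechet_comp _ Phi p _ (fun i v => jac Phi v i p) (FZ i) F)).
    assert (E := frechet_direction _ _ _ v d G Hd). cbv beta in E.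
    assert (E0 : psum (fD v (Y cx)) p = 0).
    { rewrite (psum_ext _ _ _ (fD_sq _ v Hv HYx)). apply psum_zero. }
    rewrite E0, (Jx v Hv) in E.
    assert (C : forall w, partial v (jac Phi w i) p = partial w (jac Phi v i) p).
    { intros w. apply partial_comm. auto. }
    rewrite !C in E.
    match type of E with ?A -> ?B = _ => assert (E1 : B = 0) end.
    { apply E. intros t Ht. assert (Q := Hconj (upd p v t) (HU v t Hv Ht) i). cbv zeta in Q.
      unfold jac. rewrite <- Q. ring. }
    match goal with |- ?L = ?R => replace L with (R + (L - R)) by ring; replace (L - R) with (RtoC 0) end; [ring|].
    rewrite <- E1. ring. }
  assert (Dp : forall w, partial w (jac_det Phi) p =
    (partial w (jac Phi cy1 cy1) p * jac Phi cy2 cy2 p + jac Phi cy1 cy1 p * partial w (jac Phi cy2 cy2) p)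
    - (partial w (jac Phi cy1 cy2) p * jac Phi cy2 cy1 p + jac Phi cy1 cy2 p * partial w (jac Phi cy2 cy1) p)).
  { intros w. assert (G := frechet_minus _ _ _ _ _
      (frechet_mult _ _ _ _ _ (F2 cy1 cy1) (F2 cy2 cy2)) (frechet_mult _ _ _ _ _ (F2 cy1 cy2) (F2 cy2 cy1))).
    apply (frechet_partial _ _ _ w G). }
  rewrite !Dp.
  assert (N1 : cy1 <> cx) by discriminate. assert (N2 : cy2 <> cx) by discriminate.
  assert (E11 := Eq cy1 cy1 N1). assert (E12 := Eq cy1 cy2 N2).
  assert (E21 := Eq cy2 cy1 N1). assert (E22 := Eq cy2 cy2 N2).
  assert (TY := psum_divergence Y p rY HY (HrY p Hp) HYd).
  assert (TZ := psum_divergence Z (Phi p) rZ HZ HZp HZd).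
  rewrite (Hfib p Hp) in TZ.
  set (y0 := psum (Y cx) p) in *. set (y1 := psum (Y cy1) p) in *. set (y2 := psum (Y cy2) p) in *.
  set (A11 := jac Phi cy1 cy1 p) in *. set (A12 := jac Phi cy2 cy1 p) in *.
  set (A21 := jac Phi cy1 cy2 p) in *. set (A22 := jac Phi cy2 cy2 p) in *.
  match type of E11 with ?l = _ => set (G11 := l) in * end.
  match type of E12 with ?l = _ => set (G12 := l) in * end.
  match type of E21 with ?l = _ => set (G21 := l) in * end.
  match type of E22 with ?l = _ => set (G22 := l) in * end.
  (* The [G]s are the derivatives along [Y] of the entries [A11], [A12], [A21], [A22]; the
     determinant is differentiated as a bilinear expression in them. *)
  transitivity (G11 * A22 + A11 * G22 - (G21 * A12 + A21 * G12)).
  { unfold G11, G12, G21, G22. ring. }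
  rewrite E11, E12, E21, E22.
  (* Both traces equal the same [x], because the map preserves [x]; this is where they cancel. *)
  replace (psum (fD cy2 (Y cy2)) p) with (co p cx - psum (fD cy1 (Y cy1)) p) by (rewrite <- TY; ring).
  replace (psum (fD cy2 (Z cy2)) (Phi p)) with (co p cx - psum (fD cy1 (Z cy1)) (Phi p)) by (rewrite <- TZ; ring).
  ring.
Qed.

(** * Coefficients of Laurent series in x *)

Lemma fpow_x_coef n i j k : fpow (fvar cx) n i j k =
  if ((i =? n) && (j =? 0) && (k =? 0))%nat then 1 else 0.
Proof.
  revert i j k. induction n as [|n IH]; intros i j k.
  - simpl. unfold fcst. destruct i, j, k; reflexivity.
  - change (fpow (fvar cx) (S n) i j k) with (cf (fmul (fvar cx) (fpow (fvar cx) n)) (i, j, k)).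
    rewrite fmul_conv, (conv_supported _ _ _ _ _ (fvar_support cx)).
    unfold cf. cbn [Nat.leb andb fvar]. rewrite !Nat.sub_0_r, !andb_true_r.
    destruct i as [|i]; [reflexivity|]. cbn [Nat.leb]. rewrite IH.
    replace (S i - 1)%nat with i by lia. cbn [Nat.eqb].
    destruct ((i =? n) && (j =? 0) && (k =? 0))%nat; ring.
Qed.

Lemma xmul_coef n f i j k : xmul n f i j k = if (n <=? i)%nat then f (i - n)%nat j k else 0.
Proof.
  unfold xmul. change (fmul (fpow (fvar cx) n) f i j k) with (cf (fmul (fpow (fvar cx) n) f) (i, j, k)).
  rewrite fmul_conv, (conv_supported _ _ n 0 0).
  - unfold cf. cbn [Nat.leb]. rewrite !Nat.sub_0_r, !andb_true_r, fpow_x_coef, Nat.eqb_refl. cbn [andb Nat.eqb].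
    destruct (n <=? i)%nat; [ring | reflexivity].
  - intros [[a b] c] Hne. unfold cf. rewrite fpow_x_coef.
    destruct (Nat.eqb_spec a n), (Nat.eqb_spec b 0), (Nat.eqb_spec c 0); cbn [andb]; subst; congruence.
Qed.

(* The coefficient of [x^z y1^j y2^k], with [z] possibly negative. *)
Definition lval (a : laurent) (z : Z) (j k : nat) : C :=
  if (z + Z.of_nat (pole a) <? 0)%Z then 0 else numer a (Z.to_nat (z + Z.of_nat (pole a))) j k.

Lemma xmul_lval n a i j k :
  xmul n (numer a) i j k = lval a (Z.of_nat i - Z.of_nat n - Z.of_nat (pole a)) j k.
Proof.
  rewrite xmul_coef. unfold lval.
  destruct (Nat.leb_spec n i), (Z.ltb_spec (Z.of_nat i - Z.of_nat n - Z.of_nat (pole a) + Z.of_nat (pole a)) 0);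
  try lia; auto. f_equal. lia.
Qed.

(** [leq] compares numerators after multiplication by powers of x; reading coefficients at signed
    exponents removes the choice of the representative. *)
Lemma lval_leq a b z j k : leq a b -> lval a z j k = lval b z j k.
Proof.
  intros H. destruct (Z.ltb_spec (z + Z.of_nat (pole a) + Z.of_nat (pole b)) 0).
  - unfold lval. destruct (Z.ltb_spec (z + Z.of_nat (pole a)) 0), (Z.ltb_spec (z + Z.of_nat (pole b)) 0);
    try lia; auto.
  - assert (E := H (Z.to_nat (z + Z.of_nat (pole a) + Z.of_nat (pole b))) j k).
    rewrite !xmul_lval in E by auto.
    replace (Z.of_nat (Z.to_nat (z + Z.of_nat (pole a) + Z.of_nat (pole b))) - Z.of_nat (pole b) - Z.of_nat (pole a))%Z with z in E by lia.
    replace (Z.of_nat (Z.to_nat (z + Z.of_nat (pole a) + Z.of_nat (pole b))) - Z.of_nat (pole a) - Z.of_nat (pole b))%Z with z in E by lia.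
    auto.
Qed.

Lemma lval_ladd a b z j k : lval (ladd a b) z j k = lval a z j k + lval b z j k.
Proof.
  unfold lval at 1. cbn [ladd pole numer].
  destruct (Z.ltb_spec (z + Z.of_nat (pole a + pole b)) 0).
  - unfold lval. destruct (Z.ltb_spec (z + Z.of_nat (pole a)) 0), (Z.ltb_spec (z + Z.of_nat (pole b)) 0);
    try lia. ring.
  - unfold fadd. rewrite !xmul_lval by auto. f_equal; f_equal; lia.
Qed.

Lemma lval_lopp a z j k : lval (lopp a) z j k = - lval a z j k.
Proof. unfold lval. simpl. unfold fopp. destruct (_ <? 0)%Z; ring. Qed.

Lemma lval_lDy1 a z j k : lval (lD cy1 a) z j k = RtoC (INR (S j)) * lval a z (S j) k.
Proof. unfold lval. cbn [lD pole numer]. destruct (_ <? 0)%Z; [ring | reflexivity]. Qed.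

Lemma lval_lDy2 a z j k : lval (lD cy2 a) z j k = RtoC (INR (S k)) * lval a z j (S k).
Proof. unfold lval. cbn [lD pole numer]. destruct (_ <? 0)%Z; [ring | reflexivity]. Qed.

Lemma fmul_fcst a f i j k : fmul (fcst a) f i j k = a * f i j k.
Proof.
  change (fmul (fcst a) f i j k) with (cf (fmul (fcst a) f) (i, j, k)).
  rewrite fmul_conv, (conv_supported _ _ _ _ _ (fcst_support a)).
  cbn [Nat.leb andb cf]. rewrite !Nat.sub_0_r. unfold fcst. simpl. auto.
Qed.

Lemma lval_lDx a z j k : lval (lD cx a) z j k = RtoC (IZR (z + 1)) * lval a (z + 1) j k.
Proof.
  unfold lval. cbn [lD pole numer].
  replace (z + Z.of_nat (S (pole a)))%Z with (z + 1 + Z.of_nat (pole a))%Z by lia.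
  destruct (Z.ltb_spec (z + 1 + Z.of_nat (pole a)) 0); [ring|].
  unfold fadd. rewrite xmul_coef, fmul_fcst. unfold fD.
  set (m := Z.to_nat (z + 1 + Z.of_nat (pole a))).
  assert (Em : (z + 1 = Z.of_nat m - Z.of_nat (pole a))%Z) by (unfold m; lia).
  rewrite Em, minus_IZR, <- !INR_IZR_INZ.
  destruct (Nat.leb_spec 1 m).
  - replace (S (m - 1)) with m by lia. rewrite RtoC_minus. ring.
  - replace m with 0%nat by lia. rewrite RtoC_minus. simpl. ring.
Qed.

(** [b] represents c x^s. The first clause lets c = 0 go with any exponent, so that a vanishing term
    can be added to a monomial of whatever exponent. *)
Definition is_monomial (b : laurent) (s : Z) (c : C) : Prop :=
  ((0 <= s + Z.of_nat (pole b))%Z \/ c = 0) /\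
  forall z j k, lval b z j k = if (z =? s)%Z && (j =? 0)%nat && (k =? 0)%nat then c else 0.

Lemma lval_lmul_monomial a b s c z j k : is_monomial b s c ->
  lval (lmul a b) z j k = c * lval a (z - s) j k.
Proof.
  intros [Hs Hb].
  assert (Nb : forall m j k, numer b m j k = lval b (Z.of_nat m - Z.of_nat (pole b)) j k).
  { intros. unfold lval. replace (Z.of_nat m - Z.of_nat (pole b) + Z.of_nat (pole b))%Z with (Z.of_nat m) by lia.
    destruct (Z.ltb_spec (Z.of_nat m) 0); [lia|]. rewrite Nat2Z.id. auto. }
  set (m := Z.to_nat (s + Z.of_nat (pole b))).
  assert (Sup : forall x, x <> (m, 0, 0)%nat -> cf (numer b) x = 0).
  { intros [[x y] w] Hne. unfold cf. rewrite Nb, Hb.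
    destruct Hs as [Hs| ->]; [|destruct (_ && _); auto].
    destruct (Z.eqb_spec (Z.of_nat x - Z.of_nat (pole b)) s), (Nat.eqb_spec y 0), (Nat.eqb_spec w 0); cbn [andb]; auto.
    exfalso. apply Hne. unfold m. subst y w. f_equal. f_equal. lia. }
  unfold lval. cbn [lmul pole numer].
  destruct Hs as [Hs|Hc].
  - assert (Ec : numer b m 0%nat 0%nat = c).
    { rewrite Nb, Hb. unfold m. rewrite Z2Nat.id by lia.
      replace (s + Z.of_nat (pole b) - Z.of_nat (pole b))%Z with s by lia. rewrite Z.eqb_refl. auto. }
    destruct (Z.ltb_spec (z + Z.of_nat (pole a + pole b)) 0).
    + destruct (Z.ltb_spec (z - s + Z.of_nat (pole a)) 0); [ring | lia].
    + set (i := Z.to_nat (z + Z.of_nat (pole a + pole b))).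
      change (fmul (numer a) (numer b) i j k) with (cf (fmul (numer a) (numer b)) (i, j, k)).
      rewrite fmul_conv, conv_comm, (conv_supported _ _ _ _ _ Sup). cbn [cf]. cbn [Nat.leb].
      rewrite !andb_true_r, !Nat.sub_0_r, Ec.
      destruct (Nat.leb_spec m i), (Z.ltb_spec (z - s + Z.of_nat (pole a)) 0); unfold m, i in *; try lia; try ring.
      do 2 f_equal. lia.
  - assert (Z0 : forall i, fmul (numer a) (numer b) i j k = 0).
    { intros i. change (fmul (numer a) (numer b) i j k) with (cf (fmul (numer a) (numer b)) (i, j, k)).
      rewrite fmul_conv, conv_comm, (conv_supported _ _ _ _ _ Sup).
      destruct (_ && _); auto. unfold cf. rewrite Nb, Hb, Hc. destruct (_ && _); ring. }
    rewrite Z0, Hc. destruct (_ <? 0)%Z; ring.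
Qed.

Lemma is_monomial_cst c : is_monomial (of_fps (fcst c)) 0 c.
Proof.
  split; [left; simpl; lia|]. intros z j k. unfold lval, of_fps, fcst; cbn [pole numer].
  change (Z.of_nat 0) with 0%Z. rewrite !Z.add_0_r. destruct (Z.ltb_spec z 0), (Z.eqb_spec z 0); try lia; auto.
  - subst. destruct j, k; reflexivity.
  - replace (Z.to_nat z + j + k =? 0)%nat with false; auto. symmetry. apply Nat.eqb_neq. lia.
Qed.

Lemma is_monomial_zero b s s' : is_monomial b s 0 -> is_monomial b s' 0.
Proof.
  intros [_ H]. split; auto. intros z j k. rewrite H. repeat destruct (_ && _); auto.
Qed.

Lemma is_monomial_ladd a b s c d : is_monomial a s c -> is_monomial b s d ->
  is_monomial (ladd a b) s (c + d).
Proof.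
  intros [H1 H2] [H3 H4]. split.
  - simpl. destruct H1 as [?| ->], H3 as [?| ->]; try (left; lia). right. ring.
  - intros z j k. rewrite lval_ladd, H2, H4. destruct (_ && _); ring.
Qed.

Lemma is_monomial_lopp a s c : is_monomial a s c -> is_monomial (lopp a) s (- c).
Proof.
  intros [H1 H2]. split.
  - simpl. destruct H1 as [?| ->]; [left; auto | right; ring].
  - intros z j k. rewrite lval_lopp, H2. destruct (_ && _); ring.
Qed.

Lemma is_monomial_lmul a b s t c d : is_monomial a s c -> is_monomial b t d ->
  is_monomial (lmul a b) (s + t) (c * d).
Proof.
  intros [H1 H2] H. split.
  - destruct H as [H3 _]. simpl. destruct H1 as [?| ->], H3 as [?| ->]; try (right; ring). left; lia.
  - intros z j k. rewrite (lval_lmul_monomial _ _ _ _ _ _ _ H), H2.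
    replace (z - t =? s)%Z with (z =? s + t)%Z by (destruct (Z.eqb_spec z (s + t)), (Z.eqb_spec (z - t) s); auto; lia).
    destruct (_ && _); ring.
Qed.

Lemma is_monomial_lDy v a s c : v <> cx -> is_monomial a s c -> is_monomial (lD v a) s 0.
Proof.
  intros Hv [H1 H2]. split; auto. intros z j k.
  destruct v; [congruence| |]; rewrite ?lval_lDy1, ?lval_lDy2, H2; cbn [Nat.eqb];
  rewrite ?andb_false_r; cbn [andb]; destruct (_ && _); ring.
Qed.

Lemma is_monomial_lDx a s c : is_monomial a s c -> is_monomial (lD cx a) (s - 1) (RtoC (IZR s) * c).
Proof.
  intros [H1 H2]. split.
  - cbn [lD pole]. destruct H1 as [?| ->]; [left; lia | right; ring].
  - intros z j k. rewrite lval_lDx, H2.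
    destruct (Z.eqb_spec z (s - 1)), (Z.eqb_spec (z + 1) s); try lia; cbn [andb].
    + subst s. destruct (_ && _); ring.
    + ring.
Qed.

(** * Divergence of a transversally Hamiltonian field and of the normal form *)

Definition omega_coef (i j : coord) : C :=
  match i, j with cy1, cy2 => 1 | cy2, cy1 => - (1) | _, _ => 0 end.

Lemma is_monomial_omega i j : is_monomial (omega mero_alg i j) (-1) (omega_coef i j).
Proof.
  assert (Hx : is_monomial (Laurent 1 (fcst 1)) (-1) 1).
  { split; [left; simpl; lia|]. intros z a b. unfold lval, fcst. cbn [pole numer].
    destruct (Z.ltb_spec (z + Z.of_nat 1) 0), (Z.eqb_spec z (-1)); try lia; cbn [andb]; auto.
    - subst. destruct a, b; reflexivity.
    - replace (Z.to_nat (z + Z.of_nat 1) + a + b =? 0)%nat with false; auto. symmetry. apply Nat.eqb_neq. lia. }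
  set (dc := fun v i : coord => match v, i with cx, cx | cy1, cy1 | cy2, cy2 => RtoC 1 | _, _ => RtoC 0 end).
  assert (Hd : forall v i, is_monomial (@dcoord mero_alg v i) 0 (dc v i)).
  { intros v w. destruct v, w; apply is_monomial_cst. }
  assert (H := is_monomial_lmul _ _ _ _ _ _ Hx (is_monomial_ladd _ _ _ _ _
     (is_monomial_lmul _ _ _ _ _ _ (Hd cy1 i) (Hd cy2 j))
     (is_monomial_lopp _ _ _ (is_monomial_lmul _ _ _ _ _ _ (Hd cy1 j) (Hd cy2 i))))).
  replace (omega_coef i j) with (1 * (dc cy1 i * dc cy2 j + - (dc cy1 j * dc cy2 i))).
  - exact H.
  - destruct i, j; unfold dc, omega_coef; ring.
Qed.

Lemma lval_of_fps f i j k : lval (of_fps f) (Z.of_nat i) j k = f i j k.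
Proof.
  unfold lval. cbn [of_fps pole numer]. change (Z.of_nat 0) with 0%Z. rewrite !Z.add_0_r.
  destruct (Z.ltb_spec (Z.of_nat i) 0); [lia|]. rewrite Nat2Z.id. auto.
Qed.

(** The component of [L_Y omega] on (d/dy1, d/dy2) is (div_y Y - x) / x: the term -1 in it is Y(1/x)
    = -x^2/x^2. A multiple of dx has no such component. *)
Lemma hamiltonian_divergence Y :
  feq (Y cx) (fmul (fvar cx) (fvar cx)) -> transversally_hamiltonian Y ->
  feq (divergence Y) (fvar cx).
Proof.
  intros HYx [_ (th & _ & Hth)] i j k.
  (* The division by x shifts exponents: the coefficient of x^i in the divergence is read from that
     of x^(i-1) in the Lie derivative. *)
  assert (E := lval_leq _ _ (Z.of_nat i - 1) j k (Hth cy1 cy2)).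
  set (Y' := fun i0 : coord => of_fps (Y i0)) in *.
  set (om := omega mero_alg) in *.
  assert (Hom := is_monomial_omega). fold om in Hom.
  assert (R0 : lval (@wedge11 mero_alg (dcoord cx) th cy1 cy2) (Z.of_nat i - 1) j k = 0).
  { unfold wedge11, csub. simpl. rewrite lval_ladd, lval_lopp.
    assert (Z0 : forall a z, lval (lmul (of_fps (fcst 0)) a) z j k = 0).
    { intros a z. unfold lval. cbn [lmul of_fps pole numer]. rewrite fmul_fcst. destruct (_ <? 0)%Z; ring. }
    rewrite !Z0. ring. }
  rewrite R0 in E. clear R0 Hth th.
  assert (Eb : forall v z a b, lval (@iota2 mero_alg Y' om v) z a b =
    omega_coef cx v * lval (Y' cx) (z + 1) a b + omega_coef cy1 v * lval (Y' cy1) (z + 1) a b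
    + omega_coef cy2 v * lval (Y' cy2) (z + 1) a b).
  { intros v z a b. unfold iota2, csum. cbn [cadd cmul mero_alg laurent_alg]. rewrite !lval_ladd.
    rewrite !(lval_lmul_monomial _ _ _ _ _ _ _ (Hom _ v)).
    replace (z - -1)%Z with (z + 1)%Z by lia. auto. }
  (* [d omega = -x^(-2) dx /\ dy1 /\ dy2]; the vanishing terms are assigned the exponent -2 so that
     they can be added to it. *)
  assert (Hd : forall v, is_monomial (@Defs.d2 mero_alg om v cy1 cy2) (-2)
     (match v with cx => - (1) | _ => 0 end)).
  { intros v. unfold Defs.d2, csub. cbn [cadd copp cD mero_alg laurent_alg].
    assert (N1 : cy1 <> cx) by discriminate. assert (N2 : cy2 <> cx) by discriminate.
    assert (A1 := is_monomial_lopp _ _ _ (is_monomial_zero _ _ (-2) (is_monomial_lDy cy1 _ _ _ N1 (Hom v cy2)))).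
    assert (A2 := is_monomial_zero _ _ (-2) (is_monomial_lDy cy2 _ _ _ N2 (Hom v cy1))).
    destruct v.
    - assert (A3 := is_monomial_lDx _ _ _ (Hom cy1 cy2)).
      assert (A := is_monomial_ladd _ _ _ _ _ (is_monomial_ladd _ _ _ _ _ A3 A1) A2).
      replace (- (1)) with (RtoC (IZR (-1)) * omega_coef cy1 cy2 + - 0 + 0) by (simpl; unfold RtoC; apply injective_projections; simpl; ring).
      exact A.
    - assert (A3 := is_monomial_zero _ _ (-2) (is_monomial_lDy cy1 _ _ _ N1 (Hom cy1 cy2))).
      assert (A := is_monomial_ladd _ _ _ _ _ (is_monomial_ladd _ _ _ _ _ A3 A1) A2).
      replace (RtoC 0) with (RtoC 0 + - 0 + 0) by ring. exact A.
    - assert (A3 := is_monomial_zero _ _ (-2) (is_monomial_lDy cy2 _ _ _ N2 (Hom cy1 cy2))).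
      assert (A := is_monomial_ladd _ _ _ _ _ (is_monomial_ladd _ _ _ _ _ A3 A1) A2).
      replace (RtoC 0) with (RtoC 0 + - 0 + 0) by ring. exact A. }
  unfold lie2, iota3, Defs.d1, csub, csum in E. cbn [cadd copp cmul cD mero_alg laurent_alg] in E.
  rewrite !lval_ladd, lval_lopp, lval_lDy1, lval_lDy2, !Eb in E.
  rewrite !(lval_lmul_monomial _ _ _ _ _ _ _ (Hd _)) in E.
  unfold omega_coef in E.
  replace (Z.of_nat i - 1 - -2)%Z with (Z.of_nat (S i)) in E by lia.
  replace (Z.of_nat i - 1 + 1)%Z with (Z.of_nat i) in E by lia.
  unfold Y' in E. rewrite !lval_of_fps in E. rewrite (HYx (S i) j k), fvar_sq_coef in E.
  unfold divergence, fadd, fD.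
  assert (Ex : fvar cx i j k = if ((S i =? 2) && (j =? 0) && (k =? 0))%nat then 1 else 0)
    by (destruct i as [|[|i]], j, k; reflexivity).
  rewrite Ex. match goal with |- ?L = ?R => replace L with (R + (L - R)) by ring; replace (L - R) with (RtoC 0) end; [ring|].
  symmetry. etransitivity; [|exact E]. ring.
Qed.

Ltac generalize_INR :=
  repeat match goal with |- context [RtoC (INR ?n)] => generalize (RtoC (INR n)); intro end.

Lemma Ynorm_coef1 lam a1 a2 c i j k :
  Ynorm lam a1 a2 c cy1 i j k = if (1 <=? j)%nat then
    fadd (fadd (fcst (- lam)) (fmul (fcst a1) (fvar cx))) (fopp (fresonant c)) i (j - 1)%nat k else 0.
Proof. exact (fmul_fvar_r _ cy1 (i, j, k)). Qed.

Lemma Ynorm_coef2 lam a1 a2 c i j k :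
  Ynorm lam a1 a2 c cy2 i j k = if (1 <=? k)%nat then
    fadd (fadd (fcst lam) (fmul (fcst a2) (fvar cx))) (fresonant c) i j (k - 1)%nat else 0.
Proof. exact (fmul_fvar_r _ cy2 (i, j, k)). Qed.

(** The resonant terms cancel: with v = y1 y2, the terms -c y1 and c y2 contribute -(c + v c') and c
    + v c', which leaves (a1 + a2) x. *)
Lemma Ynorm_divergence lam a1 a2 c : a1 + a2 = 1 -> feq (divergence (Ynorm lam a1 a2 c)) (fvar cx).
Proof.
  intros Ha i j k. assert (Ea : a2 = 1 - a1) by (rewrite <- Ha; ring).
  unfold divergence, fadd at 1, fD. rewrite Ynorm_coef1, Ynorm_coef2.
  cbn [Nat.leb]. rewrite !Nat.sub_succ, !Nat.sub_0_r. unfold fadd, fopp. rewrite !fmul_fcst.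
  unfold fcst, fresonant.
  destruct i as [|[|i]]; cbn [Nat.eqb andb Nat.add].
  - destruct (Nat.eqb_spec j k) as [<-|Hne].
    + destruct j as [|j]; cbn [Nat.add Nat.eqb fvar]; generalize_INR; ring.
    + replace (j + k =? 0)%nat with false by (symmetry; apply Nat.eqb_neq; lia).
      destruct j, k; try lia; cbn [fvar]; generalize_INR; ring.
  - destruct j as [|j], k as [|k]; cbn [Nat.add Nat.eqb fvar];
      [change (INR 1) with 1%R; rewrite Ea; ring | | |]; generalize_INR; ring.
  - destruct j, k; cbn [Nat.add Nat.eqb fvar]; generalize_INR; ring.
Qed.

(** * Cauchy estimate *)

Lemma frechet_co v p : frechet (fun q => co q v) p
  (fun i => match v, i with cx, cx | cy1, cy1 | cy2, cy2 => 1 | _, _ => 0 end).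
Proof.
  exists 0%R, 1%R. split; [lra|]. split; [lra|]. intros q _.
  match goal with |- (Cmod ?z <= _)%R => replace z with (RtoC 0) by (unfold dot; destruct v; simpl; ring) end.
  rewrite Cmod_0. lra.
Qed.

Lemma cderiv_const c t : cderiv (fun _ => c) t 0.
Proof.
  intros e He. exists 1%R. split; [lra|]. intros s _.
  match goal with |- (Cmod ?z <= _)%R => replace z with (RtoC 0) by ring end.
  rewrite Cmod_0. apply Rmult_le_pos; [lra | apply Rabs_pos].
Qed.

(** The product rule for curves is the composition rule applied to the product of two coordinate
    functions. *)
Lemma cderiv_mult a b t l m : cderiv a t l -> cderiv b t m ->
  cderiv (fun s => a s * b s) t (l * b t + a t * m).
Proof.
  intros Ha Hb.
  assert (F := frechet_mult _ _ _ _ _ (frechet_co cx (a t, b t, RtoC 0)) (frechet_co cy1 (a t, b t, RtoC 0))).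
  assert (H := cderiv_comp _ (fun s => (a s, b s, RtoC 0)) t _
    (fun i => match i with cx => l | cy1 => m | cy2 => 0 end) F).
  cbv beta in H. simpl co in H. replace (l * b t + a t * m) with
    ((1 * b t + a t * 0) * l + (0 * b t + a t * 1) * m + (0 * b t + a t * 0) * 0) by ring.
  apply H. intros []; simpl; auto. apply cderiv_const.
Qed.

Lemma cderiv_plus a b t l m : cderiv a t l -> cderiv b t m -> cderiv (fun s => a s + b s) t (l + m).
Proof.
  intros Ha Hb.
  assert (F := frechet_plus _ _ _ _ _ (frechet_co cx (a t, b t, RtoC 0)) (frechet_co cy1 (a t, b t, RtoC 0))).
  assert (H := cderiv_comp _ (fun s => (a s, b s, RtoC 0)) t _
    (fun i => match i with cx => l | cy1 => m | cy2 => 0 end) F).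
  cbv beta in H. simpl co in H. replace (l + m) with
    ((1 + 0) * l + (0 + 1) * m + (0 + 0) * 0) by ring.
  apply H. intros []; simpl; auto. apply cderiv_const.
Qed.

Lemma cderiv_scal k b t m : cderiv b t m -> cderiv (fun s => k * b s) t (k * m).
Proof.
  intros H. replace (k * m) with (0 * b t + k * m) by ring. apply (cderiv_mult (fun _ => k)); auto.
  apply cderiv_const.
Qed.

Lemma cderiv_eq g t l l' : l = l' -> cderiv g t l -> cderiv g t l'.
Proof. intros ->. auto. Qed.

Lemma cderiv_RtoC t : cderiv RtoC t 1.
Proof. apply (is_derive_cderiv (fun s => s) (fun _ => 0%R) t 1 0); auto_derive; auto. Qed.

Definition cis (th : R) : C := (cos th, sin th).
Definition cis_bar (th : R) : C := (cos th, (- sin th)%R).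

Lemma cis_cis_bar th : cis th * cis_bar th = 1.
Proof.
  apply injective_projections; simpl; [|ring].
  assert (H := sin2_cos2 th). unfold Rsqr in H. lra.
Qed.

Lemma Cmod_cis_bar th : Cmod (cis_bar th) = 1%R.
Proof.
  unfold Cmod, cis_bar. simpl. transitivity (sqrt 1); [f_equal | apply sqrt_1].
  assert (H := sin2_cos2 th). unfold Rsqr in H. lra.
Qed.

Lemma Cmod_cis th : Cmod (cis th) = 1%R.
Proof.
  unfold Cmod, cis. simpl. transitivity (sqrt 1); [f_equal | apply sqrt_1].
  assert (H := sin2_cos2 th). unfold Rsqr in H. lra.
Qed.

Lemma cderiv_cis th : cderiv cis th (Ci * cis th).
Proof.
  apply (cderiv_eq _ _ ((- sin th)%R, cos th)).
  - apply injective_projections; simpl; ring.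
  - apply is_derive_cderiv; auto_derive; auto; ring.
Qed.

Lemma cderiv_cis_bar th : cderiv cis_bar th (- Ci * cis_bar th).
Proof.
  apply (cderiv_eq _ _ ((- sin th)%R, (- cos th)%R)).
  - apply injective_projections; simpl; ring.
  - apply is_derive_cderiv; auto_derive; auto; ring.
Qed.

Lemma cderiv_continuous_fst g t l : cderiv g t l -> continuous (fun s => fst (g s)) t.
Proof.
  intros H. apply (@ex_derive_continuous R_AbsRing R_NormedModule). exists (fst l).
  apply cderiv_is_derive. auto.
Qed.

Section CauchyEstimate.

Variables (f : C3 -> C) (p : C3) (v : coord) (rho M : R) (u : C).
Hypothesis Hrho : (0 < rho)%R.
Hypothesis Han : forall z : C, (Cmod z < rho)%R -> analytic_at f (upd p v (co p v + z)).
Hypothesis HM : forall z : C, (Cmod z < rho)%R -> (Cmod (f (upd p v (co p v + z))) <= M)%R.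

Let pt (t th : R) : C3 := upd p v (co p v + RtoC t * cis th).
(** Real part of the integrand in Cauchy's formula for the derivative on the circle of radius [t],
    up to the factor 1/t, rotated by [u]; [dk] is its derivative in [t]. *)
Let k (t th : R) : R := fst (u * cis_bar th * f (pt t th)).
Let dk (t th : R) : R := fst (u * partial v f (pt t th)).

Lemma cauchy_pt_norm t th : (Rabs t < rho)%R -> (Cmod (RtoC t * cis th) < rho)%R.
Proof. intros H. rewrite Cmod_mult, Cmod_cis, Cmod_R. lra. Qed.

Lemma cderiv_upd (a : R -> C) s l i : cderiv a s l ->
  cderiv (fun s => co (upd p v (a s)) i) s
    (match v, i with cx, cx | cy1, cy1 | cy2, cy2 => l | _, _ => 0 end).
Proof. intros H. destruct v, i; simpl; auto using cderiv_const. Qed.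

Lemma cderiv_along (g : C3 -> C) (a : R -> C) s l : analytic_at g (upd p v (a s)) -> cderiv a s l ->
  cderiv (fun s => g (upd p v (a s))) s (partial v g (upd p v (a s)) * l).
Proof.
  intros Hg Ha. assert (H := cderiv_comp g (fun s => upd p v (a s)) s _ _ (analytic_frechet _ _ Hg)
    (fun i => cderiv_upd a s l i Ha)).
  eapply cderiv_eq; [|exact H]. destruct v; ring.
Qed.

Lemma cderiv_pt_t (g : C3 -> C) t th : analytic_at g (pt t th) ->
  cderiv (fun t => g (pt t th)) t (partial v g (pt t th) * cis th).
Proof.
  intros Hg. apply (cderiv_along g (fun t => co p v + RtoC t * cis th)); auto.
  apply (cderiv_eq _ _ (0 + (1 * cis th + RtoC t * 0))); [ring|].
  apply cderiv_plus; [apply cderiv_const|]. apply (cderiv_mult RtoC (fun _ => cis th)); [apply cderiv_RtoC | apply cderiv_const].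
Qed.

Lemma cderiv_pt_th (g : C3 -> C) t th : analytic_at g (pt t th) ->
  cderiv (fun th => g (pt t th)) th (partial v g (pt t th) * (RtoC t * (Ci * cis th))).
Proof.
  intros Hg. apply (cderiv_along g (fun th => co p v + RtoC t * cis th)); auto.
  apply (cderiv_eq _ _ (0 + RtoC t * (Ci * cis th))); [ring|].
  apply cderiv_plus; [apply cderiv_const|]. apply (cderiv_scal (RtoC t) cis), cderiv_cis.
Qed.

Lemma is_derive_k t th : (Rabs t < rho)%R -> is_derive (fun t => k t th) t (dk t th).
Proof.
  intros Ht. assert (Hg := Han _ (cauchy_pt_norm t th Ht)).
  assert (H := cderiv_scal (u * cis_bar th) _ _ _ (cderiv_pt_t f t th Hg)).
  apply cderiv_is_derive in H. destruct H as [H _]. unfold k, dk.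
  replace (u * partial v f (pt t th)) with (u * cis_bar th * (partial v f (pt t th) * cis th)); auto.
  transitivity (u * partial v f (pt t th) * (cis th * cis_bar th)); [ring|]. rewrite cis_cis_bar. ring.
Qed.

Lemma continuous_k t th : (Rabs t < rho)%R -> continuous (k t) th.
Proof.
  intros Ht. assert (Hg := Han _ (cauchy_pt_norm t th Ht)).
  exact (cderiv_continuous_fst _ _ _ (cderiv_mult _ _ _ _ _ (cderiv_scal u _ _ _ (cderiv_cis_bar th))
    (cderiv_pt_th f t th Hg))).
Qed.

Lemma continuous_dk t th : (Rabs t < rho)%R -> continuous (dk t) th.
Proof.
  intros Ht. assert (Hg := Han _ (cauchy_pt_norm t th Ht)).
  exact (cderiv_continuous_fst _ _ _ (cderiv_scal u _ _ _
    (cderiv_pt_th _ t th (analytic_partial v _ _ Hg)))).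
Qed.

(** Differentiating in the angle produces a factor i, which exchanges real and imaginary parts. Over
    the closed circle the integral of this derivative is 0, and that is the relation
    [K t = t * L t]. *)
Lemma is_derive_conjugate t th : (Rabs t < rho)%R ->
  is_derive (fun th => snd (u * cis_bar th * f (pt t th))) th (t * dk t th - k t th)%R.
Proof.
  intros Ht. assert (Hg := Han _ (cauchy_pt_norm t th Ht)).
  assert (H := cderiv_mult _ _ _ _ _ (cderiv_scal u _ _ _ (cderiv_cis_bar th)) (cderiv_pt_th f t th Hg)).
  apply cderiv_is_derive in H. destruct H as [_ H].
  match type of H with is_derive _ _ (snd ?z) => assert (E : z = Ci * (RtoC t * (u * partial v f (pt t th)) - u * cis_bar th * f (pt t th))) end.
  { replace (u * partial v f (pt t th)) with (u * partial v f (pt t th) * (cis th * cis_bar th))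
      by (rewrite cis_cis_bar; ring). ring. }
  rewrite E in H. unfold dk, k.
  match goal with |- is_derive _ _ ?x => match type of H with is_derive _ _ ?y => replace x with y; [exact H|] end end.
  simpl. ring.
Qed.

Lemma continuity_2d_dk t th : (Rabs t < rho)%R -> continuity_2d_pt dk t th.
Proof.
  intros Ht eps. assert (Hg := Han _ (cauchy_pt_norm t th Ht)).
  destruct (frechet_lipschitz _ _ _ (analytic_frechet _ _ (analytic_partial v _ _ Hg))) as (L & d & HL & Hd & Lip).
  assert (Hu := Cmod_ge_0 u).
  set (D := Rmin (d / 2) (eps / (2 * (Cmod u * L + 1)))%R).
  assert (HuL : (0 <= Cmod u * L)%R) by (apply Rmult_le_pos; auto).
  assert (Heps := cond_pos eps).
  assert (HD : (0 < D)%R) by (apply Rmin_pos; [lra | apply Rdiv_lt_0_compat; lra]).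
  assert (C1 : continuity_2d_pt (fun a b => a * cos b)%R t th).
  { apply continuity_2d_pt_mult; [apply continuity_2d_pt_id1|].
    apply (continuity_1d_2d_pt_comp cos (fun _ b => b)); [apply continuity_cos | apply continuity_2d_pt_id2]. }
  assert (C2 : continuity_2d_pt (fun a b => a * sin b)%R t th).
  { apply continuity_2d_pt_mult; [apply continuity_2d_pt_id1|].
    apply (continuity_1d_2d_pt_comp sin (fun _ b => b)); [apply continuity_sin | apply continuity_2d_pt_id2]. }
  assert (HD2 : (0 < D / 2)%R) by lra.
  destruct (C1 (mkposreal _ HD2)) as [e1 B1], (C2 (mkposreal _ HD2)) as [e2 B2]. simpl in B1, B2.
  assert (He : (0 < Rmin e1 e2)%R) by (apply Rmin_pos; apply cond_pos).
  exists (mkposreal _ He). simpl. intros a b Ha Hb.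
  assert (G1 := Rmin_l e1 e2). assert (G2 := Rmin_r e1 e2).
  specialize (B1 a b ltac:(lra) ltac:(lra)). specialize (B2 a b ltac:(lra) ltac:(lra)).
  assert (Hn : (norm3 (sub3 (pt a b) (pt t th)) < D)%R).
  { replace (norm3 (sub3 (pt a b) (pt t th))) with (Cmod (RtoC a * cis b - RtoC t * cis th)).
    - eapply Rle_lt_trans; [apply Cmod_le_Re_Im|]. simpl.
      match goal with |- (Rabs ?x + Rabs ?y < _)%R =>
        replace x with (a * cos b - t * cos th)%R by ring; replace y with (a * sin b - t * sin th)%R by ring end.
      lra.
    - unfold pt.
      replace (upd p v (co p v + RtoC a * cis b)) with (upd (upd p v (co p v + RtoC t * cis th)) v (co p v + RtoC a * cis b))
        by (destruct v; reflexivity).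
      rewrite norm3_upd_sub.
      replace (co (upd p v (co p v + RtoC t * cis th)) v) with (co p v + RtoC t * cis th) by (destruct v; reflexivity).
      f_equal. ring. }
  assert (G3 : (D <= d / 2)%R) by apply Rmin_l. assert (G4 : (D <= eps / (2 * (Cmod u * L + 1)))%R) by apply Rmin_r.
  specialize (Lip (pt a b)). fold (pt t th) in Lip. specialize (Lip ltac:(lra)).
  unfold dk. replace (fst (u * partial v f (pt a b))%C - fst (u * partial v f (pt t th))%C)%R
    with (fst (u * (partial v f (pt a b) - partial v f (pt t th)))) by (simpl; ring).
  eapply Rle_lt_trans; [apply Re_le_Cmod|]. rewrite Cmod_mult.
  assert (X : (Cmod u * Cmod (partial v f (pt a b) - partial v f (pt t th)) <= Cmod u * (L * D))%R).
  { apply Rmult_le_compat_l; auto. eapply Rle_trans; [apply Lip|]. apply Rmult_le_compat_l; lra. }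
  assert (Y : ((Cmod u * L + 1) * (eps / (2 * (Cmod u * L + 1))) = eps / 2)%R) by (field; lra).
  apply (Rmult_le_compat_l (Cmod u * L + 1)) in G4; [|lra]. lra.
Qed.

Let K (t : R) : R := RInt (k t) 0 (2 * PI).
Let L (t : R) : R := RInt (dk t) 0 (2 * PI).

Lemma cauchy_interval_locally t : (Rabs t < rho)%R -> locally t (fun s => (Rabs s < rho)%R).
Proof.
  intros Ht. assert (H : (0 < rho - Rabs t)%R) by lra. exists (mkposreal _ H). intros s Hs.
  change (Rabs (s - t) < rho - Rabs t)%R in Hs.
  assert (X : forall a b : R, (Rabs a <= Rabs (a - b) + Rabs b)%R).
  { intros a b. replace a with (a - b + b)%R at 1 by ring. apply Rabs_triang. }
  specialize (X s t). lra.
Qed.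

Lemma is_derive_circle_mean t : (Rabs t < rho)%R -> is_derive K t (L t).
Proof.
  intros Ht.
  assert (E : RInt (fun th => Derive (fun s => k s th) t) 0 (2 * PI) = L t).
  { apply RInt_ext. intros th _. apply is_derive_unique, is_derive_k. auto. }
  rewrite <- E. apply is_derive_RInt_param.
  - apply (filter_imp (fun s => (Rabs s < rho)%R)); [|apply cauchy_interval_locally; auto].
    intros s Hs th _. eexists. apply is_derive_k. auto.
  - intros th _. apply (continuity_2d_pt_ext_loc dk); [|apply continuity_2d_dk; auto].
    destruct (cauchy_interval_locally t Ht) as [d Hd]. exists d. intros a b Ha _.
    symmetry. apply is_derive_unique, is_derive_k. apply Hd. auto.
  - apply (filter_imp (fun s => (Rabs s < rho)%R)); [|apply cauchy_interval_locally; auto].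
    intros s Hs. apply (@ex_RInt_continuous R_CompleteNormedModule). intros th _. apply continuous_k. auto.
Qed.

Lemma circle_mean_ode t : (Rabs t < rho)%R -> K t = (t * L t)%R.
Proof.
  intros Ht.
  assert (I : is_RInt (fun th => t * dk t th - k t th)%R 0 (2 * PI)
    (minus (snd (u * cis_bar (2 * PI) * f (pt t (2 * PI)))) (snd (u * cis_bar 0 * f (pt t 0))))).
  { apply (is_RInt_derive (fun th => snd (u * cis_bar th * f (pt t th)))).
    - intros th _. apply is_derive_conjugate. auto.
    - intros th _. apply (continuous_minus (fun th => t * dk t th)%R (k t)); [|apply continuous_k; auto].
      apply (continuous_scal_r t (dk t)). apply continuous_dk. auto. }
  assert (Ep : pt t (2 * PI) = pt t 0).
  { unfold pt, cis. rewrite cos_2PI, sin_2PI, cos_0, sin_0. auto. }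
  assert (Eb : cis_bar (2 * PI) = cis_bar 0).
  { unfold cis_bar. rewrite cos_2PI, sin_2PI, cos_0, sin_0. auto. }
  rewrite Ep, Eb in I. rewrite minus_eq_zero in I.
  assert (Xk : ex_RInt (k t) 0 (2 * PI)).
  { apply (@ex_RInt_continuous R_CompleteNormedModule). intros; apply continuous_k; auto. }
  assert (Xd : ex_RInt (dk t) 0 (2 * PI)).
  { apply (@ex_RInt_continuous R_CompleteNormedModule). intros; apply continuous_dk; auto. }
  assert (J : is_RInt (fun th => t * dk t th - k t th)%R 0 (2 * PI) (t * L t - K t)%R).
  { apply (is_RInt_minus (fun th => t * dk t th)%R (k t)).
    - apply (is_RInt_scal (dk t) 0 (2 * PI) t (L t)). exact (RInt_correct _ _ _ Xd).
    - exact (RInt_correct _ _ _ Xk). }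
  assert (E : (t * L t - K t)%R = 0%R)
    by exact (eq_trans (eq_sym (is_RInt_unique _ _ _ _ J)) (is_RInt_unique _ _ _ _ I)).
  lra.
Qed.

(** [K' = L] and [K t = t * L t] make [K t / t] constant on (0, rho); as [K 0 = 0], its limit at 0
    is the derivative [L 0]. *)
Lemma circle_mean_linear t : (0 < t < rho)%R -> K t = (t * L 0)%R.
Proof.
  intros Ht.
  assert (K0 : K 0 = 0%R) by (rewrite circle_mean_ode; [ring | rewrite Rabs_R0; auto]).
  assert (Cst : forall s, (0 < s < t)%R -> (K s / s = K t / t)%R).
  { intros s Hs.
    assert (Hder : forall x, (s <= x <= t)%R -> is_derive (fun x => K x / x)%R x 0%R).
    { intros x Hx. assert (Rabs x < rho)%R by (rewrite Rabs_pos_eq; lra).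
      replace 0%R with ((L x * x - K x * 1) / x ^ 2)%R.
      - apply (is_derive_div K (fun x => x) x (L x) 1%R); [apply is_derive_circle_mean; auto | exact (is_derive_id (K := R_AbsRing) x) | lra].
      - rewrite circle_mean_ode by auto. generalize (L x : R). intros y. change ((y * x - x * y * 1) / x ^ 2 = 0)%R. field. lra. }
    destruct (MVT_gen (fun x => K x / x)%R s t (fun _ => 0%R)) as (c & _ & E).
    - rewrite Rmin_left, Rmax_right by lra. intros x Hx. apply Hder. lra.
    - rewrite Rmin_left, Rmax_right by lra. intros x Hx.
      apply continuity_pt_filterlim.
      exact (@ex_derive_continuous R_AbsRing R_NormedModule _ x (ex_intro _ 0%R (Hder x Hx))).
    - lra. }
  assert (D0 : is_derive K 0 (L 0)) by (apply is_derive_circle_mean; rewrite Rabs_R0; auto).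
  apply is_derive_Reals in D0.
  assert (E : (K t / t)%R = L 0).
  { apply NNPP. intros Hne.
    assert (Hp : (0 < Rabs (K t / t - L 0))%R) by (apply Rabs_pos_lt; lra).
    destruct (D0 _ Hp) as [d Hd]. set (h := (Rmin d t / 2)%R).
    assert (G1 := Rmin_l d t). assert (G2 := Rmin_r d t).
    assert (G3 : (0 < Rmin d t)%R) by (apply Rmin_pos; [apply cond_pos | lra]).
    assert (Hh : (0 < h)%R) by (unfold h; lra).
    specialize (Hd h ltac:(lra)). rewrite Rplus_0_l, K0, Rminus_0_r, Rabs_pos_eq in Hd by lra.
    specialize (Hd ltac:(unfold h; lra)). rewrite (Cst h) in Hd by (unfold h in *; lra). lra. }
  rewrite <- E. change (K t = t * (K t / t))%R. generalize (K t : R). intros x. field. lra.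
Qed.

Lemma cauchy_estimate_rotated : (2 * PI * fst (u * partial v f p)%C * rho <= 2 * PI * (Cmod u * M))%R.
Proof.
  assert (E0 : L 0 = (2 * PI * fst (u * partial v f p)%C)%R).
  { unfold L. rewrite (RInt_ext _ (fun _ => fst (u * partial v f p))).
    - rewrite RInt_const. unfold scal. simpl. unfold mult. simpl. ring.
    - intros th _. unfold dk, pt. do 3 f_equal. replace (co p v + RtoC 0 * cis th) with (co p v) by ring.
      apply upd_co. }
  rewrite <- E0.
  assert (Bt : forall t, (0 < t < rho)%R -> (L 0 * t <= 2 * PI * (Cmod u * M))%R).
  { intros t Ht. assert (Rabs t < rho)%R by (rewrite Rabs_pos_eq; lra).
    rewrite (Rmult_comm (L 0)), <- circle_mean_linear by auto.
    eapply Rle_trans; [apply Rle_abs|]. unfold K.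
    assert (HPI := PI_RGT_0).
    replace (2 * PI * (Cmod u * M))%R with ((2 * PI - 0) * (Cmod u * M))%R by ring.
    apply abs_RInt_le_const; [lra | |].
    - apply (@ex_RInt_continuous R_CompleteNormedModule). intros; apply continuous_k; auto.
    - intros th _. unfold k. eapply Rle_trans; [apply Re_le_Cmod|].
      rewrite !Cmod_mult, Cmod_cis_bar, Rmult_1_r. apply Rmult_le_compat_l; [apply Cmod_ge_0|].
      apply HM. apply cauchy_pt_norm. auto. }
  (* The radius is brought close to [rho] by a margin that involves [e / L 0], so the sign of [L 0]
     is settled first. *)
  destruct (Rle_dec (L 0) 0) as [Hn|Hp].
  - assert (B := Bt (rho / 2)%R ltac:(lra)).
    assert (HM0 : (0 <= M)%R).
    { eapply Rle_trans; [apply Cmod_ge_0|]. apply (HM 0). rewrite Cmod_0. auto. }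
    assert (0 <= Cmod u * M)%R by (apply Rmult_le_pos; auto; apply Cmod_ge_0).
    assert (HPI := PI_RGT_0). nra.
  - apply le_epsilon. intros e He.
    set (t := (rho - Rmin (rho / 2) (e / L 0))%R).
    assert (G1 := Rmin_l (rho / 2) (e / L 0)). assert (G2 := Rmin_r (rho / 2) (e / L 0)).
    assert (G3 : (0 < Rmin (rho / 2) (e / L 0))%R) by (apply Rmin_pos; [lra | apply Rdiv_lt_0_compat; lra]).
    assert (B := Bt t ltac:(unfold t; lra)). unfold t in B.
    apply (Rmult_le_compat_l (L 0)) in G2; [|lra].
    replace (L 0 * (e / L 0))%R with e in G2 by (field; lra). lra.
Qed.

End CauchyEstimate.

Lemma cauchy_estimate (f : C3 -> C) p v rho M : (0 < rho)%R ->
  (forall z : C, (Cmod z < rho)%R -> analytic_at f (upd p v (co p v + z))) ->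
  (forall z : C, (Cmod z < rho)%R -> (Cmod (f (upd p v (co p v + z))) <= M)%R) ->
  (Cmod (partial v f p) * rho <= M)%R.
Proof.
  intros Hrho Han HM.
  (* With [u] the conjugate of the derivative l, the real part of u l is |l|^2 and |u| = |l|. *)
  assert (H := cauchy_estimate_rotated f p v rho M (Cconj (partial v f p)) Hrho Han HM).
  set (l := partial v f p) in *.
  assert (E : fst (Cconj l * l) = (Cmod l ^ 2)%R).
  { rewrite Cmod2_alt. unfold Re, Im. simpl. ring. }
  rewrite E, Cmod_conj in H. assert (HPI := PI_RGT_0). assert (Hl := Cmod_ge_0 l).
  destruct (Req_dec (Cmod l) 0) as [Z|Z].
  - rewrite Z, Rmult_0_l. eapply Rle_trans; [apply Cmod_ge_0|]. apply (HM 0). rewrite Cmod_0. auto.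
  - apply (Rmult_le_reg_l (2 * PI * Cmod l)); [apply Rmult_lt_0_compat; lra|]. lra.
Qed.

(** * The image of a map tangent to the identity *)

Definition kronecker (v i : coord) : C :=
  match v, i with cx, cx | cy1, cy1 | cy2, cy2 => 1 | _, _ => 0 end.

Lemma Csub_eq_0 (x y : C) : x - y = 0 -> x = y.
Proof. intros H. replace x with (x - y + y) by ring. rewrite H. ring. Qed.

Lemma cderiv_segment p h t i : cderiv (fun s => co (move p s h) i) t (co h i).
Proof.
  assert (H : cderiv (fun s => co p i + RtoC s * co h i) t (co h i)).
  { apply (cderiv_eq _ _ (0 + (1 * co h i + RtoC t * 0))); [ring|].
    apply cderiv_plus; [apply cderiv_const|].
    apply (cderiv_mult RtoC (fun _ => co h i)); [apply cderiv_RtoC | apply cderiv_const]. }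
  destruct i; exact H.
Qed.

(** The real mean value theorem is applied to the real part of conj(D) f, where D is the total
    increment of [f]: it yields |D|^2 <= |D| B. *)
Lemma mean_value_segment (f : C3 -> C) p h B :
  (forall t, (0 <= t <= 1)%R -> analytic_at f (move p t h) /\
     (Cmod (dot (fun v => partial v f (move p t h)) h) <= B)%R) ->
  (Cmod (f (move p 1 h) - f (move p 0 h)) <= B)%R.
Proof.
  intros H. set (D := f (move p 1 h) - f (move p 0 h)).
  set (g := fun t => Cconj D * f (move p t h)).
  assert (Hg : forall t, (0 <= t <= 1)%R -> cderiv g t (Cconj D * dot (fun v => partial v f (move p t h)) h)).
  { intros t Ht. apply cderiv_scal.
    apply (cderiv_comp f (fun t => move p t h) t _ (co h) (analytic_frechet _ _ (proj1 (H t Ht)))).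
    intros i. apply cderiv_segment. }
  destruct (MVT_gen (fun t => fst (g t)) 0 1 (fun t => fst (Cconj D * dot (fun v => partial v f (move p t h)) h)))
    as (c & Hc & E).
  - rewrite Rmin_left, Rmax_right by lra. intros x Hx. apply cderiv_is_derive, Hg. lra.
  - rewrite Rmin_left, Rmax_right by lra. intros x Hx. apply continuity_pt_filterlim.
    exact (cderiv_continuous_fst _ _ _ (Hg x Hx)).
  - rewrite Rmin_left, Rmax_right in Hc by lra. rewrite Rminus_0_r, Rmult_1_r in E.
    assert (ED : (fst (g 1) - fst (g 0))%R = (Cmod D ^ 2)%R).
    { rewrite Cmod2_alt. unfold g, Re, Im. transitivity (fst (Cconj D * D)); [unfold D at 2; simpl; ring | simpl; ring]. }
    rewrite ED in E. destruct (H c Hc) as [_ Hb].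
    assert (Q := Re_le_Cmod (Cconj D * dot (fun v => partial v f (move p c h)) h)).
    rewrite <- E, Cmod_mult, Cmod_conj in Q.
    assert (Q' := Rle_abs (Cmod D ^ 2)). assert (P := Cmod_ge_0 D).
    destruct (Req_dec (Cmod D) 0) as [Z|Z].
    + rewrite Z. eapply Rle_trans; [apply Cmod_ge_0 | exact Hb].
    + apply (Rmult_le_reg_l (Cmod D)); [lra|].
      apply (Rmult_le_compat_l (Cmod D)) in Hb; lra.
Qed.

Section NearZero.

Variables (X : C -> Prop) (rho : R) (U : C3 -> Prop) (Phi : C3 -> C3) (M d : R).
Hypothesis HU : forall p, U p <-> X (co p cx) /\ (Cmod (co p cy1) < rho)%R /\ (Cmod (co p cy2) < rho)%R.
Hypothesis Han : forall i p, U p -> analytic_at (fun q => co (Phi q) i) p.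
Hypothesis Hfib : fibered_on U Phi.
Hypothesis HM : (0 <= M)%R.
Hypothesis Hd : (0 < d)%R.
Hypothesis Hrho : (2 * d <= rho)%R.
Hypothesis Htan : forall p, U p -> (norm3 p < 2 * d)%R -> (norm3 (sub3 (Phi p) p) <= M * norm3 p ^ 2)%R.

Let G (i : coord) (q : C3) : C := co (Phi q) i - co q i.

Lemma small_in_U p : X (co p cx) -> (norm3 p < 2 * d)%R -> U p.
Proof.
  intros Hx Hp. apply HU. split; auto.
  split; (eapply Rle_lt_trans; [apply norm3_co | lra]).
Qed.

Lemma G_analytic i p : U p -> analytic_at (G i) p.
Proof.
  intros Hp. apply analytic_minus; auto.
  exists (fadd (fcst (co p i)) (fvar i)), 1%R. split; [lra|]. split.
  - apply abs_summable_fadd; [lra | apply abs_summable_fcst; lra | apply abs_summable_fvar; lra].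
  - intros q _. destruct (psum_fcst (co p i) (sub3 q p)) as [E1 [M1 H1]].
    destruct (psum_fvar i (sub3 q p)) as [E2 [M2 H2]].
    rewrite (psum_fadd _ _ _ _ _ H1 H2), E1, E2. destruct i; simpl; ring.
Qed.

Lemma G_bound i p : U p -> (norm3 p < 2 * d)%R -> (Cmod (G i p) <= M * norm3 p ^ 2)%R.
Proof.
  intros Hp Hn. eapply Rle_trans; [|apply Htan; auto].
  replace (G i p) with (co (sub3 (Phi p) p) i) by (unfold G; destruct i; reflexivity). apply norm3_co.
Qed.

(** A disc of radius [d] in a [y] direction stays in norm below [2 * d], where [G] is at most M
    (2d)^2; dividing by [d] gives [4 * M * d]. The direction [cx] is excluded, since such a disc may
    leave the sector. *)
Lemma G_partial v i p : v <> cx -> U p -> (norm3 p < d)%R -> (Cmod (partial v (G i) p) <= 4 * M * d)%R.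
Proof.
  intros Hv Hp Hn.
  assert (HX : X (co p cx)) by (apply HU; auto).
  assert (Q : forall z, (Cmod z < d)%R -> U (upd p v (co p v + z)) /\ (norm3 (upd p v (co p v + z)) < 2 * d)%R).
  { intros z Hz.
    assert (N : (norm3 (upd p v (co p v + z)) < 2 * d)%R).
    { eapply Rle_lt_trans; [apply (norm3_sub_le _ p)|]. rewrite norm3_upd_sub.
      replace (co p v + z - co p v) with z by ring. lra. }
    split; auto. apply small_in_U; auto. destruct v; [congruence| |]; exact HX. }
  apply (Rmult_le_reg_r d); auto.
  replace (4 * M * d * d)%R with (M * (2 * d) ^ 2)%R by ring.
  apply cauchy_estimate; auto.
  - intros z Hz. apply G_analytic, Q. auto.
  - intros z Hz. destruct (Q z Hz) as [Q1 Q2]. eapply Rle_trans; [apply G_bound; auto|].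
    apply Rmult_le_compat_l; auto. apply pow_incr. split; [apply norm3_nonneg | lra].
Qed.

Lemma jac_near_identity v i p : v <> cx -> U p -> (norm3 p < d)%R ->
  (Cmod (jac Phi v i p - kronecker v i) <= 4 * M * d)%R.
Proof.
  intros Hv Hp Hn. eapply Rle_trans; [|apply (G_partial v i p); auto]. right. f_equal.
  symmetry. assert (F := frechet_minus _ _ _ _ _ (analytic_frechet _ _ (Han i p Hp)) (frechet_co i p)).
  etransitivity; [exact (frechet_partial (G i) p _ v F)|].
  unfold jac, kronecker. destruct v, i; reflexivity.
Qed.

(** Both points have the same [x], so the segment stays in the domain and only the two [y]
    derivatives, each at most [4 * M * d], contribute. *)
Lemma G_contracts i p q : U p -> U q -> (norm3 p < d)%R -> (norm3 q < d)%R -> co p cx = co q cx ->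
  (Cmod (G i q - G i p) <= 8 * M * d * norm3 (sub3 q p))%R.
Proof.
  intros Hp Hq Np Nq Ex. set (h := sub3 q p).
  assert (E1 : move p 1 h = q).
  { unfold move, h. destruct p as [[? ?] ?], q as [[? ?] ?]. simpl. f_equal; [f_equal|]; ring. }
  assert (E0 : move p 0 h = p).
  { unfold move, h. destruct p as [[? ?] ?], q as [[? ?] ?]. simpl. f_equal; [f_equal|]; ring. }
  assert (H := mean_value_segment (G i) p h (8 * M * d * norm3 h)). rewrite E1, E0 in H.
  apply H. intros t Ht.
  assert (Nt : (norm3 (move p t h) < d)%R).
  { apply norm3_lt. intros j.
    replace (co (move p t h) j) with (RtoC (1 - t) * co p j + RtoC t * co q j)
      by (rewrite RtoC_minus; unfold h; destruct j; simpl; ring).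
    eapply Rle_lt_trans; [apply Cmod_triangle|]. rewrite !Cmod_mult, !Cmod_R, !Rabs_pos_eq by lra.
    assert (B1 := norm3_co p j). assert (B2 := norm3_co q j).
    destruct (Req_dec t 0) as [->|]; nra. }
  assert (Ut : U (move p t h)).
  { apply small_in_U; [|lra].
    replace (co (move p t h) cx) with (co p cx) by (unfold h; simpl in *; rewrite Ex; ring).
    apply HU; auto. }
  split; [apply G_analytic; auto|]. unfold dot.
  replace (co h cx) with (RtoC 0) by (unfold h; simpl in *; rewrite Ex; ring).
  assert (B1 := G_partial cy1 i _ ltac:(discriminate) Ut Nt).
  assert (B2 := G_partial cy2 i _ ltac:(discriminate) Ut Nt).
  rewrite Cmult_0_r, Cplus_0_l. eapply Rle_trans; [apply Cmod_triangle|]. rewrite !Cmod_mult.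
  assert (N1 := norm3_co h cy1). assert (N2 := norm3_co h cy2). assert (N0 := norm3_nonneg h).
  assert (C1 : (Cmod (partial cy1 (G i) (move p t h)) * Cmod (co h cy1) <= 4 * M * d * norm3 h)%R)
    by (apply Rmult_le_compat; auto; apply Cmod_ge_0).
  assert (C2 : (Cmod (partial cy2 (G i) (move p t h)) * Cmod (co h cy2) <= 4 * M * d * norm3 h)%R)
    by (apply Rmult_le_compat; auto; apply Cmod_ge_0).
  lra.
Qed.

Hypothesis HMd : (32 * M * d <= 1)%R.

Section Target.

Variable w : C3.
Hypothesis Hwx : X (co w cx).
Hypothesis Hw : (norm3 w < d / 2)%R.

(** Iteration for the equation p = w - G(p), equivalent to Phi(p) = w, with [x] frozen at its value
    in [w] because the map is fibered. *)
Fixpoint picard_seq (n : nat) : C3 :=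
  match n with
  | 0%nat => (co w cx, RtoC 0, RtoC 0)
  | S m => (co w cx, co w cy1 - G cy1 (picard_seq m), co w cy2 - G cy2 (picard_seq m))
  end.

Lemma picard_x n : co (picard_seq n) cx = co w cx.
Proof. destruct n; reflexivity. Qed.

(** 17/32 is 1/2 + 1/32: the target is smaller than [d / 2], and [32 * M * d <= 1] bounds the
    correction M d^2 by [d / 32]. *)
Lemma picard_small n : U (picard_seq n) /\ (norm3 (picard_seq n) <= 17 / 32 * d)%R.
Proof.
  induction n as [|n [IHU IHn]].
  - assert (N : (norm3 (picard_seq 0) <= 17 / 32 * d)%R).
    { apply norm3_le. intros []; simpl; rewrite ?Cmod_0; try lra.
      assert (B := norm3_co w cx). simpl in B. lra. }
    split; auto. apply small_in_U; [auto | lra].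
  - assert (N : (norm3 (picard_seq (S n)) <= 17 / 32 * d)%R).
    { assert (B : forall i, (Cmod (co w i - G i (picard_seq n)) <= 17 / 32 * d)%R).
      { intros i. eapply Rle_trans; [apply Cmod_minus_le|].
        assert (B1 := norm3_co w i). assert (B2 := G_bound i _ IHU ltac:(lra)).
        assert (B3 := norm3_nonneg (picard_seq n)).
        assert (M * norm3 (picard_seq n) ^ 2 <= M * d ^ 2)%R by (apply Rmult_le_compat_l; auto; apply pow_incr; lra).
        assert (M * d ^ 2 <= d / 32)%R by nra. lra. }
      apply norm3_le. intros []; [rewrite picard_x | exact (B cy1) | exact (B cy2)].
      assert (B1 := norm3_co w cx). lra. }
    split; auto. apply small_in_U; [rewrite picard_x; auto | lra].
Qed.

(** The contraction factor 1/4 bounds [8 * M * d], by [32 * M * d <= 1]. *)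
Lemma picard_step i n p : U p -> (norm3 p < d)%R -> co p cx = co w cx ->
  (Cmod ((co w i - G i (picard_seq n)) - (co w i - G i p)) <= norm3 (sub3 (picard_seq n) p) / 4)%R.
Proof.
  intros Hp Np Ex. destruct (picard_small n) as [HUn Nn].
  replace (co w i - G i (picard_seq n) - (co w i - G i p)) with (- (G i (picard_seq n) - G i p)) by ring.
  rewrite Cmod_opp. eapply Rle_trans; [apply G_contracts; auto; [lra | rewrite picard_x; auto]|].
  assert (N := norm3_nonneg (sub3 (picard_seq n) p)). nra.
Qed.

Lemma picard_diff n : (norm3 (sub3 (picard_seq (S n)) (picard_seq n)) <= d * (/ 4) ^ n)%R.
Proof.
  induction n as [|n IH].
  - destruct (picard_small 1) as [_ N1]. apply norm3_le. intros i.
    replace (d * (/ 4) ^ 0)%R with d by (simpl; ring).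
    assert (B1 := norm3_co (picard_seq 1) i).
    destruct i.
    + replace (co (sub3 (picard_seq 1) (picard_seq 0)) cx) with (RtoC 0) by (simpl; ring). rewrite Cmod_0. lra.
    + replace (co (sub3 (picard_seq 1) (picard_seq 0)) cy1) with (co (picard_seq 1) cy1) by (simpl; ring). lra.
    + replace (co (sub3 (picard_seq 1) (picard_seq 0)) cy2) with (co (picard_seq 1) cy2) by (simpl; ring). lra.
  - destruct (picard_small n) as [HUn Nn].
    assert (B := fun i => picard_step i (S n) _ HUn ltac:(lra) (picard_x n)).
    apply norm3_le. intros i. replace (d * (/ 4) ^ S n)%R with (d * (/ 4) ^ n / 4)%R by (simpl; field).
    apply Rle_trans with (norm3 (sub3 (picard_seq (S n)) (picard_seq n)) / 4)%R; [|lra].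
    destruct i.
    + replace (co (sub3 (picard_seq (S (S n))) (picard_seq (S n))) cx) with (RtoC 0) by (simpl; ring).
      rewrite Cmod_0. assert (N := norm3_nonneg (sub3 (picard_seq (S n)) (picard_seq n))). lra.
    + exact (B cy1).
    + exact (B cy2).
Qed.

Lemma picard_cauchy n m : (n <= m)%nat -> (norm3 (sub3 (picard_seq m) (picard_seq n)) <= 2 * d * (/ 4) ^ n)%R.
Proof.
  intros H. assert (A : (norm3 (sub3 (picard_seq m) (picard_seq n)) <= 2 * d * ((/ 4) ^ n - (/ 4) ^ m))%R).
  { induction H as [|m H IH].
    - rewrite norm3_sub_self. lra.
    - eapply Rle_trans; [apply (norm3_sub_triangle _ (picard_seq m))|].
      assert (D := picard_diff m). assert (0 < d * (/ 4) ^ m)%R by (apply Rmult_lt_0_compat; [|apply pow_lt]; lra).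
      change ((/ 4) ^ S m)%R with (/ 4 * (/ 4) ^ m)%R. lra. }
  assert (0 < d * (/ 4) ^ m)%R by (apply Rmult_lt_0_compat; [|apply pow_lt]; lra). lra.
Qed.

Lemma picard_limit : exists p, U p /\ Phi p = w /\ (norm3 p <= 2 * norm3 w)%R.
Proof.
  assert (P4 : forall e, (0 < e)%R -> exists N, forall n, (N <= n)%nat -> (2 * d * (/ 4) ^ n < e)%R).
  { intros e He. destruct (pow_lt_1_zero (/ 4) ltac:(rewrite Rabs_pos_eq; lra) (e / (2 * d))) as [N HN].
    { apply Rdiv_lt_0_compat; lra. }
    exists N. intros n Hn. specialize (HN n Hn). rewrite Rabs_pos_eq in HN by (apply pow_le; lra).
    apply (Rmult_lt_compat_l (2 * d)) in HN; [|lra].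
    replace (2 * d * (e / (2 * d)))%R with e in HN by (field; lra). auto. }
  assert (L : forall i, exists z, forall e, (0 < e)%R -> exists N, forall n, (N <= n)%nat ->
     (Cmod (co (picard_seq n) i - z) < e)%R).
  { intros i. apply Ccauchy_lim. intros e He. destruct (P4 e He) as [N HN]. exists N. intros n m Hnm.
    eapply Rle_lt_trans; [|apply (HN n); lia]. eapply Rle_trans; [|apply (picard_cauchy n m); lia].
    replace (co (picard_seq m) i - co (picard_seq n) i) with (co (sub3 (picard_seq m) (picard_seq n)) i)
      by (destruct i; reflexivity). apply norm3_co. }
  destruct (L cy1) as [z1 L1], (L cy2) as [z2 L2]. clear L.
  set (p := (co w cx, z1, z2)).
  assert (Lp : forall e, (0 < e)%R -> exists N, forall n, (N <= n)%nat -> (norm3 (sub3 (picard_seq n) p) < e)%R).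
  { intros e He. destruct (L1 e He) as [N1 H1], (L2 e He) as [N2 H2]. exists (N1 + N2)%nat. intros n Hn.
    apply norm3_lt. intros [].
    - replace (co (sub3 (picard_seq n) p) cx) with (RtoC 0); [rewrite Cmod_0; auto|].
      transitivity (co (picard_seq n) cx - co p cx); [|reflexivity]. rewrite picard_x. unfold p. simpl. ring.
    - apply H1. lia.
    - apply H2. lia. }
  assert (Np : (norm3 p <= 17 / 32 * d)%R).
  { apply le_epsilon. intros e He. destruct (Lp e He) as [N HN]. specialize (HN N (le_n N)).
    destruct (picard_small N) as [_ B]. assert (T := norm3_sub_le p (picard_seq N)).
    replace (norm3 (sub3 p (picard_seq N))) with (norm3 (sub3 (picard_seq N) p)) in T; [lra|].
    unfold norm3. cbn [co sub3 fst snd]. f_equal; [|f_equal]; apply Cmod_sub_comm. }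
  assert (Up : U p) by (apply small_in_U; [exact Hwx | lra]).
  assert (Fix_ : forall i, i <> cx -> co w i - G i p = co p i).
  { intros i Hi. apply Csub_eq_0, Cmod_eq_0, Rle_antisym; [|apply Cmod_ge_0].
    apply le_epsilon. intros e He. destruct (Lp (e / 2)%R ltac:(lra)) as [N HN].
    assert (S1 := picard_step i N p Up ltac:(lra) eq_refl). rewrite Cmod_sub_comm in S1.
    assert (B1 := HN N (le_n N)). assert (B2 := HN (S N) ltac:(lia)).
    assert (E : co (picard_seq (S N)) i = co w i - G i (picard_seq N)) by (destruct i; [congruence| |]; reflexivity).
    assert (B3 := norm3_co (sub3 (picard_seq (S N)) p) i).
    replace (co (sub3 (picard_seq (S N)) p) i) with (co (picard_seq (S N)) i - co p i) in B3 by (destruct i; reflexivity).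
    rewrite E in B3. assert (T := Cmod_triangle_sub (co w i - G i p) (co w i - G i (picard_seq N)) (co p i)). lra. }
  assert (EPhi : Phi p = w).
  { assert (Ei : forall i, co (Phi p) i = co w i).
    { intros i. destruct (classic (i = cx)) as [->|Hi]; [rewrite Hfib; auto|].
      assert (E := Fix_ i Hi). unfold G in E.
      replace (co (Phi p) i) with (co w i - (co w i - (co (Phi p) i - co p i)) + co p i) by ring. rewrite E. ring. }
    assert (E1 := Ei cx). assert (E2 := Ei cy1). assert (E3 := Ei cy2).
    destruct (Phi p) as [[? ?] ?], w as [[? ?] ?]. simpl in *. congruence. }
  exists p. split; [auto|]. split; [auto|].
  assert (N0 := norm3_nonneg p). assert (Nw := norm3_nonneg w).
  (* Here M |p|^2 <= |p| / 32 because M |p| <= M d; so preimages are small together with their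
     targets. *)
  assert (B : (norm3 p <= norm3 w + norm3 p / 32)%R); [|lra].
  apply norm3_le. intros i. destruct (classic (i = cx)) as [->|Hi].
  - assert (Bx := norm3_co w cx). change (co p cx) with (co w cx). lra.
  - rewrite <- Fix_ by auto. eapply Rle_trans; [apply Cmod_minus_le|].
    assert (Bw := norm3_co w i). assert (Bg := G_bound i p Up ltac:(lra)).
    assert (M * norm3 p ^ 2 <= norm3 p / 32)%R by nra. lra.
Qed.

End Target.
End NearZero.

(** * Trajectories of the normal form *)

(** The exponential of the integral of [g] from 0 to [t], in polar form: the solution of e' = g e
    with e(0) = 1. *)
Definition exp_integral (g : R -> C) (t : R) : C :=
  RtoC (exp (RInt (fun s => fst (g s)) 0 t)) * cis (RInt (fun s => snd (g s)) 0 t).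

(** The integrand is continuous from some [b < 0] on, so that the derivative at the initial time 0
    is two-sided as well. *)
Lemma is_derive_RInt_from_zero (f : R -> R) (b t : R) : (b < 0)%R -> (b < t)%R ->
  (forall s, (b < s)%R -> continuous f s) -> is_derive (fun t => RInt f 0 t) t (f t).
Proof.
  intros Hb Ht Hf. apply (is_derive_RInt f (fun t => RInt f 0 t) 0 t); [|apply Hf; auto].
  assert (Hp : (0 < t - b)%R) by lra. exists (mkposreal _ Hp). intros s Hs.
  change (Rabs (s - t) < t - b)%R in Hs. apply Rabs_def2 in Hs.
  apply (@RInt_correct R_CompleteNormedModule), (@ex_RInt_continuous R_CompleteNormedModule).
  intros z Hz. apply Hf. unfold Rmin in Hz. destruct (Rle_dec 0 s); lra.
Qed.

Lemma exp_integral_zero g : exp_integral g 0 = 1.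
Proof.
  unfold exp_integral, cis. rewrite !RInt_point. unfold zero. simpl.
  rewrite exp_0, cos_0, sin_0. apply injective_projections; simpl; ring.
Qed.

Lemma cderiv_exp_integral g b t : (b < 0)%R -> (b < t)%R ->
  (forall s, (b < s)%R -> exists l, cderiv g s l) ->
  cderiv (exp_integral g) t (g t * exp_integral g t).
Proof.
  intros Hb Ht Hg.
  assert (C1 : forall s, (b < s)%R -> continuous (fun s => fst (g s)) s).
  { intros s Hs. destruct (Hg s Hs) as [l Hl]. apply (cderiv_continuous_fst _ _ _ Hl). }
  assert (C2 : forall s, (b < s)%R -> continuous (fun s => snd (g s)) s).
  { intros s Hs. destruct (Hg s Hs) as [l Hl].
    apply (@ex_derive_continuous R_AbsRing R_NormedModule). exists (snd l). apply cderiv_is_derive. auto. }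
  assert (D1 := is_derive_RInt_from_zero _ b t Hb Ht C1).
  assert (D2 := is_derive_RInt_from_zero _ b t Hb Ht C2).
  set (A := fun t => RInt (fun s => fst (g s)) 0 t) in *.
  set (B := fun t => RInt (fun s => snd (g s)) 0 t) in *.
  assert (E : forall s, exp_integral g s = (exp (A s) * cos (B s), exp (A s) * sin (B s))%R).
  { intros s. unfold exp_integral, cis. fold (A s) (B s). apply injective_projections; simpl; ring. }
  apply (cderiv_ext (fun s => ((exp (A s) * cos (B s))%R, (exp (A s) * sin (B s))%R))); [intros s; auto|].
  rewrite E.
  apply (cderiv_eq _ _ ((exp (A t) * (fst (g t) * cos (B t) - snd (g t) * sin (B t)))%R,
                        (exp (A t) * (fst (g t) * sin (B t) + snd (g t) * cos (B t)))%R)).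
  - apply injective_projections; simpl; ring.
  - assert (X1 : ex_derive A t) by (eexists; exact D1). assert (X2 : ex_derive B t) by (eexists; exact D2).
    assert (Y1 := is_derive_unique _ _ _ D1). assert (Y2 := is_derive_unique _ _ _ D2).
    change (Derive A t = fst (g t)) in Y1. change (Derive B t = snd (g t)) in Y2.
    clearbody A B. rewrite <- Y1, <- Y2.
    apply is_derive_cderiv; auto_derive; auto; change (Derive (fun x => A x) t) with (Derive A t); change (Derive (fun x => B x) t) with (Derive B t); ring.
Qed.

Lemma exp_nondecreasing (x y : R) : (x <= y)%R -> (exp x <= exp y)%R.
Proof. intros [H| ->]; [left; apply exp_increasing; auto | lra]. Qed.

Lemma Cmod_exp_integral g b t m : (b < 0)%R -> (0 <= t)%R ->
  (forall s, (b < s)%R -> exists l, cderiv g s l) ->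
  (forall s, (0 <= s)%R -> (fst (g s) <= m)%R) ->
  (Cmod (exp_integral g t) <= exp (m * t))%R.
Proof.
  intros Hb Ht Hg Hm.
  assert (C1 : forall s, (b < s)%R -> continuous (fun s => fst (g s)) s).
  { intros s Hs. destruct (Hg s Hs) as [l Hl]. apply (cderiv_continuous_fst _ _ _ Hl). }
  unfold exp_integral. rewrite Cmod_mult, Cmod_cis, Rmult_1_r, Cmod_R, Rabs_pos_eq by (left; apply exp_pos).
  assert (D : forall s, (0 <= s <= t)%R -> is_derive (fun t => RInt (fun s => fst (g s)) 0 t) s (fst (g s))).
  { intros s Hs. apply (is_derive_RInt_from_zero (fun s => fst (g s)) b); auto; lra. }
  destruct (MVT_gen (fun t => RInt (fun s => fst (g s)) 0 t) 0 t (fun s => fst (g s))) as (c & Hc & E).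
  - rewrite Rmin_left, Rmax_right by lra. intros x Hx. apply D. lra.
  - rewrite Rmin_left, Rmax_right by lra. intros x Hx. apply continuity_pt_filterlim.
    exact (@ex_derive_continuous R_AbsRing R_NormedModule _ x (ex_intro _ _ (D x Hx))).
  - rewrite Rmin_left, Rmax_right in Hc by lra. rewrite RInt_point in E. unfold zero in E. simpl in E.
    rewrite !Rminus_0_r in E. rewrite E.
    apply exp_nondecreasing. apply Rmult_le_compat_r; auto. apply Hm. lra.
Qed.

Lemma cderiv_inv (g : R -> C) t l : g t <> 0 -> cderiv g t l -> cderiv (fun s => / g s) t (- l / (g t * g t)).
Proof.
  intros Hz Hg. set (p := (g t, RtoC 0, RtoC 0)).
  assert (Fi := analytic_frechet _ _ (analytic_inv_x p Hz)).
  set (m := partial cx (fun q => / co q cx) p) in *.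
  assert (Em : m = - / (g t * g t)).
  { assert (F := frechet_minus _ _ _ _ _ (frechet_mult _ _ _ _ _ (frechet_co cx p) Fi) (frechet_const 1 p)).
    assert (Hd : (0 < Cmod (g t))%R) by (apply Cmod_gt_0; auto).
    assert (Z := frechet_direction _ _ _ cx _ F Hd). cbv beta in Z. fold m in Z.
    change (co p cx) with (g t) in Z.
    assert (Z0 : 1 * / g t + g t * m - 0 = 0).
    { apply Z. intros s Hs. change (co (upd p cx s) cx) with s.
      assert (s <> 0). { intros ->. rewrite <- Cmod_opp in Hs.
        replace (- (0 - g t)) with (g t) in Hs by ring. lra. }
      rewrite Cinv_r by auto. ring. }
    replace m with ((1 * / g t + g t * m - 0) / g t - / (g t * g t)) by (field; auto).
    rewrite Z0. field. auto. }
  assert (H := cderiv_comp _ (fun s => (g s, RtoC 0, RtoC 0)) t _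
    (fun i => match i with cx => l | _ => 0 end) Fi).
  cbv beta in H. fold p m in H. rewrite Em in H.
  eapply cderiv_eq; [|apply H].
  - field. auto.
  - intros []; [exact Hg | exact (cderiv_const 0 t) | exact (cderiv_const 0 t)].
Qed.

Lemma Cmod_ge_re (z : C) : (fst z <= Cmod z)%R.
Proof. eapply Rle_trans; [apply Rle_abs | apply Re_le_Cmod]. Qed.

Lemma sign_sq (sg : R) : (sg = 1 \/ sg = -1)%R -> RtoC sg * RtoC sg = 1.
Proof. intros H. rewrite <- RtoC_mult. destruct H as [-> | ->]; f_equal; ring. Qed.

Section Trajectory.

Variables (lam a1 a2 W0 y10 y20 : C) (sg T0 V K : R) (cf : C -> C).
Hypothesis Hlam : lam <> 0.
Hypothesis Hsg : (sg = 1 \/ sg = -1)%R.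
Hypothesis Ha : a1 + a2 = 1.
Hypothesis HK : (0 <= K)%R.
Hypothesis Hcf : forall v, (Cmod v < V)%R -> (Cmod (cf v) <= K * Cmod v)%R.
Hypothesis Hcfd : forall v t l, cderiv v t l -> (Cmod (v t) < V)%R ->
  exists l', cderiv (fun t => cf (v t)) t l'.
Hypothesis HW0 : (Cmod (W0 - RtoC T0) <= 1)%R.

(** Half the difference of the real parts of [a1] and [a2], whose sum is 1. *)
Let beta : R := (fst a1 - / 2)%R.
(* The first integral [y1 y2 / x] of the normal form. *)
Let h : C := y10 * y20 * (- Ci * RtoC sg * W0 / lam).

(** [HT1] keeps |W| >= 3 from time -1/2 on, [HT2] gives |dW/W - 1| <= 1, and [HT3] and [Hh1] bound
    by 1/8 each the errors coming from dW/W and from c; together these cost half of the decay rate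
    1/2. [Hh2] keeps [h * x] in the disc where c is controlled. *)
Hypothesis HT1 : (8 <= T0)%R.
Hypothesis HT2 : (1 + Rabs beta <= T0 - 1)%R.
Hypothesis HT3 : (8 * (Cmod a1 + Cmod a2) * (1 + Rabs beta) <= T0 - 1)%R.
Hypothesis Hh1 : (16 * K * Cmod h <= 1)%R.
Hypothesis Hh2 : (Cmod h * Cmod lam < V)%R.

(* In [W = i lam sg / x] the flow is nearly a translation; the drift [i sg beta t] balances the
   powers [x^a1] and [x^a2], so that [y1] and [y2] both decay like [x^(1/2)]. *)
Let W (t : R) : C := W0 - RtoC T0 + RtoC (T0 * exp t) + RtoC t * (Ci * RtoC (sg * beta)).
Let dW (t : R) : C := RtoC (T0 * exp t) + Ci * RtoC (sg * beta).
Let x (t : R) : C := Ci * lam * RtoC sg * / W t.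
(** The complex speed of the flow time along the path: the factor for which x' = kap x^2. *)
Let kap (t : R) : C := Ci * RtoC sg * / lam * dW t.
(** Logarithmic derivatives of [y1] and [y2]. The product [y1 y2] inside c is replaced in advance by
    [h * x], which makes the equations linear and uncoupled; [y1_y2] justifies this afterwards. *)
Let g1 (t : R) : C := kap t * (- lam + a1 * x t - cf (h * x t)).
Let g2 (t : R) : C := kap t * (lam + a2 * x t + cf (h * x t)).
Let y1 (t : R) : C := y10 * exp_integral g1 t.
Let y2 (t : R) : C := y20 * exp_integral g2 t.

Lemma re_W t : (T0 * exp t - 1 <= fst (W t))%R.
Proof.
  assert (B : (-1 <= fst (W0 - RtoC T0)%C)%R).
  { assert (Q := Re_le_Cmod (W0 - RtoC T0)). apply Rabs_le_between in Q. lra. }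
  unfold W. simpl in *. lra.
Qed.

Lemma exp_lower t : (-1 / 2 < t)%R -> (/ 2 <= exp t)%R.
Proof. intros Ht. assert (E := exp_ineq1_le t). lra. Qed.

Lemma Cmod_W t : (-1 / 2 < t)%R -> (3 <= Cmod (W t))%R.
Proof.
  intros Ht. assert (E := exp_lower t Ht). assert (B := re_W t). assert (B' := Cmod_ge_re (W t)). nra.
Qed.

Lemma W_neq0 t : (-1 / 2 < t)%R -> W t <> 0.
Proof. intros Ht. apply Cmod_gt_0. assert (B := Cmod_W t Ht). lra. Qed.

Lemma Cmod_sg : Cmod (RtoC sg) = 1%R.
Proof. rewrite Cmod_R. destruct Hsg as [-> | ->]; [apply Rabs_R1 | rewrite Rabs_left; lra]. Qed.

Lemma Cmod_x t : (-1 / 2 < t)%R -> Cmod (x t) = (Cmod lam / Cmod (W t))%R.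
Proof.
  intros Ht. unfold x. rewrite !Cmod_mult, Cmod_inv, Cmod_Ci, Cmod_sg by (apply W_neq0; auto).
  unfold Rdiv. ring.
Qed.

Lemma hx_small t : (-1 / 2 < t)%R -> (Cmod (h * x t) < V)%R.
Proof.
  intros Ht. rewrite Cmod_mult, Cmod_x by auto. assert (B := Cmod_W t Ht).
  eapply Rle_lt_trans; [|apply Hh2]. apply Rmult_le_compat_l; [apply Cmod_ge_0|].
  apply Rle_div_l; [lra|]. assert (Q := Cmod_ge_0 lam). nra.
Qed.

Lemma cderiv_W t : cderiv W t (dW t).
Proof.
  apply (cderiv_eq _ _ (0 + RtoC (T0 * exp t) + (1 * (Ci * RtoC (sg * beta)) + RtoC t * 0))).
  { unfold dW. ring. }
  apply cderiv_plus; [apply cderiv_plus|].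
  - apply cderiv_const.
  - apply (is_derive_cderiv (fun s => T0 * exp s)%R (fun _ => 0%R) t (T0 * exp t)%R 0%R);
    auto_derive; auto. ring.
  - apply (cderiv_mult RtoC (fun _ => Ci * RtoC (sg * beta))); [apply cderiv_RtoC | apply cderiv_const].
Qed.

Lemma kap_x t : (-1 / 2 < t)%R -> kap t * x t = - (dW t / W t).
Proof.
  intros Ht. assert (HW := W_neq0 t Ht). unfold kap, x.
  transitivity (RtoC sg * RtoC sg * (Ci * Ci) * (dW t / W t)); [field; auto|].
  rewrite (sign_sq sg Hsg). replace (Ci * Ci) with (- (1)) by (apply injective_projections; simpl; ring). ring.
Qed.

Lemma cderiv_x t : (-1 / 2 < t)%R -> cderiv x t (kap t * (x t * x t)).
Proof.
  intros Ht. assert (HW := W_neq0 t Ht).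
  eapply cderiv_eq; [|exact (cderiv_scal (Ci * lam * RtoC sg) _ _ _ (cderiv_inv W t _ HW (cderiv_W t)))].
  rewrite Cmult_assoc, kap_x by auto. unfold x. field. auto.
Qed.

Lemma cderiv_kap t : exists l, cderiv kap t l.
Proof.
  eexists. apply (cderiv_scal (Ci * RtoC sg * / lam) dW). apply cderiv_plus; [|apply cderiv_const].
  apply (is_derive_cderiv (fun s => T0 * exp s)%R (fun _ => 0%R) t (T0 * exp t)%R 0%R);
  auto_derive; auto. ring.
Qed.

Lemma cderiv_cf_hx t : (-1 / 2 < t)%R -> exists l, cderiv (fun t => cf (h * x t)) t l.
Proof.
  intros Ht. apply (Hcfd _ _ (h * (kap t * (x t * x t)))); [|apply hx_small; auto].
  apply cderiv_scal, cderiv_x. auto.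
Qed.

Lemma cderiv_g1 t : (-1 / 2 < t)%R -> exists l, cderiv g1 t l.
Proof.
  intros Ht. destruct (cderiv_kap t) as [l1 H1], (cderiv_cf_hx t Ht) as [l2 H2].
  eexists. apply cderiv_mult; [exact H1|]. apply cderiv_plus; [apply cderiv_plus|].
  - apply cderiv_const.
  - apply cderiv_scal, cderiv_x. auto.
  - apply (cderiv_ext (fun s => - (1) * cf (h * x s))); [intros; ring|]. apply cderiv_scal. exact H2.
Qed.

Lemma cderiv_g2 t : (-1 / 2 < t)%R -> exists l, cderiv g2 t l.
Proof.
  intros Ht. destruct (cderiv_kap t) as [l1 H1], (cderiv_cf_hx t Ht) as [l2 H2].
  eexists. apply cderiv_mult; [exact H1|]. apply cderiv_plus; [apply cderiv_plus|].
  - apply cderiv_const.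
  - apply cderiv_scal, cderiv_x. auto.
  - exact H2.
Qed.

(** [W] differs from its derivative only by W0 - T0 and a term affine in t, both dominated by e^t,
    while |W| is at least (T0 - 1) e^t. *)
Lemma dW_over_W t : (0 <= t)%R -> (Cmod (dW t / W t - 1) * (T0 - 1) <= 1 + Rabs beta)%R.
Proof.
  intros Ht. assert (HW := W_neq0 t ltac:(lra)).
  assert (E1 := exp_ineq1_le t). assert (Hb := Rabs_pos beta).
  replace (dW t / W t - 1) with ((dW t - W t) / W t) by (field; auto).
  assert (N : (Cmod (dW t - W t) <= (1 + Rabs beta) * exp t)%R).
  { replace (dW t - W t) with (- (W0 - RtoC T0) + Ci * RtoC (sg * beta * (1 - t)))
      by (unfold dW, W; rewrite !RtoC_mult, RtoC_minus; ring).
    eapply Rle_trans; [apply Cmod_triangle|]. rewrite Cmod_opp, Cmod_mult, Cmod_Ci, Cmod_R, !Rabs_mult.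
    replace (Rabs sg) with 1%R by (rewrite <- Cmod_R; symmetry; apply Cmod_sg).
    assert (Ht1 : (Rabs (1 - t) <= exp t)%R) by (apply Rabs_le; lra).
    assert (Rabs beta * Rabs (1 - t) <= Rabs beta * exp t)%R by (apply Rmult_le_compat_l; auto). lra. }
  assert (D : ((T0 - 1) * exp t <= Cmod (W t))%R).
  { assert (B := re_W t). assert (B' := Cmod_ge_re (W t)). lra. }
  rewrite Cmod_div by auto.
  assert (PW : (0 < Cmod (W t))%R) by (apply Cmod_gt_0; auto).
  assert (Pe := exp_pos t).
  apply (Rmult_le_reg_r (Cmod (W t))); auto.
  replace (Cmod (dW t - W t) / Cmod (W t) * (T0 - 1) * Cmod (W t))%R
    with (Cmod (dW t - W t) * (T0 - 1))%R by (field; lra).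
  apply Rle_trans with ((1 + Rabs beta) * exp t * (T0 - 1))%R; [apply Rmult_le_compat_r; lra|].
  apply Rle_trans with ((1 + Rabs beta) * ((T0 - 1) * exp t))%R; [lra|].
  apply Rmult_le_compat_l; lra.
Qed.

(** [kap] grows like e^t, but c vanishes at 0, so c(h x) is of order x, and [kap x = - dW/W] is
    bounded by 2. *)
Lemma kap_cf t : (0 <= t)%R -> (Cmod (kap t * cf (h * x t)) <= / 8)%R.
Proof.
  intros Ht. rewrite Cmod_mult.
  assert (B := Hcf _ (hx_small t ltac:(lra))). rewrite Cmod_mult in B.
  assert (D := dW_over_W t Ht).
  assert (Q : (Cmod (dW t / W t) <= 2)%R).
  { assert (T := Cmod_triangle (dW t / W t - 1) 1).
    replace (dW t / W t - 1 + 1) with (dW t / W t) in T by ring. rewrite Cmod_1 in T.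
    assert (P := Cmod_ge_0 (dW t / W t - 1)).
    assert (Cmod (dW t / W t - 1) <= 1)%R by nra. lra. }
  assert (E : (Cmod (kap t) * Cmod (x t) = Cmod (dW t / W t))%R)
    by (rewrite <- Cmod_mult, kap_x, Cmod_opp by lra; auto).
  assert (P1 := Cmod_ge_0 (kap t)). assert (P2 := Cmod_ge_0 h).
  apply Rle_trans with (Cmod (kap t) * (K * (Cmod h * Cmod (x t))))%R; [apply Rmult_le_compat_l; auto|].
  replace (Cmod (kap t) * (K * (Cmod h * Cmod (x t))))%R with (K * Cmod h * (Cmod (kap t) * Cmod (x t)))%R by ring.
  rewrite E. assert (0 <= K * Cmod h)%R by (apply Rmult_le_pos; auto). nra.
Qed.

(** The growing part of lam kap = i sg dW is purely imaginary; only the drift in [W] has a real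
    contribution. *)
Lemma lam_kap t : fst (lam * kap t) = (- beta)%R.
Proof.
  replace (lam * kap t) with (Ci * RtoC sg * dW t) by (unfold kap; field; auto).
  unfold dW. simpl. destruct Hsg as [-> | ->]; ring.
Qed.

Lemma remainder_bound a t : (Cmod a <= Cmod a1 + Cmod a2)%R -> (0 <= t)%R ->
  (Cmod (a * (dW t / W t - 1)) <= / 8)%R.
Proof.
  intros Hb Ht. rewrite Cmod_mult. assert (D := dW_over_W t Ht).
  assert (P := Cmod_ge_0 (dW t / W t - 1)). assert (Pa := Cmod_ge_0 a). assert (Hbeta := Rabs_pos beta).
  apply (Rmult_le_reg_r (T0 - 1)); [lra|].
  apply Rle_trans with (Cmod a * (1 + Rabs beta))%R; [rewrite Rmult_assoc; apply Rmult_le_compat_l; auto|].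
  apply Rle_trans with ((Cmod a1 + Cmod a2) * (1 + Rabs beta))%R; [apply Rmult_le_compat_r; lra | lra].
Qed.

(** The drift contributes [beta] and the power of x contributes -Re a1, in all -1/2; the two errors
    are at most 1/8 each. *)
Lemma re_g1 t : (0 <= t)%R -> (fst (g1 t) <= - / 4)%R.
Proof.
  intros Ht.
  assert (E : g1 t = - (lam * kap t) - a1 - a1 * (dW t / W t - 1) - kap t * cf (h * x t)).
  { unfold g1. transitivity (- (lam * kap t) + a1 * (kap t * x t) - kap t * cf (h * x t)); [ring|].
    rewrite kap_x by lra. ring. }
  assert (B1 := remainder_bound a1 t ltac:(assert (Q := Cmod_ge_0 a2); lra) Ht). assert (B2 := kap_cf t Ht).
  assert (B3 := lam_kap t).
  assert (R1 := Re_le_Cmod (a1 * (dW t / W t - 1))). assert (R2 := Re_le_Cmod (kap t * cf (h * x t))).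
  apply Rabs_le_between in R1. apply Rabs_le_between in R2.
  rewrite E.
  replace (fst (- (lam * kap t) - a1 - a1 * (dW t / W t - 1) - kap t * cf (h * x t)))
    with (- fst (lam * kap t)%C - fst a1 - fst (a1 * (dW t / W t - 1))%C - fst (kap t * cf (h * x t))%C)%R by (simpl; ring).
  unfold beta in B3. lra.
Qed.

Lemma re_g2 t : (0 <= t)%R -> (fst (g2 t) <= - / 4)%R.
Proof.
  intros Ht.
  assert (E : g2 t = lam * kap t - a2 - a2 * (dW t / W t - 1) + kap t * cf (h * x t)).
  { unfold g2. transitivity (lam * kap t + a2 * (kap t * x t) + kap t * cf (h * x t)); [ring|].
    rewrite kap_x by lra. ring. }
  assert (B1 := remainder_bound a2 t ltac:(assert (Q := Cmod_ge_0 a1); lra) Ht). assert (B2 := kap_cf t Ht).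
  assert (B3 := lam_kap t).
  assert (R1 := Re_le_Cmod (a2 * (dW t / W t - 1))). assert (R2 := Re_le_Cmod (kap t * cf (h * x t))).
  apply Rabs_le_between in R1. apply Rabs_le_between in R2.
  assert (Hr : (fst a1 + fst a2 = 1)%R) by (apply (f_equal fst) in Ha; exact Ha).
  rewrite E.
  replace (fst (lam * kap t - a2 - a2 * (dW t / W t - 1) + kap t * cf (h * x t)))
    with (fst (lam * kap t)%C - fst a2 - fst (a2 * (dW t / W t - 1))%C + fst (kap t * cf (h * x t))%C)%R by (simpl; ring).
  unfold beta in B3. lra.
Qed.

Lemma cderiv_y1 t : (-1 / 2 < t)%R -> cderiv y1 t (g1 t * y1 t).
Proof.
  intros Ht. apply (cderiv_eq _ _ (y10 * (g1 t * exp_integral g1 t))); [unfold y1; ring|].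
  apply cderiv_scal, (cderiv_exp_integral g1 (-1 / 2)); [lra | auto | apply cderiv_g1].
Qed.

Lemma cderiv_y2 t : (-1 / 2 < t)%R -> cderiv y2 t (g2 t * y2 t).
Proof.
  intros Ht. apply (cderiv_eq _ _ (y20 * (g2 t * exp_integral g2 t))); [unfold y2; ring|].
  apply cderiv_scal, (cderiv_exp_integral g2 (-1 / 2)); [lra | auto | apply cderiv_g2].
Qed.

(** Adding the two equations cancels [lam] and c and leaves g1 + g2 = kap x = - dW/W by
    [a1 + a2 = 1], so that y1 y2 W is constant. *)
Lemma y1_y2 t : (0 <= t)%R -> y1 t * y2 t = h * x t.
Proof.
  intros Ht. set (P := fun t => y1 t * y2 t * (- Ci * RtoC sg * / lam * W t)).
  assert (HP : forall s, (0 <= s)%R -> cderiv P s 0).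
  { intros s Hs. assert (Hs' : (-1 / 2 < s)%R) by lra.
    assert (D := cderiv_mult _ _ _ _ _ (cderiv_mult _ _ _ _ _ (cderiv_y1 s Hs') (cderiv_y2 s Hs'))
      (cderiv_scal (- Ci * RtoC sg * / lam) _ _ _ (cderiv_W s))).
    eapply cderiv_eq; [|exact D].
    assert (Eg : g1 s + g2 s = - (dW s / W s)).
    { transitivity ((a1 + a2) * (kap s * x s)); [unfold g1, g2; ring|]. rewrite Ha, kap_x by auto. ring. }
    transitivity (y1 s * y2 s * (- Ci * RtoC sg * / lam) * ((g1 s + g2 s) * W s + dW s)); [ring|].
    rewrite Eg. field. split; auto. apply W_neq0. auto. }
  assert (E : P t = P 0%R).
  { apply (cderiv_zero_const P 0 t); auto. intros s Hs. apply HP. lra. exists 0. apply HP. lra. }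
  assert (E0 : P 0%R = h).
  { unfold P, y1, y2, h, W. rewrite !exp_integral_zero, exp_0, Rmult_1_r.
    unfold Cdiv. replace (RtoC 0) with (0 * 0)%C at 1 by ring. ring. }
  rewrite <- E0, <- E. unfold P, x. assert (HW := W_neq0 t ltac:(lra)).
  transitivity (y1 t * y2 t * (RtoC sg * RtoC sg) * - (Ci * Ci)); [|field; auto].
  rewrite (sign_sq sg Hsg). replace (Ci * Ci) with (- (1)) by (apply injective_projections; simpl; ring). ring.
Qed.

Lemma trajectory : exists x y1 y2 kap : R -> C,
  x 0%R = Ci * lam * RtoC sg / W0 /\ y1 0%R = y10 /\ y2 0%R = y20 /\
  forall t, (0 <= t)%R ->
    cderiv x t (kap t * (x t * x t)) /\
    cderiv y1 t (kap t * ((- lam + a1 * x t - cf (y1 t * y2 t)) * y1 t)) /\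
    cderiv y2 t (kap t * ((lam + a2 * x t + cf (y1 t * y2 t)) * y2 t)) /\
    (Cmod (y1 t * y2 t) < V)%R /\
    (Cmod (y1 t) <= Cmod y10 * exp (- / 4 * t))%R /\ (Cmod (y2 t) <= Cmod y20 * exp (- / 4 * t))%R /\
    exists Wt : C, (T0 * exp t - 1 <= fst Wt)%R /\ x t = Ci * lam * RtoC sg / Wt.
Proof.
  exists x, y1, y2, kap.
  split. { unfold x, W. rewrite exp_0, Rmult_1_r. unfold Cdiv. f_equal. f_equal. ring. }
  split. { unfold y1. rewrite exp_integral_zero. ring. }
  split. { unfold y2. rewrite exp_integral_zero. ring. }
  intros t Ht. assert (Ht' : (-1 / 2 < t)%R) by lra. rewrite y1_y2 by auto.
  split; [apply cderiv_x; auto|].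
  split. { eapply cderiv_eq; [|apply cderiv_y1; auto]. unfold g1. ring. }
  split. { eapply cderiv_eq; [|apply cderiv_y2; auto]. unfold g2. ring. }
  split; [apply hx_small; auto|].
  split. { unfold y1. rewrite Cmod_mult. apply Rmult_le_compat_l; [apply Cmod_ge_0|].
    apply (Cmod_exp_integral g1 (-1 / 2)); [lra | auto | apply cderiv_g1 | apply re_g1]. }
  split. { unfold y2. rewrite Cmod_mult. apply Rmult_le_compat_l; [apply Cmod_ge_0|].
    apply (Cmod_exp_integral g2 (-1 / 2)); [lra | auto | apply cderiv_g2 | apply re_g2]. }
  exists (W t). split; [apply re_W | reflexivity].
Qed.

End Trajectory.

(** * Evaluation of the normal form and geometry of the sectors *)

(** Dividing a series by a variable costs a factor 1/r but no radius. *)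
Lemma abs_summable_unshift f g v r : (0 < r)%R ->
  (forall a, (Cmod (cf g a) <= Cmod (cf f (iadd a (unit_idx v))))%R) ->
  abs_summable f r -> abs_summable g r.
Proof.
  intros Hr Hle H. apply abs_summable_iff in H. destruct H as [M H].
  apply abs_summable_iff. exists (/ r * M)%R. intros n.
  set (w := fun b => (Cmod (cf f b) * r ^ deg b)%R).
  apply Rle_trans with (/ r * rsum_list (map (fun a => iadd a (unit_idx v)) (cube n)) w)%R.
  - rewrite rsum_list_map, <- rsum_list_scal. apply rsum_list_le. intros a _. unfold w.
    assert (Hdeg : deg (iadd a (unit_idx v)) = S (deg a)) by (destruct a as [[i j] k], v; simpl; lia).
    rewrite Hdeg. simpl.
    replace (/ r * (Cmod (cf f (iadd a (unit_idx v))) * (r * r ^ deg a)))%R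
      with (Cmod (cf f (iadd a (unit_idx v))) * r ^ deg a)%R by (field; lra).
    apply Rmult_le_compat_r; auto. apply pow_le. lra.
  - apply Rmult_le_compat_l; [left; apply Rinv_0_lt_compat; auto|].
    eapply Rle_trans; [|apply (H (S n))].
    apply rsum_list_incl.
    + apply FinFun.Injective_map_NoDup; [|apply nodup_cube].
      intros [[i j] k] [[i' j'] k']. destruct v; simpl; intros E; injection E; intros;
      f_equal; [f_equal| | f_equal| |f_equal|]; lia.
    + intros b Hb. apply in_map_iff in Hb. destruct Hb as ([[i j] k] & <- & Hb).
      apply in_cube in Hb. destruct v; cbn [iadd unit_idx]; apply in_cube; lia.
    + intros b. apply Rmult_le_pos; [apply Cmod_ge_0 | apply pow_le; lra].
Qed.

(** The series c(y1 y2) inherits its convergence from the normal form: up to sign its coefficients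
    are among those of the y1 component, except the constant one, which is hidden by [- lam] and
    equals 0. *)
Lemma abs_summable_fresonant lam a1 a2 (c : nat -> C) r : (0 < r)%R -> c 0%nat = RtoC 0 ->
  abs_summable (Ynorm lam a1 a2 c cy1) r -> abs_summable (fresonant c) r.
Proof.
  intros Hr Hc. apply (abs_summable_unshift _ _ cy1); auto.
  intros [[i j] k]. unfold cf, iadd, unit_idx. rewrite Ynorm_coef1.
  replace (1 <=? j + 1)%nat with true by (symmetry; apply Nat.leb_le; lia).
  replace (j + 1 - 1)%nat with j by lia. rewrite !Nat.add_0_r.
  unfold fadd, fopp. rewrite fmul_fcst. unfold fresonant.
  destruct (Nat.eqb_spec i 0) as [->|]; cbn [andb]; [|rewrite Cmod_0; apply Cmod_ge_0].
  destruct (Nat.eqb_spec j k) as [<-|]; [|rewrite Cmod_0; apply Cmod_ge_0].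
  destruct j as [|j].
  - rewrite Hc, Cmod_0. apply Cmod_ge_0.
  - unfold fcst. cbn [Nat.add Nat.eqb fvar]. rewrite <- Cmod_opp. right. f_equal. ring.
Qed.

(* [c(v)], read off as the value of [c(y1 y2)] at [y1 = v / s], [y2 = s]. *)
Definition resonant_fun (c : nat -> C) (s : R) (v : C) : C :=
  psum (fresonant c) (RtoC 0, v / RtoC s, RtoC s).

Lemma psum_fresonant c s q : (0 < s)%R ->
  psum (fresonant c) q = resonant_fun c s (co q cy1 * co q cy2).
Proof.
  intros Hs. assert (Hs' : RtoC s <> 0) by (intros E; apply RtoC_inj in E; lra).
  unfold resonant_fun. rewrite !psum_total. apply total_ext.
  intros [[i j] k]. unfold pterm, cf, fresonant.
  destruct (Nat.eqb_spec i 0) as [->|]; cbn [andb]; [|ring].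
  destruct (Nat.eqb_spec j k) as [<-|]; [|ring].
  f_equal. unfold mono. simpl co. cbn [Cpow].
  rewrite <- !Cmult_assoc, <- !Cpow_mult_l, !Cmult_1_l.
  f_equal. field. auto.
Qed.

Section Resonant.

Variables (lam a1 a2 : C) (c : nat -> C) (r : R).
Hypothesis Hr : (0 < r)%R.
Hypothesis Hc : c 0%nat = RtoC 0.
Hypothesis HZ : abs_summable (Ynorm lam a1 a2 c cy1) r.

(** Half the radius of convergence: when |v| <= s^2, the point (0, v/s, s) has norm at most s. *)
Let s : R := (r / 2)%R.

Lemma resonant_point_norm v : (Cmod v <= s * s)%R ->
  (norm3 (RtoC 0, (v / RtoC s)%C, RtoC s) <= s)%R.
Proof.
  intros Hv. assert (Hs : (0 < s)%R) by (unfold s; lra).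
  assert (Hs' : RtoC s <> 0) by (intros E; apply RtoC_inj in E; lra).
  apply norm3_le. intros []; cbn [co fst snd].
  - rewrite Cmod_0. lra.
  - rewrite Cmod_div, Cmod_R, Rabs_pos_eq by (auto; lra). apply Rle_div_l; auto.
  - rewrite Cmod_R, Rabs_pos_eq; lra.
Qed.

(** As c(0) = 0, a factor |v| comes out of every term; the remaining |v|^j <= s^(2j) compares the
    series with its value at (0, s, s). *)
Lemma resonant_fun_bound : exists K, (0 <= K)%R /\
  forall v, (Cmod v < s * s)%R -> (Cmod (resonant_fun c s v) <= K * Cmod v)%R.
Proof.
  assert (Hs : (0 < s)%R) by (unfold s; lra).
  assert (Hs' : RtoC s <> 0) by (intros E; apply RtoC_inj in E; lra).
  assert (Hss : (0 < s * s)%R) by (apply Rmult_lt_0_compat; auto).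
  assert (HS := abs_summable_fresonant _ _ _ _ _ Hr Hc HZ).
  set (P := (RtoC 0, RtoC s, RtoC s)).
  destruct (abs_summable_at _ _ P HS) as [M HM].
  { apply Rle_trans with s; [|unfold s; lra]. apply norm3_le.
    intros []; cbn [co fst snd P]; rewrite ?Cmod_0, ?Cmod_R, ?Rabs_pos_eq; lra. }
  assert (HM0 := summable_by_nonneg _ _ HM).
  exists (M / (s * s))%R. split; [apply Rdiv_le_0_compat; auto|]. intros v Hv.
  unfold resonant_fun. rewrite psum_total.
  assert (Hk : (0 <= Cmod v / (s * s))%R) by (apply Rdiv_le_0_compat; auto; apply Cmod_ge_0).
  assert (Sv : summable_by (pterm (fresonant c) (RtoC 0, v / RtoC s, RtoC s)) (Cmod v / (s * s) * M)).
  { apply summable_by_bound with (v := pterm (fresonant c) P); auto.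
    intros [[i j] k]. unfold pterm, cf, fresonant.
    destruct (Nat.eqb_spec i 0) as [->|]; cbn [andb].
    2: { rewrite !Cmult_0_l, Cmod_0. lra. }
    destruct (Nat.eqb_spec j k) as [<-|].
    2: { rewrite !Cmult_0_l, Cmod_0. lra. }
    destruct j as [|j].
    { rewrite Hc, !Cmult_0_l, Cmod_0. lra. }
    unfold mono, P. cbn [co fst snd]. rewrite !Cmod_mult, !Cmod_pow, Cmod_div, !Cmod_R, Rabs_R0, !(Rabs_pos_eq s) by (auto; lra).
    replace ((Cmod v / s) ^ S j)%R with (Cmod v ^ S j / s ^ S j)%R
      by (unfold Rdiv; rewrite Rpow_mult_distr, pow_inv; auto).
    assert (Hp : (0 < s ^ S j)%R) by (apply pow_lt; auto).
    assert (Hvj : (Cmod v ^ j <= (s * s) ^ j)%R) by (apply pow_incr; split; [apply Cmod_ge_0 | lra]).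
    assert (Pc := Cmod_ge_0 (c (S j))). assert (Pv := Cmod_ge_0 v).
    replace (Cmod (c (S j)) * (0 ^ 0 * (Cmod v ^ S j / s ^ S j) * s ^ S j))%R
      with (Cmod (c (S j)) * (Cmod v * Cmod v ^ j))%R by (simpl in *; field; split; [|lra]; intros E; rewrite E in Hp; lra).
    replace (Cmod v / (s * s) * (Cmod (c (S j)) * (0 ^ 0 * s ^ S j * s ^ S j)))%R
      with (Cmod (c (S j)) * (Cmod v * (s * s) ^ j))%R by (simpl; rewrite Rpow_mult_distr; field; lra).
        apply Rmult_le_compat_l; [exact Pc|]. apply Rmult_le_compat_l; [exact Pv | exact Hvj]. }
  eapply Rle_trans; [apply (summable_total _ _ Sv)|]. right. field. lra.
Qed.

Lemma resonant_fun_cderiv (v : R -> C) t l : cderiv v t l -> (Cmod (v t) < s * s)%R ->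
  exists l', cderiv (fun t => resonant_fun c s (v t)) t l'.
Proof.
  intros Hv Hs. assert (HS := abs_summable_fresonant _ _ _ _ _ Hr Hc HZ).
  assert (Hn : (norm3 (RtoC 0, (v t / RtoC s)%C, RtoC s) < r)%R).
  { eapply Rle_lt_trans; [apply resonant_point_norm; lra | unfold s; lra]. }
  assert (F := frechet_psum _ _ _ HS Hn). eexists.
  apply (cderiv_comp (psum (fresonant c)) (fun t => (RtoC 0, v t / RtoC s, RtoC s)) t _
    (fun i => match i with cy1 => l * / RtoC s + v t * 0 | _ => 0 end) F).
  intros []; [exact (cderiv_const 0 t) | | exact (cderiv_const (RtoC s) t)].
  apply (cderiv_mult v (fun _ => / RtoC s)); [auto | apply cderiv_const].
Qed.

Lemma psum_Ynorm q : (norm3 q < r)%R ->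
  psum (Ynorm lam a1 a2 c cy1) q
    = (- lam + a1 * co q cx - resonant_fun c s (co q cy1 * co q cy2)) * co q cy1 /\
  psum (Ynorm lam a1 a2 c cy2) q
    = (lam + a2 * co q cx + resonant_fun c s (co q cy1 * co q cy2)) * co q cy2.
Proof.
  intros Hq. assert (Hs : (0 < s)%R) by (unfold s; lra).
  assert (HS := abs_summable_fresonant _ _ _ _ _ Hr Hc HZ).
  assert (Hr0 : (0 <= r)%R) by lra.
  assert (At : forall f, abs_summable f r -> exists M, summable_by (pterm f q) M).
  { intros f Hf. apply (abs_summable_at f r); auto. lra. }
  assert (Lin : forall k a, abs_summable (fadd (fcst k) (fmul (fcst a) (fvar cx))) r).
  { intros k a. apply abs_summable_fadd; auto; [apply abs_summable_fcst; auto|].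
    apply abs_summable_fmul; auto; [apply abs_summable_fcst | apply abs_summable_fvar]; auto. }
  assert (PLin : forall k a, psum (fadd (fcst k) (fmul (fcst a) (fvar cx))) q = k + a * co q cx).
  { intros k a. destruct (psum_fcst k q) as [E1 [M1 H1]], (psum_fcst a q) as [E2 [M2 H2]], (psum_fvar cx q) as [E3 [M3 H3]].
    destruct (At (fmul (fcst a) (fvar cx))) as [M4 H4].
    { apply abs_summable_fmul; auto; [apply abs_summable_fcst | apply abs_summable_fvar]; auto. }
    rewrite (psum_fadd _ _ _ _ _ H1 H4), (psum_fmul _ _ _ _ _ H2 H3), E1, E2, E3. auto. }
  destruct (At _ HS) as [M HM]. rewrite <- psum_fresonant by auto.
  destruct (psum_fvar cy1 q) as [E1 [N1 H1]], (psum_fvar cy2 q) as [E2 [N2 H2]].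
  split; unfold Ynorm.
  - destruct (At _ (abs_summable_fopp _ _ Hr0 HS)) as [M' HM'].
    destruct (At _ (Lin (- lam) a1)) as [ML HL].
    destruct (At _ (abs_summable_fadd _ _ _ Hr0 (Lin (- lam) a1) (abs_summable_fopp _ _ Hr0 HS))) as [MA HA].
    rewrite (psum_fmul _ _ _ _ _ HA H1), (psum_fadd _ _ _ _ _ HL HM'), PLin, (psum_fopp _ _ _ HM), E1. ring.
  - destruct (At _ (Lin lam a2)) as [ML HL].
    destruct (At _ (abs_summable_fadd _ _ _ Hr0 (Lin lam a2) HS)) as [MA HA].
    rewrite (psum_fmul _ _ _ _ _ HA H2), (psum_fadd _ _ _ _ _ HL HM), PLin, E2. ring.
Qed.

End Resonant.

(** * Sectors *)

Lemma unit_circle_arg (u v : R) : (u * u + v * v = 1)%R -> (-1 < u)%R ->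
  exists t, (Rabs t = acos u)%R /\ cos t = u /\ sin t = v.
Proof.
  intros H Hu. assert (Hu1 : (-1 <= u <= 1)%R) by nra.
  assert (Hb := acos_bound u).
  assert (Es : sin (acos u) = Rabs v).
  { rewrite sin_acos by auto. unfold Rsqr. replace (1 - u * u)%R with (Rsqr v) by (unfold Rsqr; lra). apply sqrt_Rsqr_abs. }
  destruct (Rle_dec 0 v) as [Hv|Hv].
  - exists (acos u). rewrite Rabs_pos_eq, cos_acos, Es, Rabs_pos_eq by lra. auto.
  - exists (- acos u)%R. rewrite Rabs_Ropp, Rabs_pos_eq, cos_neg, sin_neg, cos_acos, Es, Rabs_left by lra.
    repeat split; auto. ring.
Qed.

(** |arg z| < pi/2 + eps means cos(arg z) > - sin eps. Multiplied by |z|, this becomes Re z + sin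
    eps |z| > 0, which contains z <> 0 and can be handled without arguments of complex numbers. *)
Lemma sector_iff (sg : R) (lam : C) r eps x : lam <> 0 -> (sg = 1 \/ sg = -1)%R -> (0 < eps < PI / 2)%R ->
  sector (RtoC sg) lam r eps x <->
  (Cmod x < r)%R /\
  (0 < fst (RtoC sg * x / (Ci * lam))%C + sin eps * Cmod (RtoC sg * x / (Ci * lam))%C)%R.
Proof.
  intros Hlam Hsg Heps. unfold sector. cbv zeta. set (z := RtoC sg * x / (Ci * lam)).
  assert (Hi : Ci <> 0) by (intros E; apply (f_equal snd) in E; simpl in E; lra).
  assert (Hs : RtoC sg <> 0) by (intros E; apply RtoC_inj in E; lra).
  assert (Hse : (0 < sin eps < 1)%R).
  { assert (HPI := PI_RGT_0). split; [apply sin_gt_0; lra|].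
    rewrite <- sin_PI2. apply sin_increasing_1; lra. }
  assert (HPI := PI_RGT_0).
  assert (Ecos : cos (PI / 2 + eps) = (- sin eps)%R) by (rewrite cos_plus, cos_PI2, sin_PI2; ring).
  assert (Hz : x <> 0 <-> z <> 0).
  { unfold z. split; intros H E; apply H.
    - replace x with (RtoC sg * x / (Ci * lam) * (Ci * lam) / RtoC sg) by (field; auto).
      rewrite E. field. auto.
    - rewrite E. field. auto. }
  clearbody z.
  split.
  - intros (Hx & Hr & t & Ht & E). split; auto.
    assert (Pz : (0 < Cmod z)%R) by (apply Cmod_gt_0, Hz; auto).
    assert (Ef : fst z = (Cmod z * cos t)%R) by (rewrite E at 1; simpl; ring).
    assert (Hc : (- sin eps < cos t)%R).
    { rewrite <- Ecos. replace (cos t) with (cos (Rabs t)).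
      - apply cos_decreasing_1; try lra. apply Rabs_pos.
      - unfold Rabs. destruct (Rcase_abs t); [apply cos_neg | auto]. }
    rewrite Ef. nra.
  - intros (Hr & H).
    assert (Hx : z <> 0).
    { intros E. rewrite E, Cmod_0 in H. simpl in H. lra. }
    split; [apply Hz; auto|]. split; auto.
    assert (Pz : (0 < Cmod z)%R) by (apply Cmod_gt_0; auto).
    assert (N2 : (fst z * fst z + snd z * snd z = Cmod z * Cmod z)%R).
    { assert (Q := Cmod2_alt z). unfold Re, Im in Q. simpl in Q. lra. }
    assert (Hc : (- sin eps < fst z / Cmod z)%R).
    { apply (Rmult_lt_reg_r (Cmod z)); auto. replace (fst z / Cmod z * Cmod z)%R with (fst z) by (field; lra). lra. }
    destruct (unit_circle_arg (fst z / Cmod z) (snd z / Cmod z)) as (t & Ht & Ec & Es).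
    + replace (fst z / Cmod z * (fst z / Cmod z) + snd z / Cmod z * (snd z / Cmod z))%R
        with ((fst z * fst z + snd z * snd z) / (Cmod z * Cmod z))%R by (field; lra).
      rewrite N2. field. lra.
    + lra.
    + exists t. split.
      * apply Rnot_le_lt. intros Hge.
        assert (B : (cos (Rabs t) <= cos (PI / 2 + eps))%R).
        { apply cos_decr_1; try lra; rewrite Ht; apply acos_bound. }
        replace (cos (Rabs t)) with (cos t) in B.
        { rewrite Ec, Ecos in B. lra. }
        unfold Rabs. destruct (Rcase_abs t); [symmetry; apply cos_neg | auto].
      * apply injective_projections; simpl; rewrite ?Ec, ?Es; field; lra.
Qed.

(** In the coordinate [W] the normalized variable sg x / (i lam) is 1/W, and the half-plane Re > 0
    lies in the angle of the sector. *)
Lemma sector_of_flow (sg : R) (lam : C) r eps (W : C) : lam <> 0 -> (sg = 1 \/ sg = -1)%R -> (0 < eps < PI / 2)%R ->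
  (0 < fst W)%R -> (Cmod (Ci * lam * RtoC sg / W) < r)%R -> sector (RtoC sg) lam r eps (Ci * lam * RtoC sg / W).
Proof.
  intros Hlam Hsg Heps HW Hr. apply sector_iff; auto. split; auto.
  assert (Hi : Ci <> 0) by (intros E; apply (f_equal snd) in E; simpl in E; lra).
  assert (HW0 : W <> 0) by (intros E; rewrite E in HW; simpl in HW; lra).
  replace (RtoC sg * (Ci * lam * RtoC sg / W) / (Ci * lam)) with (/ W).
  2: { transitivity (RtoC sg * RtoC sg * / W); [rewrite sign_sq by auto; ring | field; auto]. }
  assert (HPI := PI_RGT_0). assert (Hs : (0 < sin eps)%R) by (apply sin_gt_0; lra).
  assert (P : (0 < Cmod (/ W))%R) by (apply Cmod_gt_0; intros E; apply C1_nz; rewrite <- (Cinv_r W HW0), E; ring).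
  assert (F : (0 < fst (/ W)%C)%R).
  { simpl. apply Rdiv_lt_0_compat; auto. simpl. nra. }
  assert (0 < sin eps * Cmod (/ W))%R by (apply Rmult_lt_0_compat; auto). lra.
Qed.

(** The sector is not convex, its opening being larger than pi, but it is star-shaped about the
    points of its bisector, where [x1] lies. In the criterion of [sector_iff], the contribution a of
    [x1] leaves at least a (1 - sin eps) >= 0. *)
Lemma sector_convex_comb (sg : R) (lam : C) r eps x1 x0 t : lam <> 0 -> (sg = 1 \/ sg = -1)%R -> (0 < eps < PI / 2)%R ->
  (exists T : R, (0 < T)%R /\ x1 = Ci * lam * RtoC sg / RtoC T) -> (Cmod x1 < r)%R ->
  sector (RtoC sg) lam r eps x0 -> (0 <= t <= 1)%R ->
  sector (RtoC sg) lam r eps (x1 + RtoC t * (x0 - x1)).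
Proof.
  intros Hlam Hsg Heps (T & HT & E1) H1 H0 Ht. apply sector_iff in H0; auto. destruct H0 as [H0 Hs0].
  apply sector_iff; auto.
  assert (Hi : Ci <> 0) by (intros E; apply (f_equal snd) in E; simpl in E; lra).
  assert (HT' : RtoC T <> 0) by (intros E; apply RtoC_inj in E; lra).
  set (z0 := RtoC sg * x0 / (Ci * lam)) in *.
  assert (Ez : RtoC sg * (x1 + RtoC t * (x0 - x1)) / (Ci * lam) = RtoC ((1 - t) / T) + RtoC t * z0).
  { unfold z0. rewrite E1, RtoC_div, RtoC_minus by lra.
    transitivity (RtoC sg * RtoC sg * ((1 - RtoC t) / RtoC T) + RtoC t * (RtoC sg * x0 / (Ci * lam))); [field; auto|].
    rewrite sign_sq by auto. ring. }
  rewrite Ez. split.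
  - replace (x1 + RtoC t * (x0 - x1)) with (RtoC (1 - t) * x1 + RtoC t * x0) by (rewrite RtoC_minus; ring).
    eapply Rle_lt_trans; [apply Cmod_triangle|]. rewrite !Cmod_mult, !Cmod_R, !Rabs_pos_eq by lra.
    destruct (Req_dec t 0) as [->|]; nra.
  - set (a := ((1 - t) / T)%R). assert (Ha : (0 <= a)%R) by (apply Rdiv_le_0_compat; lra).
    assert (HPI := PI_RGT_0).
    assert (Hs : (0 < sin eps < 1)%R).
    { split; [apply sin_gt_0; lra|]. rewrite <- sin_PI2. apply sin_increasing_1; lra. }
    assert (B : (t * Cmod z0 - a <= Cmod (RtoC a + RtoC t * z0))%R).
    { assert (Q := Cmod_triangle_rev (RtoC t * z0) (- RtoC a)).
      replace (RtoC t * z0 - - RtoC a) with (RtoC a + RtoC t * z0) in Q by ring.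
      rewrite Cmod_opp, Cmod_mult, !Cmod_R, !Rabs_pos_eq in Q by lra. lra. }
    assert (Ef : fst (RtoC a + RtoC t * z0)%C = (a + t * fst z0)%R) by (simpl; ring).
    rewrite Ef. apply (Rmult_le_compat_l (sin eps)) in B; [|lra].
    destruct (Req_dec t 0) as [E|Hne].
    + assert (0 < a)%R by (unfold a; rewrite E; apply Rdiv_lt_0_compat; lra).
      rewrite E in *. nra.
    + assert (0 < t * (fst z0 + sin eps * Cmod z0))%R by (apply Rmult_lt_0_compat; lra).
      assert (0 <= a * (1 - sin eps))%R by (apply Rmult_le_pos; lra). lra.
Qed.

Lemma sector_dom_open_in_y s lam r eps rho : open_in_y (sector_dom s lam r eps rho).
Proof.
  intros p (Hx & H1 & H2).
  exists (Rmin (rho - Cmod (co p cy1)) (rho - Cmod (co p cy2)))%R.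
  assert (G1 := Rmin_l (rho - Cmod (co p cy1)) (rho - Cmod (co p cy2))).
  assert (G2 := Rmin_r (rho - Cmod (co p cy1)) (rho - Cmod (co p cy2))).
  split; [apply Rmin_pos; lra|]. intros v t Hv Ht.
  assert (T := fun y => Cmod_triangle (t - y) y).
  destruct v; [congruence| |]; (split; [exact Hx|]); (split; [|auto]); auto.
  - assert (Q := T (co p cy1)). replace (t - co p cy1 + co p cy1) with t in Q by ring.
    change (co (upd p cy1 t) cy1) with t. lra.
  - assert (Q := T (co p cy2)). replace (t - co p cy2 + co p cy2) with t in Q by ring.
    change (co (upd p cy2 t) cy2) with t. lra.
Qed.

(* Only the component of the pull-back of [omega] on [dy1 /\ dy2] matters modulo [dx]. *)
Lemma symplectic_of_jac_det (U : C3 -> Prop) (Phi : C3 -> C3) :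
  fibered_on U Phi -> (forall i, analytic_on U (fun p => co (Phi p) i)) ->
  (forall p, U p -> co p cx <> 0) -> (forall p, U p -> jac_det Phi p = 1) -> symplectic_on U Phi.
Proof.
  intros Hfib Han Hx HD.
  (* The one-form is the contraction of the pulled-back form with d/dx; [omega] itself has no dx
     component. *)
  exists (fun j => (fun p => / co p cx * (jac Phi cx cy1 p * jac Phi j cy2 p - jac Phi cx cy2 p * jac Phi j cy1 p))
    : analytic_alg U).
  split.
  - intros i p Hp. apply analytic_mult; [apply analytic_inv_x; auto|].
    apply analytic_minus; apply analytic_mult; apply analytic_partial; apply (Han _ p Hp).
  - intros k l p Hp. assert (E := HD p Hp). unfold jac_det in E.
    assert (F := Hfib p Hp).
    unfold pullback2, omega, wedge11, csum, csub. cbn [cadd copp cmul cD cinvx analytic_alg ceq dcoord cone czero].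
    rewrite F.
    assert (J : forall v i, partial v (fun p => co (Phi p) i) p = jac Phi v i p) by reflexivity.
    destruct k, l; cbn [dcoord cone czero analytic_alg]; rewrite ?J.
    all: try ring.
    + match goal with |- ?L = ?R => replace L with (/ co p cx * (jac Phi cy1 cy1 p * jac Phi cy2 cy2 p - jac Phi cy1 cy2 p * jac Phi cy2 cy1 p) - / co p cx) by ring end.
      rewrite E. ring.
    + match goal with |- ?L = ?R => replace L with (- / co p cx * (jac Phi cy1 cy1 p * jac Phi cy2 cy2 p - jac Phi cy1 cy2 p * jac Phi cy2 cy1 p) + / co p cx) by ring end.
      rewrite E. ring.
Qed.

(** * Conclusion *)

(** With e = 4 M d bounding the entries of the Jacobian minus the identity, the determinant deviates
    from 1 by at most 2 e + 2 e^2, which is at most 3 e as e <= 1/8. *)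
Lemma jac_det_near_one (X : C -> Prop) rho (U : C3 -> Prop) (Phi : C3 -> C3) M d p :
  (forall p, U p <-> X (co p cx) /\ (Cmod (co p cy1) < rho)%R /\ (Cmod (co p cy2) < rho)%R) ->
  (forall i p, U p -> analytic_at (fun q => co (Phi q) i) p) ->
  (0 <= M)%R -> (0 < d)%R -> (2 * d <= rho)%R ->
  (forall p, U p -> (norm3 p < 2 * d)%R -> (norm3 (sub3 (Phi p) p) <= M * norm3 p ^ 2)%R) ->
  (32 * M * d <= 1)%R -> U p -> (norm3 p < d)%R ->
  (Cmod (jac_det Phi p - 1) <= 12 * M * d)%R.
Proof.
  intros HU Han HM Hd Hrho Htan HMd Hp Np.
  assert (J := fun v i Hv => jac_near_identity X rho U Phi M d HU Han HM Hd Hrho Htan v i p Hv Hp Np).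
  assert (N1 : cy1 <> cx) by discriminate. assert (N2 : cy2 <> cx) by discriminate.
  assert (J11 := J cy1 cy1 N1). assert (J12 := J cy1 cy2 N1).
  assert (J21 := J cy2 cy1 N2). assert (J22 := J cy2 cy2 N2). unfold kronecker in *.
  set (e := (4 * M * d)%R) in *. assert (He : (0 <= e <= / 8)%R) by (unfold e; split; [repeat apply Rmult_le_pos; lra | lra]).
  replace (jac_det Phi p - 1) with ((jac Phi cy1 cy1 p - 1) + (jac Phi cy2 cy2 p - 1)
    + (jac Phi cy1 cy1 p - 1) * (jac Phi cy2 cy2 p - 1) - (jac Phi cy1 cy2 p - 0) * (jac Phi cy2 cy1 p - 0))
    by (unfold jac_det; ring).
  eapply Rle_trans; [apply Cmod_minus_le|].
  eapply Rle_trans; [apply Rplus_le_compat_r, Cmod_triangle|].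
  eapply Rle_trans; [apply Rplus_le_compat_r, Rplus_le_compat_r, Cmod_triangle|].
  rewrite !Cmod_mult.
  assert (B1 : (Cmod (jac Phi cy1 cy1 p - 1) * Cmod (jac Phi cy2 cy2 p - 1) <= e * e)%R)
    by (apply Rmult_le_compat; auto; apply Cmod_ge_0).
  assert (B2 : (Cmod (jac Phi cy1 cy2 p - 0) * Cmod (jac Phi cy2 cy1 p - 0) <= e * e)%R)
    by (apply Rmult_le_compat; auto; apply Cmod_ge_0).
  replace (12 * M * d)%R with (3 * e)%R by (unfold e; ring). nra.
Qed.

Lemma psum_x_sq Yx p : feq Yx (fmul (fvar cx) (fvar cx)) -> psum Yx p = co p cx * co p cx.
Proof.
  intros H. rewrite (psum_ext _ _ _ H). destruct (psum_fvar cx p) as [E [M HM]].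
  rewrite (psum_fmul _ _ _ _ _ HM HM), E. auto.
Qed.

(** The lift of a trajectory of [Z] is a trajectory of [Y]: the discrepancy between the velocity of
    the lift and kap Y lies in the kernel of the [y]-Jacobian, which is invertible. The determinant,
    a first integral of [Y], is then constant along the lift. *)
Lemma jac_det_constant_along_flow (U : C3 -> Prop) (Phi Psi : C3 -> C3) (Y Z : vfield)
  (G : R -> C3) (kap : R -> C) :
  open_in_y U -> fibered_on U Phi -> (forall i, analytic_on U (fun p => co (Phi p) i)) ->
  conj_on U Phi Y Z ->
  feq (Y cx) (fmul (fvar cx) (fvar cx)) -> feq (Z cx) (fmul (fvar cx) (fvar cx)) ->
  feq (divergence Y) (fvar cx) -> feq (divergence Z) (fvar cx) ->
  (forall p, U p -> Psi (Phi p) = p) ->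
  (forall i, analytic_on (image U Phi) (fun q => co (Psi q) i)) ->
  (forall t, (0 <= t)%R -> image U Phi (G t)) ->
  (forall t, (0 <= t)%R -> forall i, cderiv (fun s => co (G s) i) t (kap t * psum (Z i) (G t))) ->
  (forall t, (0 <= t)%R -> jac_det Phi (Psi (G t)) <> 0) ->
  forall t, (0 <= t)%R -> jac_det Phi (Psi (G t)) = jac_det Phi (Psi (G 0%R)).
Proof.
  intros Hopen Hfib Han Hconj HYx HZx HYd HZd HPsi HPan HG HGd HD T HT.
  set (P := fun t => Psi (G t)).
  assert (HP : forall t, (0 <= t)%R -> U (P t) /\ Phi (P t) = G t).
  { intros t Ht. destruct (HG t Ht) as (p & Hp & E). unfold P. rewrite E, HPsi by auto. auto. }
  set (m := fun t i => partial cx (fun q => co (Psi q) i) (G t) * (kap t * psum (Z cx) (G t))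
    + partial cy1 (fun q => co (Psi q) i) (G t) * (kap t * psum (Z cy1) (G t))
    + partial cy2 (fun q => co (Psi q) i) (G t) * (kap t * psum (Z cy2) (G t))).
  assert (Hm : forall t, (0 <= t)%R -> forall i, cderiv (fun s => co (P s) i) t (m t i)).
  { intros t Ht i. apply (cderiv_comp (fun q => co (Psi q) i) G t (fun v => partial v (fun q => co (Psi q) i) (G t)) (fun i => kap t * psum (Z i) (G t))).
    - apply analytic_frechet, (HPan i (G t)), HG. auto.
    - intros j. apply HGd. auto. }
  assert (AD : forall t, (0 <= t)%R -> frechet (jac_det Phi) (P t) (fun v => partial v (jac_det Phi) (P t))).
  { intros t Ht. apply analytic_frechet, analytic_jac_det. intros i. apply (Han i). apply HP. auto. }
  assert (CD : forall t, (0 <= t)%R -> cderiv (fun s => jac_det Phi (P s)) t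
    (partial cx (jac_det Phi) (P t) * m t cx + partial cy1 (jac_det Phi) (P t) * m t cy1
     + partial cy2 (jac_det Phi) (P t) * m t cy2)).
  { intros t Ht. apply (cderiv_comp (jac_det Phi) P t (fun v => partial v (jac_det Phi) (P t)) (m t)); auto. }
  apply (cderiv_zero_const (fun s => jac_det Phi (P s)) 0 T HT).
  2: { eexists. apply CD. lra. }
  intros t Ht. destruct (HP t ltac:(lra)) as [Ut EP].
  (* For t > 0 a full neighbourhood consists of nonnegative times, where the trajectory is known to
     lie in the image. *)
  assert (Near : forall s, (Rabs (s - t) < t)%R -> (0 <= s)%R).
  { intros s Hs. apply Rabs_def2 in Hs. lra. }
  assert (Ex : m t cx = kap t * psum (Z cx) (G t)).
  { apply (cderiv_unique (fun s => co (P s) cx) t); [apply Hm; lra|].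
    apply (cderiv_ext_loc (fun s => co (G s) cx) _ t _ t); [lra| |apply HGd; lra].
    intros s Hs. destruct (HP s (Near s Hs)) as [Us Es]. rewrite <- Es. apply Hfib. auto. }
  assert (Exy : psum (Z cx) (G t) = psum (Y cx) (P t)).
  { rewrite (psum_x_sq _ _ HZx), (psum_x_sq _ _ HYx), <- EP, Hfib by auto. auto. }
  assert (Ey : forall i, jac Phi cx i (P t) * m t cx + jac Phi cy1 i (P t) * m t cy1 + jac Phi cy2 i (P t) * m t cy2
     = kap t * psum (Z i) (G t)).
  { intros i. apply (cderiv_unique (fun s => co (Phi (P s)) i) t).
    - apply (cderiv_comp (fun q => co (Phi q) i) P t (fun v => jac Phi v i (P t)) (m t)); [|apply Hm; lra].
      apply (analytic_frechet (fun q => co (Phi q) i)). apply (Han i). auto.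
    - apply (cderiv_ext_loc (fun s => co (G s) i) _ t _ t); [lra| |apply HGd; lra].
      intros s Hs. destruct (HP s (Near s Hs)) as [Us Es]. rewrite Es. auto. }
  assert (Hc : forall i, jac Phi cx i (P t) * psum (Y cx) (P t) + jac Phi cy1 i (P t) * psum (Y cy1) (P t)
     + jac Phi cy2 i (P t) * psum (Y cy2) (P t) = psum (Z i) (G t)).
  { intros i. rewrite <- EP. destruct Hconj as (_ & _ & Hc). exact (Hc (P t) Ut i). }
  set (e1 := m t cy1 - kap t * psum (Y cy1) (P t)). set (e2 := m t cy2 - kap t * psum (Y cy2) (P t)).
  assert (Le : forall i, jac Phi cy1 i (P t) * e1 + jac Phi cy2 i (P t) * e2 = 0).
  { intros i. assert (Q1 := Ey i). rewrite <- (Hc i), Ex, Exy in Q1.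
    unfold e1, e2. match type of Q1 with ?l = ?r => transitivity (l - r); [ring | rewrite Q1; ring] end. }
  assert (Dt := HD t ltac:(lra)). fold (P t) in Dt.
  (* Cramer's rule. *)
  assert (Z1 : e1 = 0).
  { transitivity ((jac Phi cy2 cy2 (P t) * (jac Phi cy1 cy1 (P t) * e1 + jac Phi cy2 cy1 (P t) * e2)
      - jac Phi cy2 cy1 (P t) * (jac Phi cy1 cy2 (P t) * e1 + jac Phi cy2 cy2 (P t) * e2)) / jac_det Phi (P t)).
    - unfold jac_det in *. field. auto.
    - rewrite !Le. field. auto. }
  assert (Z2 : e2 = 0).
  { transitivity ((jac Phi cy1 cy1 (P t) * (jac Phi cy1 cy2 (P t) * e1 + jac Phi cy2 cy2 (P t) * e2)
      - jac Phi cy1 cy2 (P t) * (jac Phi cy1 cy1 (P t) * e1 + jac Phi cy2 cy1 (P t) * e2)) / jac_det Phi (P t)).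
    - unfold jac_det in *. field. auto.
    - rewrite !Le. field. auto. }
  eapply cderiv_eq; [|apply CD; lra].
  assert (FI := jac_det_first_integral U Phi Y Z Hopen Hfib Han Hconj HYx HYd HZd (P t) Ut).
  replace (m t cy1) with (e1 + kap t * psum (Y cy1) (P t)) by (unfold e1; ring).
  replace (m t cy2) with (e2 + kap t * psum (Y cy2) (P t)) by (unfold e2; ring).
  rewrite Ex, Exy, Z1, Z2.
  match type of FI with ?L = _ => transitivity (kap t * L); [ring | rewrite FI; ring] end.
Qed.

(** * The determinant on a whole sectorial domain *)

Section Sectorial.

Variables (sg : R) (lam a1 a2 : C) (c : nat -> C) (Y : vfield) (r eps rho : R) (Phi Psi : C3 -> C3).
Hypothesis Hsg : (sg = 1 \/ sg = -1)%R.
Hypothesis Hlam : lam <> 0.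
Hypothesis Ha : a1 + a2 = 1.
Hypothesis Hc : c 0%nat = RtoC 0.
Hypothesis Heps : (0 < eps < PI / 2)%R.
Hypothesis Hr : (0 < r)%R.
Hypothesis Hrho : (0 < rho)%R.
Hypothesis HYx : feq (Y cx) (fmul (fvar cx) (fvar cx)).
Hypothesis HYd : feq (divergence Y) (fvar cx).

Let U : C3 -> Prop := sector_dom (RtoC sg) lam r eps rho.
Let X : C -> Prop := sector (RtoC sg) lam r eps.
Let Z : vfield := Ynorm lam a1 a2 c.

Hypothesis Hfib : fibered_on U Phi.
Hypothesis Han : forall i, analytic_on U (fun p => co (Phi p) i).
Hypothesis HPsi : forall p, U p -> Psi (Phi p) = p.
Hypothesis HPan : forall i, analytic_on (image U Phi) (fun q => co (Psi q) i).
Hypothesis Htan : tangent_id_on U Phi.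
Hypothesis Hconj : conj_on U Phi Y Z.

Lemma sector_dom_iff p : U p <-> X (co p cx) /\ (Cmod (co p cy1) < rho)%R /\ (Cmod (co p cy2) < rho)%R.
Proof. reflexivity. Qed.

Lemma tangency_constants : exists M d, (0 <= M)%R /\ (0 < d)%R /\ (2 * d <= rho)%R /\ (d <= r)%R /\
  (32 * M * d <= 1)%R /\
  forall p, U p -> (norm3 p < 2 * d)%R -> (norm3 (sub3 (Phi p) p) <= M * norm3 p ^ 2)%R.
Proof.
  destruct Htan as (M0 & delta & Hdelta & H). set (M := Rabs M0). assert (HM : (0 <= M)%R) by apply Rabs_pos.
  (* The factors 1/2 are there because tangency and the Cauchy discs are used up to norm [2 * d];
     the last bound gives [32 * M * d <= 1]. *)
  set (d := Rmin (Rmin (delta / 2) (rho / 2)) (Rmin r (/ (32 * (M + 1))))).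
  assert (G1 := Rmin_l (Rmin (delta / 2) (rho / 2)) (Rmin r (/ (32 * (M + 1))))).
  assert (G2 := Rmin_r (Rmin (delta / 2) (rho / 2)) (Rmin r (/ (32 * (M + 1))))).
  assert (G3 := Rmin_l (delta / 2) (rho / 2)). assert (G4 := Rmin_r (delta / 2) (rho / 2)).
  assert (G5 := Rmin_l r (/ (32 * (M + 1)))). assert (G6 := Rmin_r r (/ (32 * (M + 1)))). fold d in G1, G2.
  assert (Hd : (0 < d)%R).
  { repeat apply Rmin_pos; try lra. apply Rinv_0_lt_compat. lra. }
  exists M, d. repeat split; auto; try lra.
  - assert (Q : (d <= / (32 * (M + 1)))%R) by lra.
    apply (Rmult_le_compat_l (32 * (M + 1))) in Q; [|lra]. rewrite Rinv_r in Q by lra. lra.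
  - intros p Hp Np. eapply Rle_trans; [apply H; auto; lra|].
    apply Rmult_le_compat_r; [apply pow_le, norm3_nonneg | apply Rle_abs].
Qed.

(** The base point sits at [y = 0] on the bisector. At distance xi from the origin the map moves
    points by O(xi^2), so nearby images have [y1] and [y2] of size xi^2 and the first integral
    [y1 y2 / x] is as small as the trajectories require. *)
Lemma jac_det_one_on_open_set : exists p1 eta (T : R), (0 < T)%R /\
  p1 = (Ci * lam * RtoC sg / RtoC T, RtoC 0, RtoC 0) /\ U p1 /\ (0 < eta)%R /\
  forall p, (norm3 (sub3 p p1) < eta)%R -> U p -> jac_det Phi p = 1.
Proof.
  destruct tangency_constants as (M & d & HM & Hd & Hdrho & Hdr & HMd & HT).
  assert (HU := sector_dom_iff).
  destruct Hconj as (_ & (rZ & HZ & HrZ) & _).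
  assert (Hanat : forall i p, U p -> analytic_at (fun q => co (Phi q) i) p) by (intros; apply Han; auto).
  assert (Plam : (0 < Cmod lam)%R) by (apply Cmod_gt_0; auto).
  assert (Hi : Ci <> 0) by (intros E; apply (f_equal snd) in E; simpl in E; lra).
  assert (Hs : RtoC sg <> 0) by (intros E; apply RtoC_inj in E; lra).
  assert (Csg : Cmod (RtoC sg) = 1%R) by (rewrite Cmod_R; destruct Hsg as [-> | ->]; [apply Rabs_R1 | rewrite Rabs_left; lra]).
  assert (Cx : forall W : C, W <> 0 -> Cmod (Ci * lam * RtoC sg / W) = (Cmod lam / Cmod W)%R).
  { intros W HW. rewrite Cmod_div, !Cmod_mult, Cmod_Ci, Csg by auto. unfold Rdiv. ring. }
  (* The radius is positive because some point of the domain has its image within it; [T] makes |x|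
     = |lam| / T smaller than [r]. *)
  assert (HrZ0 : (0 < rZ)%R).
  { set (T := (2 * Cmod lam / r + 1)%R).
    assert (HT0 : (0 < T)%R) by (assert (0 <= 2 * Cmod lam / r)%R by (apply Rdiv_le_0_compat; lra); unfold T; lra).
    assert (HTc : RtoC T <> 0) by (intros E; apply RtoC_inj in E; lra).
    set (p := (Ci * lam * RtoC sg / RtoC T, RtoC 0, RtoC 0)).
    assert (Up : U p).
    { apply HU. simpl. rewrite Cmod_0. split; [|lra].
      assert (HTf : (0 < fst (RtoC T))%R) by exact HT0.
      apply sector_of_flow; auto. rewrite Cx by auto.
      rewrite Cmod_R, Rabs_pos_eq by lra. apply Rlt_div_l; auto.
        unfold T. replace (r * (2 * Cmod lam / r + 1))%R with (2 * Cmod lam + r)%R by (field; lra). lra. }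
    eapply Rle_lt_trans; [apply norm3_nonneg | apply (HrZ (Phi p)); exists p; auto]. }
  destruct (resonant_fun_bound lam a1 a2 c rZ HrZ0 Hc (HZ cy1)) as (K & HK & HKb).
  assert (HKd := resonant_fun_cderiv lam a1 a2 c rZ HrZ0 Hc (HZ cy1)).
  set (s := (rZ / 2)%R) in *. set (V := (s * s)%R) in *.
  assert (HV : (0 < V)%R) by (unfold V, s; apply Rmult_lt_0_compat; lra).
  set (beta := (fst a1 - / 2)%R). assert (Hb := Rabs_pos beta).
  (* The [y] components of the images are bounded by B xi^2: at most xi^2 from the point itself and
     M (2 xi)^2 from the tangency. *)
  set (B := (1 + 4 * M)%R). assert (HB : (1 <= B)%R) by (unfold B; lra).
  assert (HB2 : (0 < B * B)%R) by nra.
  (* The bounds serve xi <= 1, images below d/4, and the two smallness conditions on h, given |h| <=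
     2 B^2 xi; the terms + 1 avoid a division by 0. *)
  set (xi0 := Rmin (Rmin 1 (d / (4 * B))) (Rmin (/ (32 * K * (B * B) + 1)) (V / (2 * (B * B) * Cmod lam + 1)))).
  assert (Q1 : (0 <= 32 * K * (B * B))%R) by (repeat apply Rmult_le_pos; lra).
  assert (Q2 : (0 <= 2 * (B * B) * Cmod lam)%R) by (repeat apply Rmult_le_pos; lra).
  assert (Hxi0 : (0 < xi0)%R).
  { repeat apply Rmin_pos; try lra; [apply Rdiv_lt_0_compat | apply Rinv_0_lt_compat | apply Rdiv_lt_0_compat]; lra. }
  set (A := (8 * (Cmod a1 + Cmod a2) * (1 + Rabs beta))%R).
  assert (HA : (0 <= A)%R).
  { assert (G1 := Cmod_ge_0 a1). assert (G2 := Cmod_ge_0 a2). repeat apply Rmult_le_pos; lra. }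
  assert (Hl1 : (0 < Cmod lam / xi0)%R) by (apply Rdiv_lt_0_compat; lra).
  assert (Hl2 : (0 < 4 * Cmod lam / d)%R) by (apply Rdiv_lt_0_compat; lra).
  (* The sum of all lower bounds imposed on [T]: |lam| / xi0 makes xi <= xi0, and 4 |lam| / d keeps
     |x| <= d/4 along the path. *)
  set (T := (8 + Rabs beta + A + Cmod lam / xi0 + 4 * Cmod lam / d)%R).
  assert (HT8 : (8 <= T)%R) by (unfold T; lra).
  assert (HTc : RtoC T <> 0) by (intros E; apply RtoC_inj in E; lra).
  set (xi := (Cmod lam / T)%R). assert (Hxi : (0 < xi)%R) by (apply Rdiv_lt_0_compat; lra).
  assert (HxiT : (xi * T = Cmod lam)%R) by (unfold xi; field; lra).
  assert (Hxixi : (xi <= xi0)%R).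
  { unfold xi. apply Rle_div_l; [lra|].
    assert (Q : (Cmod lam / xi0 <= T)%R) by (unfold T; lra).
    apply (Rmult_le_compat_l xi0) in Q; [|lra].
    replace (xi0 * (Cmod lam / xi0))%R with (Cmod lam) in Q by (field; lra). auto. }
  assert (X1 : (xi <= 1)%R).
  { eapply Rle_trans; [apply Hxixi|]. eapply Rle_trans; [apply Rmin_l|]. apply Rmin_l. }
  assert (X2 : (B * xi <= d / 4)%R).
  { assert (Q : (xi <= d / (4 * B))%R).
    { eapply Rle_trans; [apply Hxixi|]. eapply Rle_trans; [apply Rmin_l|]. apply Rmin_r. }
    apply (Rmult_le_compat_l B) in Q; [|lra]. replace (B * (d / (4 * B)))%R with (d / 4)%R in Q by (field; lra). auto. }
  assert (X3 : (32 * K * (B * B) * xi <= 1)%R).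
  { assert (Q : (xi <= / (32 * K * (B * B) + 1))%R).
    { eapply Rle_trans; [apply Hxixi|]. eapply Rle_trans; [apply Rmin_r|]. apply Rmin_l. }
    apply (Rmult_le_compat_l (32 * K * (B * B) + 1)) in Q; [|lra]. rewrite Rinv_r in Q by lra. lra. }
  assert (X4 : (2 * (B * B) * Cmod lam * xi < V)%R).
  { assert (Q : (xi <= V / (2 * (B * B) * Cmod lam + 1))%R).
    { eapply Rle_trans; [apply Hxixi|]. eapply Rle_trans; [apply Rmin_r|]. apply Rmin_r. }
    apply (Rmult_le_compat_l (2 * (B * B) * Cmod lam + 1)) in Q; [|lra].
    replace ((2 * (B * B) * Cmod lam + 1) * (V / (2 * (B * B) * Cmod lam + 1)))%R with V in Q by (field; lra). lra. }
  assert (Xd : (xi <= d / 4)%R) by nra.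
  set (x1 := Ci * lam * RtoC sg / RtoC T).
  assert (Nx1 : Cmod x1 = xi) by (unfold x1; rewrite Cx, Cmod_R, Rabs_pos_eq by (auto; lra); auto).
  set (p1 := (x1, RtoC 0, RtoC 0)).
  assert (Np1 : (norm3 p1 <= xi)%R).
  { apply norm3_le. intros []; cbn [co fst snd p1]; rewrite ?Cmod_0; lra. }
  (* The first bound gives |W0 - T| <= 1, as W is lam/x up to a unit factor; the second makes the
     [y] components of [p] at most xi^2. *)
  set (eta := Rmin (xi / (2 * T)) (xi * xi)).
  assert (E1 : (eta <= xi / (2 * T))%R) by apply Rmin_l. assert (E2 : (eta <= xi * xi)%R) by apply Rmin_r.
  assert (Heta : (0 < eta)%R) by (apply Rmin_pos; [apply Rdiv_lt_0_compat | apply Rmult_lt_0_compat]; lra).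
  assert (E3 : (eta <= xi / 2)%R).
  { eapply Rle_trans; [apply E1|]. unfold Rdiv. apply Rmult_le_compat_l; [lra|]. apply Rinv_le_contravar; lra. }
  exists p1, eta, T. split; [lra|]. split; [reflexivity|]. split.
  { apply HU. cbn [co fst snd p1]. rewrite Cmod_0. split; [|lra].
    assert (HTf : (0 < fst (RtoC T))%R) by (simpl; lra).
    apply sector_of_flow; auto. change (Cmod x1 < r)%R. lra. }
  split; auto. intros p Hp Up.
  set (x0 := co p cx).
  assert (D0 : (Cmod (x0 - x1) < eta)%R).
  { eapply Rle_lt_trans; [|apply Hp]. exact (norm3_co (sub3 p p1) cx). }
  assert (N0 : (xi / 2 <= Cmod x0)%R).
  { assert (Q := Cmod_triangle_rev x1 x0). rewrite Cmod_sub_comm in Q. lra. }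
  assert (Hx0 : x0 <> 0) by (apply Cmod_gt_0; lra).
  assert (Hx1 : x1 <> 0) by (apply Cmod_gt_0; lra).
  set (W0 := Ci * lam * RtoC sg / x0).
  assert (HW0 : (Cmod (W0 - RtoC T) <= 1)%R).
  { assert (ET : RtoC T = Ci * lam * RtoC sg / x1) by (unfold x1; field; auto).
    rewrite ET. unfold W0.
    replace (Ci * lam * RtoC sg / x0 - Ci * lam * RtoC sg / x1)
      with (Ci * lam * RtoC sg * (x1 - x0) / (x0 * x1)) by (field; auto).
    assert (Hxx : x0 * x1 <> 0) by (apply Cmult_neq_0; auto).
    rewrite Cmod_div, !Cmod_mult, Cmod_Ci, Csg, Nx1, Cmod_sub_comm by auto.
    apply Rle_div_l; [apply Rmult_lt_0_compat; lra|]. rewrite Rmult_1_l, Rmult_1_r, Rmult_1_l.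
    apply Rle_trans with (Cmod lam * (xi / (2 * T)))%R; [apply Rmult_le_compat_l; lra|].
    rewrite <- HxiT. replace (xi * T * (xi / (2 * T)))%R with (xi / 2 * xi)%R by (field; lra).
    apply Rmult_le_compat_r; lra. }
  assert (Np : (norm3 p <= 2 * xi)%R) by (assert (Q := norm3_sub_le p p1); lra).
  set (y10 := co (Phi p) cy1). set (y20 := co (Phi p) cy2).
  assert (By : forall i, i <> cx -> (Cmod (co (Phi p) i) <= B * (xi * xi))%R).
  { intros i Hne. replace (co (Phi p) i) with (co p i + co (sub3 (Phi p) p) i) by (destruct i; simpl; ring).
    eapply Rle_trans; [apply Cmod_triangle|].
    assert (R1 : (Cmod (co p i) <= eta)%R).
    { replace (co p i) with (co (sub3 p p1) i) by (destruct i; [congruence| |]; simpl; ring).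
      assert (Q := norm3_co (sub3 p p1) i). lra. }
    assert (R2 := norm3_co (sub3 (Phi p) p) i). assert (R3 := HT p Up ltac:(lra)).
    assert (R4 : (M * norm3 p ^ 2 <= M * (2 * xi) ^ 2)%R).
    { apply Rmult_le_compat_l; auto. apply pow_incr. split; [apply norm3_nonneg | auto]. }
    unfold B. lra. }
  assert (By1 : (Cmod y10 <= B * (xi * xi))%R) by (apply By; discriminate).
  assert (By2 : (Cmod y20 <= B * (xi * xi))%R) by (apply By; discriminate).
  assert (Byd : (B * (xi * xi) < d / 2)%R) by nra.
  assert (Bh : (Cmod (y10 * y20 * (- Ci * RtoC sg * W0 / lam)) <= 2 * (B * B) * xi)%R).
  { replace (- Ci * RtoC sg * W0 / lam) with (RtoC sg * RtoC sg * - (Ci * Ci) / x0) by (unfold W0; field; auto).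
    rewrite (sign_sq sg Hsg). replace (1 * - (Ci * Ci)) with (RtoC 1) by (apply injective_projections; simpl; ring).
    unfold Cdiv. rewrite !Cmod_mult, Cmod_1, Cmod_inv by auto.
    assert (Pinv : (/ Cmod x0 <= 2 * / xi)%R).
    { replace (2 * / xi)%R with (/ (xi / 2))%R by (field; lra). apply Rinv_le_contravar; lra. }
    assert (R1 : (Cmod y10 * Cmod y20 <= (B * (xi * xi)) * (B * (xi * xi)))%R)
      by (apply Rmult_le_compat; auto; apply Cmod_ge_0).
    rewrite Rmult_1_l.
    apply Rle_trans with ((B * (xi * xi)) * (B * (xi * xi)) * (2 * / xi))%R.
    - apply Rmult_le_compat; auto; [apply Rmult_le_pos; apply Cmod_ge_0 | left; apply Rinv_0_lt_compat; lra].
    - replace (B * (xi * xi) * (B * (xi * xi)) * (2 * / xi))%R with (2 * (B * B) * xi * (xi * xi))%R by (field; lra).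
      rewrite <- (Rmult_1_r (2 * (B * B) * xi)) at 2. apply Rmult_le_compat_l; [|nra].
      apply Rmult_le_pos; lra. }
  destruct (trajectory lam a1 a2 W0 y10 y20 sg T V K (resonant_fun c s)) as (x & y1 & y2 & kap & Ix & I1 & I2 & Tr); auto.
  { fold beta. unfold T. lra. }
  { fold beta. fold A. unfold T. lra. }
  { apply (Rmult_le_compat_l (16 * K)) in Bh; [|lra]. lra. }
  { apply (Rmult_le_compat_r (Cmod lam)) in Bh; lra. }
  set (G := fun t => (x t, y1 t, y2 t)).
  assert (G0 : G 0%R = Phi p).
  { unfold G. rewrite Ix, I1, I2. replace (Ci * lam * RtoC sg / W0) with x0 by (unfold W0; field; auto).
    unfold x0, y10, y20. rewrite <- Hfib by auto. destruct (Phi p) as [[? ?] ?]. reflexivity. }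
  (* Only exp u >= 1 + u is retained from the exponentials: decay like 1/t suffices to reach the
     origin. *)
  assert (Decay : forall t, (0 <= t)%R -> (Cmod (x t) < d / 2)%R /\
    (Cmod (x t) * (1 + t) <= Cmod lam)%R /\
    (forall i, i <> cx -> (Cmod (co (G t) i) * (1 + t / 4) <= B * (xi * xi))%R) /\ X (x t)).
  { intros t Ht. destruct (Tr t Ht) as (_ & _ & _ & _ & D1 & D2 & W & HW & Exw).
    assert (E := exp_ineq1_le t). assert (HWt : (T - 1 + t <= fst W)%R) by nra.
    assert (HW' := Cmod_ge_re W).
    assert (HWn : W <> 0) by (apply Cmod_gt_0; lra).
    assert (Nxt : (Cmod (x t) * Cmod W = Cmod lam)%R) by (rewrite Exw, Cx by auto; field; apply Rgt_not_eq; lra).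
    assert (Px := Cmod_ge_0 (x t)).
    assert (N1 : (Cmod (x t) * (T - 1 + t) <= Cmod lam)%R) by nra.
    assert (N2 : (Cmod (x t) * (1 + t) <= Cmod lam)%R) by nra.
    assert (HTd : (4 * Cmod lam <= d * (T - 1))%R).
    { assert (Q : (4 * Cmod lam / d <= T - 1)%R) by (unfold T; lra).
      apply (Rmult_le_compat_l d) in Q; [|lra].
      replace (d * (4 * Cmod lam / d))%R with (4 * Cmod lam)%R in Q by (field; lra). auto. }
    assert (N3 : (Cmod (x t) <= d / 4)%R).
    { apply (Rmult_le_reg_r (T - 1)); [lra|]. nra. }
    assert (N4 : (Cmod (x t) < d / 2)%R) by lra.
    split; [auto|]. split; [auto|]. split.
    - assert (Ex := exp_ineq1_le (t / 4)).
      assert (Ee : (exp (- / 4 * t) * exp (t / 4) = 1)%R).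
      { rewrite <- exp_plus. replace (- / 4 * t + t / 4)%R with 0%R by field. apply exp_0. }
      assert (Pe := exp_pos (- / 4 * t)).
      assert (Ed : (exp (- / 4 * t) * (1 + t / 4) <= 1)%R) by (rewrite <- Ee; apply Rmult_le_compat_l; lra).
      assert (Fin : forall y y0 : C, (Cmod y <= Cmod y0 * exp (- / 4 * t))%R -> (Cmod y0 <= B * (xi * xi))%R ->
        (Cmod y * (1 + t / 4) <= B * (xi * xi))%R).
      { intros y y0 F1 F2. apply Rle_trans with (Cmod y0 * (exp (- / 4 * t) * (1 + t / 4)))%R.
        - rewrite <- Rmult_assoc. apply Rmult_le_compat_r; lra.
        - assert (P0 := Cmod_ge_0 y0). nra. }
      intros [] Hne; [congruence | exact (Fin _ _ D1 By1) | exact (Fin _ _ D2 By2)].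
    - rewrite Exw. apply sector_of_flow; auto; [lra|]. rewrite <- Exw. lra. }
  assert (NG : forall t, (0 <= t)%R -> (norm3 (G t) < d / 2)%R /\ X (co (G t) cx)).
  { intros t Ht. destruct (Decay t Ht) as (R1 & _ & R2 & R3). split; auto.
    apply norm3_lt. intros i. destruct (classic (i = cx)) as [->|Hne]; auto.
    assert (Q := R2 i Hne). assert (P := Cmod_ge_0 (co (G t) i)). nra. }
  assert (Lift : forall t, (0 <= t)%R -> exists p', U p' /\ Phi p' = G t /\ (norm3 p' <= 2 * norm3 (G t))%R).
  { intros t Ht. destruct (NG t Ht) as [R1 R2].
    apply (picard_limit X rho U Phi M d HU Hanat Hfib HM Hd Hdrho HT HMd (G t) R2 R1). }
  assert (LiftPsi : forall t, (0 <= t)%R -> U (Psi (G t)) /\ Phi (Psi (G t)) = G t /\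
    (norm3 (Psi (G t)) <= 2 * norm3 (G t))%R).
  { intros t Ht. destruct (Lift t Ht) as (p' & R1 & R2 & R3). rewrite <- R2 at 1 2 4.
    rewrite HPsi by auto. rewrite R2. auto. }
  (* The estimate is available at every smaller scale [d']; this is how the limit 1 at the origin
     enters. *)
  assert (Near1 : forall t d', (0 <= t)%R -> (0 < d' <= d)%R -> (norm3 (G t) < d' / 2)%R ->
    (Cmod (jac_det Phi (Psi (G t)) - 1) <= 12 * M * d')%R).
  { intros t d' Ht Hd' Nt. destruct (LiftPsi t Ht) as (R1 & _ & R3).
    apply (jac_det_near_one X rho U Phi M d'); auto; try lra.
    - intros q Uq Nq. apply HT; auto. lra.
    - apply Rle_trans with (32 * M * d)%R; auto. apply Rmult_le_compat_l; lra. }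
  assert (HZx : feq (Z cx) (fmul (fvar cx) (fvar cx))) by (intros i j k; reflexivity).
  assert (Const : forall t, (0 <= t)%R -> jac_det Phi (Psi (G t)) = jac_det Phi p).
  { intros t Ht.
    rewrite (jac_det_constant_along_flow U Phi Psi Y Z G kap (sector_dom_open_in_y _ _ _ _ _) Hfib Han Hconj
      HYx HZx HYd (Ynorm_divergence _ _ _ _ Ha) HPsi HPan); auto.
    - rewrite G0, HPsi by auto. auto.
    - intros u Hu. destruct (Lift u Hu) as (p' & R1 & R2 & _). exists p'. auto.
    - intros u Hu i. destruct (Tr u Hu) as (T1 & T2 & T3 & T4 & _).
      assert (Nu : (norm3 (G u) < rZ)%R).
      { apply HrZ. destruct (Lift u Hu) as (p' & R1 & R2 & _). exists p'. auto. }
      destruct (psum_Ynorm lam a1 a2 c rZ HrZ0 Hc (HZ cy1) (G u) Nu) as [P1 P2]. fold s in P1, P2. fold Z in P1, P2.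
      destruct i.
      + rewrite (psum_x_sq _ _ HZx). exact T1.
      + rewrite P1. exact T2.
      + rewrite P2. exact T3.
    (* A zero of the determinant would give 1 <= 12 M d, while 12 M d <= 3/8. *)
    - intros u Hu E. assert (Q := Near1 u d Hu ltac:(lra) (proj1 (NG u Hu))).
      rewrite E in Q. replace (0 - 1) with (- (1)) in Q by ring. rewrite Cmod_m1 in Q. lra. }
  apply Csub_eq_0, Cmod_eq_0.
  apply (Rle_small_zero _ (12 * M) d); [apply Cmod_ge_0 | auto |].
  intros d' Hd'.
  (* At this time both bounds, with denominators 1 + t and 1 + t/4, are below d'/2. *)
  set (t := (4 * (Cmod lam + B * (xi * xi) + 1) / (d' / 2))%R).
  assert (Pb : (0 <= B * (xi * xi))%R) by (apply Rmult_le_pos; nra).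
  assert (Ht : (0 <= t)%R) by (unfold t; apply Rdiv_le_0_compat; lra).
  assert (Et : (t * (d' / 2) = 4 * (Cmod lam + B * (xi * xi) + 1))%R) by (unfold t; field; lra).
  rewrite <- (Const t Ht). apply Near1; [auto | lra |].
  destruct (Decay t Ht) as (_ & R1 & R2 & _).
  apply norm3_lt. intros i. assert (P := Cmod_ge_0 (co (G t) i)).
  destruct (classic (i = cx)) as [->|Hne].
  - change (co (G t) cx) with (x t) in *.
    apply Rnot_le_lt. intros Hge. nra.
  - assert (Q := R2 i Hne). apply Rnot_le_lt. intros Hge. nra.
Qed.

(** The domain is star-shaped about [p1], so segments issued from [p1] reach all its points, and
    each of them starts in the set where the determinant is known to be 1. *)
Lemma jac_det_one p0 : U p0 -> jac_det Phi p0 = 1.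
Proof.
  intros U0. destruct jac_det_one_on_open_set as (p1 & eta & T & HT & Ep1 & U1 & Heta & H1).
  set (v := sub3 p0 p1).
  assert (Seg : forall t, (0 <= t <= 1)%R -> U (move p1 t v)).
  { intros t Ht. destruct U0 as (X0 & A0 & B0), U1 as (X1 & A1 & B1).
    assert (Y1 : forall w : C, (Cmod w < rho)%R -> (Cmod (0 + RtoC t * (w - 0)) < rho)%R).
    { intros w Hw. replace (0 + RtoC t * (w - 0)) with (RtoC t * w) by ring.
      rewrite Cmod_mult, Cmod_R, Rabs_pos_eq by lra. assert (Q := Cmod_ge_0 w). nra. }
    subst p1. unfold move, v. simpl in X1. split; [|split]; [|exact (Y1 _ A0) | exact (Y1 _ B0)].
    apply sector_convex_comb; auto; [exists T; auto | apply X1]. }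
  assert (E1 : move p1 1 v = p0).
  { unfold move, v. destruct p0 as [[? ?] ?], p1 as [[? ?] ?]. simpl. f_equal; [f_equal|]; ring. }
  assert (Nv := norm3_nonneg v).
  (* While t < eta / (|v| + 1), the point stays within eta of [p1]; the + 1 covers v = 0. *)
  assert (H := identity_on_segment (fun q => jac_det Phi q - 1) p1 v (eta / (norm3 v + 1))).
  rewrite E1 in H. apply Csub_eq_0, H.
  - apply Rdiv_lt_0_compat; lra.
  - intros t Ht. apply analytic_minus; [|apply analytic_const]. apply analytic_jac_det.
    intros i. apply (Han i), Seg. auto.
  - intros t Ht Ht1. rewrite H1; [ring| |apply Seg; lra].
    assert (E0 : p1 = move p1 0 v).
    { unfold move. destruct p1 as [[? ?] ?]. simpl. f_equal; [f_equal|]; ring. }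
    rewrite E0 at 2. rewrite sub3_move, norm3_scal3, Rminus_0_r, Rabs_pos_eq by lra.
    apply Rle_lt_trans with (t * (norm3 v + 1))%R; [apply Rmult_le_compat_l; lra|].
    apply Rlt_div_r; lra.
Qed.

Lemma sectorial_symplectic : symplectic_on U Phi.
Proof.
  apply symplectic_of_jac_det; auto.
  - intros p (H & _). apply H.
  - apply jac_det_one.
Qed.

End Sectorial.

Theorem theorem1p22
    (lam : C) (Y : vfield)
    (HY : diagonal_drsn lam Y)
    (HYham : transversally_hamiltonian Y)
    (a1 a2 : C) (c : nat -> C)
    (Ha : (a1 + a2 = 1)%C) (Hc : c 0%nat = RtoC 0)
    (Phihat : coord -> fps)
    (Hfib : formal_fibered Phihat)
    (Hsymp : formal_symplectic Phihat)
    (Htan : formal_tangent_id Phihat)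
    (Hconj : formal_conj Phihat Y (Ynorm lam a1 a2 c))
    (eps rp rhop rm rhom : R)
    (Heps : (0 < eps < PI / 2)%R)
    (Hrp : (0 < rp)%R) (Hrhop : (0 < rhop)%R)
    (Hrm : (0 < rm)%R) (Hrhom : (0 < rhom)%R)
    (Phip Phim : C3 -> C3)
    (Hp : sectorial_normalizing (sector_dom 1 lam rp eps rhop)
            Y (Ynorm lam a1 a2 c) Phip)
    (Hm : sectorial_normalizing (sector_dom (-1) lam rm eps rhom)
            Y (Ynorm lam a1 a2 c) Phim) :
  symplectic_on (sector_dom 1 lam rp eps rhop) Phip /\
  symplectic_on (sector_dom (-1) lam rm eps rhom) Phim.
Proof.
  destruct HY as (Hlam & F1 & F2 & _ & _ & _ & _ & HYx & _).
  assert (HYd := hamiltonian_divergence Y HYx HYham).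
  assert (Main : forall sg r rho Phi, (sg = 1 \/ sg = -1)%R -> (0 < r)%R -> (0 < rho)%R ->
    sectorial_normalizing (sector_dom (RtoC sg) lam r eps rho) Y (Ynorm lam a1 a2 c) Phi ->
    symplectic_on (sector_dom (RtoC sg) lam r eps rho) Phi).
  { intros sg r rho Phi Hsg Hr Hrho (Hf & (Han & Psi & HPsi & HPan) & Ht & Hcj).
    apply (sectorial_symplectic sg lam a1 a2 c Y r eps rho Phi Psi); auto. }
  split.
  - apply (Main 1%R rp rhop); auto.
  - replace (-(1))%C with (RtoC (-1)) in * by (apply injective_projections; simpl; ring).
    apply (Main (-1)%R rm rhom); auto.
Qed.
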